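(* Let $n\ge1$, $0<s<1$, let $\Omega\subset\mathbb{R}^n$ be a bounded domain with $C^{1,1}$ boundary, $\Omega_e:=\mathbb{R}^n\setminus\overline\Omega$, and let $W_1,W_2\Subset\Omega_e$ be arbitrary nonempty open sets. For $j=1,2$ let $a_j=a_j(x,z):\Omega\times\mathbb{R}\to\mathbb{R}$ satisfy: $a_j(x,0)=0$, $\partial_za_j(x,0)\ge0$, and the map $\mathbb{R}\ni z\mapsto a_j(\cdot,z)$ is holomorphic with values in $C^s(\overline\Omega)$. Then there is a sufficiently small $\delta>0$ such that for any fixed $f\in C_c^\infty(W_1)\setminus\{0\}$ with $\|f\|_{C_c^\infty(W_1)}<\delta$, the following holds. Let $u_j$ be the (unique small) solution of $(-\Delta)^su_j+a_j(x,u_j)=0$ in $\Omega$ with $u_j=f$ in $\Omega_e$, and let $\Lambda_{a_j}$ be the corresponding DN map, $j=1,2$. If $\Lambda_{a_1}(f)|_{W_2}=\Lambda_{a_2}(f)|_{W_2}$, then $u_1=u_2$ and, with $u(x):=u_1(x)=u_2(x)$, $$a_1(x,u(x))=a_2(x,u(x))\qquad\text{for }x\in\Omega.$$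
   Context: For $0<s<1$, $(-\Delta)^su(x)=c_{n,s}\,\mathrm{P.V.}\int_{\mathbb{R}^n}\frac{u(x)-u(y)}{|x-y|^{n+2s}}\,dy$ with $c_{n,s}=\frac{\Gamma(n/2+s)}{|\Gamma(-s)|}\frac{4^s}{\pi^{n/2}}$ (the Fourier multiplier $|\xi|^{2s}$; for $u\in H^s(\mathbb{R}^n)$ it is an element of $H^{-s}(\mathbb{R}^n)$). For $0<\alpha<1$, $C^\alpha(U)$ is the Hölder space with norm $\|f\|_{L^\infty(U)}+\sup_{x\ne y}|f(x)-f(y)|/|x-y|^\alpha$. Holomorphy of $z\mapsto a(\cdot,z)$ with values in $C^s(\overline\Omega)$ means that $a(x,z)=\sum_{k\ge1}a_k(x)z^k/k!$ with $a_k=\partial_z^ka(\cdot,0)\in C^s(\overline\Omega)$, the series converging in $C^s(\overline\Omega)$ for every $z$. $\|f\|_{C_c^\infty(W)}$ denotes the norm used to measure the size of $f\in C_c^\infty(W)$; it is taken to be $\sum_{|\beta|\le2}\|\partial^\beta f\|_{L^\infty}$. Functions in $C_c^\infty(\Omega_e)$ are extended by zero to $\mathbb{R}^n$. $W\Subset\Omega_e$ means that $\overline W$ is compact and contained in $\Omega_e$. A solution of $(-\Delta)^su+a(x,u)=0$ in $\Omega$, $u=f$ in $\Omega_e$, is $u\in C^s(\mathbb{R}^n)\cap H^s(\mathbb{R}^n)$ with $u=f$ in $\Omega_e$ and $\int_{\mathbb{R}^n}(-\Delta)^{s/2}u\,(-\Delta)^{s/2}\varphi\,dx+\int_\Omega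 a(x,u)\varphi\,dx=0$ for all $\varphi\in C_c^\infty(\Omega)$. For $f\in C_c^\infty(\Omega_e)$ of sufficiently small norm there is a unique small solution $u_f$: there are $\varepsilon_0,\delta_0>0$ such that for $\|f\|_{C_c^\infty(\Omega_e)}\le\varepsilon_0$ there is exactly one solution $u_f$ with $\|u_f\|_{C^s(\mathbb{R}^n)}\le\delta_0$. The Dirichlet-to-Neumann (DN) map is $\Lambda_a(f)=(-\Delta)^su_f|_{\Omega_e}$, and $\Lambda_a(f)|_{W_2}$ is the restriction of the distribution $(-\Delta)^su_f$ to $W_2$. *)

(* Defs.v *)
From HB Require Import structures.
From mathcomp Require Import all_boot all_order all_algebra.
From mathcomp Require Import all_classical all_reals all_analysis.

Set Implicit Arguments.
Unset Strict Implicit.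
Unset Printing Implicit Defensive.

Import Order.TTheory GRing.Theory Num.Theory.
Import numFieldNormedType.Exports.

Local Open Scope classical_set_scope.
Local Open Scope ring_scope.

(** * Lebesgue measure on R^n

    R^n is ['rV[R]_n].  Its sigma-algebra is generated by the coordinate maps;
    this is the Borel sigma-algebra. *)

Fact rV_display : measure_display -> measure_display.
Proof. exact. Qed.

Definition rV_coord (R : realType) (n : nat) (i : 'I_n) (x : 'rV[R]_n) :
  measurableTypeR R := x ord0 i.

Section measurable_rV.
Variables (R : realType) (n : nat).

Let coords : 'I_n -> 'rV[R]_n -> measurableTypeR R := @rV_coord R n.

Let rV_set0 : g_sigma_preimage coords set0.
Proof. exact: sigma_algebra0. Qed.

Let rV_setC A : g_sigma_preimage coords A -> g_sigma_preimage coords (~` A).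
Proof. exact: sigma_algebraC. Qed.

Let rV_bigcup (F : (set 'rV[R]_n)^nat) :
  (forall i, g_sigma_preimage coords (F i)) ->
  g_sigma_preimage coords (\bigcup_i (F i)).
Proof. exact: sigma_algebra_bigcup. Qed.

HB.instance Definition _ := @isMeasurable.Build (rV_display default_measure_display)
  'rV[R]_n (g_sigma_preimage coords) rV_set0 rV_setC rV_bigcup.

Lemma measurable_rV_coord (i : 'I_n) :
  measurable_fun [set: 'rV[R]_n] (@rV_coord R n i).
Proof.
move=> _ Y mY; rewrite setTI; apply: sub_sigma_algebra => /=.
rewrite -bigcup_seq/=; exists i => /=; first by rewrite mem_index_enum.
by exists Y => //; rewrite setTI.
Qed.

Lemma measurable_fun_rVP d (T : measurableType d) (f : T -> 'rV[R]_n) :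
  (forall i, measurable_fun [set: T] (@rV_coord R n i \o f)) ->
  measurable_fun [set: T] f.
Proof.
move=> mf _ Y mY; rewrite setTI.
pose S := [set A : set 'rV[R]_n | measurable (f @^-1` A)].
suff : g_sigma_preimage coords `<=` S by apply.
apply: smallest_sub => /=.
  split => /=; rewrite /S /=.
  - by rewrite preimage_set0; exact: measurable0.
  - by move=> A mA; rewrite setTD preimage_setC; exact: measurableC.
  - by move=> F mF; rewrite preimage_bigcup; exact: bigcup_measurable.
rewrite -bigcup_seq => A [i _ [B mB <-]]; rewrite /S/= setTI.
by have := mf i measurableT B mB; rewrite setTI.
Qed.

End measurable_rV.

Section rV_cons.
Variables (R : realType) (n : nat).

Definition rV_cons (p : measurableTypeR R * 'rV[R]_n) : 'rV[R]_n.+1 :=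
  row_mx (const_mx p.1 : 'rV_1) p.2.

Definition rV_uncons (x : 'rV[R]_n.+1) : measurableTypeR R * 'rV[R]_n :=
  (x ord0 ord0, rsubmx (x : 'rV_(1 + n))).

Lemma rV_consK : cancel rV_cons rV_uncons.
Proof.
move=> [a v]; rewrite /rV_uncons /rV_cons /= row_mxKr; congr pair.
apply: etrans (etrans (row_mxEl (const_mx a : 'rV_1) v ord0 ord0) (mxE _ _ _ _)).
by congr (row_mx _ _ _ _); exact: val_inj.
Qed.

Lemma measurable_rV_cons : measurable_fun setT rV_cons.
Proof.
apply: measurable_fun_rVP => i.
have [j ->|j ->] := split_ordP (i : 'I_(1 + n)).
- rewrite (_ : _ \o _ = fst); first exact: measurable_fst.
  by apply/funext => p; exact: etrans (row_mxEl _ _ _ _) (mxE _ _ _ _).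
- rewrite (_ : _ \o _ = @rV_coord R n j \o snd).
    by apply: measurableT_comp; [exact: measurable_rV_coord|exact: measurable_snd].
  by apply/funext => p; exact: row_mxEr.
Qed.

Lemma measurable_rV_uncons : measurable_fun setT rV_uncons.
Proof.
apply/measurable_fun_pairP; split; first exact: (measurable_rV_coord ord0).
apply: measurable_fun_rVP => i.
rewrite (_ : _ \o _ = @rV_coord R n.+1 (rshift 1 i)).
  exact: measurable_rV_coord.
by apply/funext => x; rewrite /= /rV_coord mxE.
Qed.

Section pushforward_cons.
Variable mu : {sigma_finite_measure set 'rV[R]_n -> \bar R}.

Definition leb_cons : set 'rV[R]_n.+1 -> \bar R :=
  pushforward (lebesgue_measure \x mu)%E rV_cons.

HB.instance Definition _ := Measure.copy leb_cons
  (measure_function_pushforward__canonical__measure_function_Measure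
    (lebesgue_measure \x mu)%E measurable_rV_cons).

Let leb_cons_sigma_finite : sigma_finite setT leb_cons.
Proof.
have /sigma_finiteP[F [FT ndF Foo]] :=
  @sigma_finiteT _ _ _ (@lebesgue_measure R).
have /sigma_finiteP[G [GT ndG Goo]] := sigma_finiteT mu.
exists (fun i => rV_uncons @^-1` (F i `*` G i)).
  rewrite -preimage_bigcup; apply/esym/seteqP; split=> // x _ /=.
  have [k _ Fk] : (\bigcup_i F i) (rV_uncons x).1 by rewrite -FT.
  have [l _ Gl] : (\bigcup_i G i) (rV_uncons x).2 by rewrite -GT.
  exists (maxn k l) => //; split.
  - by move: Fk; exact/subsetPset/ndF/leq_maxl.
  - by move: Gl; exact/subsetPset/ndG/leq_maxr.
move=> i; have [mF Fi] := Foo i; have [mG Gi] := Goo i; split.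
  rewrite -[X in measurable X]setTI; apply: measurable_rV_uncons => //.
  exact: measurableX.
rewrite /leb_cons /pushforward -comp_preimage.
rewrite (_ : rV_uncons \o rV_cons = id); last exact/funext/rV_consK.
by rewrite preimage_id product_measure1E// lte_mul_pinfty// ge0_fin_numE.
Qed.

HB.instance Definition _ := Measure_isSigmaFinite.Build _ _ _ leb_cons
  leb_cons_sigma_finite.

End pushforward_cons.
End rV_cons.

(* lebesgue_measure \x ... \x lebesgue_measure (n factors) *)
Fixpoint leb (R : realType) (n : nat) :
    {sigma_finite_measure set 'rV[R]_n -> \bar R} :=
  match n with
  | 0 => dirac (0 : 'rV[R]_0)
  | m.+1 => leb_cons (leb R m)
  end.

(** * Function spaces *)

Section function_spaces.
Variables (R : realType) (n : nat).
Implicit Types (x y : 'rV[R]_n) (u f g : 'rV[R]_n -> R) (U : set 'rV[R]_n).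

(* The library norm on ['rV[R]_n] is the maximum norm; this is the Euclidean
   one. *)
Definition enorm x : R := Num.sqrt (\sum_(i < n) x ord0 i ^+ 2).

Definition unit_vec (i : 'I_n) : 'rV[R]_n := delta_mx ord0 i.

Definition partial (i : 'I_n) f : 'rV[R]_n -> R := fun x => 'D_(unit_vec i) f x.

(* partial derivatives successively in the directions listed in l *)
Definition partials (l : seq 'I_n) f : 'rV[R]_n -> R := foldr partial f l.

Definition smooth f : Prop := forall l : seq 'I_n,
  continuous (partials l f) /\
  forall (i : 'I_n) x, derivable (partials l f) x (unit_vec i).

Definition supp f : set 'rV[R]_n := closure [set x | f x != 0].

(* C_c^oo(U), its elements being extended by zero to R^n *)
Definition Cc_infty U : set ('rV[R]_n -> R) :=
  [set f | [/\ smooth f, compact (supp f) & supp f `<=` U]].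

Definition sup_norm f : R := sup [set `|f x| | x in setT].

Definition multi_partial (beta : 'I_n -> nat) f : 'rV[R]_n -> R :=
  foldr (fun i g => iter (beta i) (partial i) g) f (enum 'I_n).

(* the sum over multi-indices of order at most 2 of the sup norms *)
Definition Cc_norm f : R :=
  \sum_(beta : {ffun 'I_n -> 'I_3} | (\sum_(i < n) beta i <= 2)%N)
     sup_norm (multi_partial (fun i => beta i : nat) f).

(* The norm of C^alpha(U), equal to +oo outside of this space.  The functions
   of the space are continuous, so that a supremum is enough for the first
   term. *)
Definition hoelder_norm (alpha : R) U f : \bar R :=
  (ereal_sup [set `|f x|%:E | x in U] +
   ereal_sup [set (`|f p.1 - f p.2| / enorm (p.1 - p.2) `^ alpha)%:E |
     p in [set p : 'rV[R]_n * 'rV[R]_n | [/\ U p.1, U p.2 & p.1 != p.2]]])%E.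

Definition hoelder_space (alpha : R) U : set ('rV[R]_n -> R) :=
  [set f | (hoelder_norm alpha U f < +oo)%E].

(* H^s(R^n), through the Gagliardo seminorm *)
Definition Hs (s : R) : set ('rV[R]_n -> R) :=
  [set u | u \in Lfun (leb R n) 2%:E /\
    (\int[leb R n]_x \int[leb R n]_y
       (`|u x - u y| ^+ 2 / enorm (x - y) `^ (n%:R + 2 * s))%:E < +oo)%E].

End function_spaces.

(** * The fractional Laplacian *)

Section fractional_laplacian.
Variables (R : realType).

Definition Gamma_pos (t : R) : R :=
  \int[lebesgue_measure]_(x in `]0, +oo[) (x `^ (t - 1) * expR (- x)).

(* Euler's Gamma function for t > -1, t <> 0 *)
Definition Gamma (t : R) : R :=
  if 0 < t then Gamma_pos t else Gamma_pos (t + 1) / t.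

Definition frac_lap_const (n : nat) (s : R) : R :=
  Gamma (n%:R / 2 + s) / `|Gamma (- s)| * (4 `^ s / pi `^ (n%:R / 2)).

Variable n : nat.
Implicit Types (u g f phi : 'rV[R]_n -> R).

Definition frac_lap (s : R) u : 'rV[R]_n -> R := fun x =>
  frac_lap_const n s *
  lim ((\int[leb R n]_(y in [set y | (eps < enorm (x - y))%R])
          ((u x - u y) / enorm (x - y) `^ (n%:R + 2 * s)))
       @[eps --> 0^'+]).

(* (-Delta)^s u as a distribution: <(-Delta)^s u, phi> = <u, (-Delta)^s phi>.
   For u in H^s(R^n) this is the element of H^-s(R^n) given by the Fourier
   multiplier |xi|^(2s). *)
Definition frac_lap_distr (s : R) u : ('rV[R]_n -> R) -> R := fun phi =>
  \int[leb R n]_x (u x * frac_lap s phi x).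

(* the distribution (-Delta)^s u is the L^2 function g *)
Definition frac_lap_L2 (s : R) u g : Prop :=
  g \in Lfun (leb R n) 2%:E /\
  forall phi, Cc_infty setT phi ->
    frac_lap_distr s u phi = \int[leb R n]_x (g x * phi x).

Definition eq_distr_on (W : set 'rV[R]_n) (T1 T2 : ('rV[R]_n -> R) -> R) : Prop :=
  forall phi, Cc_infty W phi -> T1 phi = T2 phi.

End fractional_laplacian.

(** * Domains *)

Section domains.
Variables (R : realType) (n : nat).
Implicit Types (Omega W : set 'rV[R]_n).

Definition is_domain Omega : Prop :=
  [/\ open Omega, connected Omega & Omega !=set0].

Definition C11 (gamma : 'rV[R]_n -> R) : Prop :=
  (forall (i : 'I_n) x, derivable gamma x (unit_vec R i)) /\
  exists L : R, forall (i : 'I_n) x y,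
    `|partial i gamma x - partial i gamma y| <= L * enorm (x - y).

(* In the coordinates (x - x0) *m Q near a boundary point x0, Omega lies above
   the graph of a C^{1,1} function gamma of the coordinates other than the
   i-th one. *)
Definition C11_boundary Omega : Prop :=
  forall x0, (closure Omega `\` interior Omega) x0 ->
    exists (r : R) (Q : 'M[R]_n) (i : 'I_n) (gamma : 'rV[R]_n -> R),
      [/\ 0 < r, Q *m Q^T = 1%:M, C11 gamma,
          forall y t, gamma (y + t *: unit_vec R i) = gamma y &
          forall x, enorm (x - x0) < r ->
            (Omega x <-> gamma ((x - x0) *m Q) < ((x - x0) *m Q) ord0 i)].

Definition exterior Omega : set 'rV[R]_n := ~` closure Omega.

Definition compactly_inside W U : Prop :=
  compact (closure W) /\ closure W `<=` U.

End domains.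

(** * The semilinear problem *)

Section semilinear.
Variables (R : realType) (n : nat) (s : R) (Omega : set 'rV[R]_n).
Implicit Types (a : 'rV[R]_n -> R -> R) (u f : 'rV[R]_n -> R).

Definition taylor_coef a (k : nat) : 'rV[R]_n -> R := fun x => derive1n k (a x) 0.

(* Since a(., z) belongs to C^s(closure Omega), a stands here for its extension
   to closure Omega. *)
Definition holomorphic_Cs a : Prop :=
  (forall k, (1 <= k)%N -> hoelder_space s (closure Omega) (taylor_coef a k)) /\
  forall z : R,
    hoelder_norm s (closure Omega)
      (fun x => a x z - \sum_(1 <= k < N) taylor_coef a k x * z ^+ k / k`!%:R)
    @[N --> \oo] --> 0%E.

Definition admissible a : Prop :=
  [/\ forall x, Omega x -> a x 0 = 0,
      forall x, Omega x -> 0 <= derive1 (a x) 0 &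
      holomorphic_Cs a].

(* In the last condition g is (-Delta)^(s/2) u. *)
Definition is_solution a f u : Prop :=
  [/\ hoelder_space s setT u, Hs s u,
      forall x, exterior Omega x -> u x = f x &
      exists g, frac_lap_L2 (s / 2) u g /\
        forall phi, Cc_infty Omega phi ->
          \int[leb R n]_x (g x * frac_lap (s / 2) phi x) +
          \int[leb R n]_(x in Omega) (a x (u x) * phi x) = 0].

Definition is_small_solution a (delta0 : R) f u : Prop :=
  is_solution a f u /\ (hoelder_norm s setT u <= delta0%:E)%E.

(* The thresholds eps0, delta0 > 0 define the unique small solution for data of
   norm at most eps0. *)
Definition well_posed a (eps0 delta0 : R) : Prop :=
  [/\ 0 < eps0, 0 < delta0 &
      forall f, Cc_infty (exterior Omega) f -> Cc_norm f <= eps0 ->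
        exists! u, is_small_solution a delta0 f u].

(* u_f, when there is exactly one small solution *)
Definition small_solution a (delta0 : R) f : 'rV[R]_n -> R :=
  xget (cst 0) [set u | is_small_solution a delta0 f u].

(* The Dirichlet-to-Neumann map; Lambda_a(f) is a distribution, to be tested
   against functions of C_c^oo(exterior Omega). *)
Definition DN_map a (delta0 : R) f : ('rV[R]_n -> R) -> R :=
  frac_lap_distr s (small_solution a delta0 f).

End semilinear.

(* Main.v *)
Require Import Defs.
From mathcomp Require Import all_boot all_order all_algebra.
From mathcomp Require Import all_classical all_reals all_analysis.
From mathcomp Require Import measurable_realfun.
From mathcomp Require Import ring lra.

Set Implicit Arguments.
Unset Strict Implicit.
Unset Printing Implicit Defensive.

Import Order.TTheory GRing.Theory Num.Theory.
Import numFieldNormedType.Exports.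

Local Open Scope classical_set_scope.
Local Open Scope ring_scope.

(** The theorem rests on the antilocality of the fractional Laplacian: a
    single exterior measurement determines the whole solution.

    Put [w = u1 - u2], which vanishes outside the compact set
    [K = closure Omega].  Equality of the two Dirichlet-to-Neumann data on
    [W2] means that [w] annihilates [(-Delta)^s phi] for all [phi] supported in
    [W2].  As the support of [phi] avoids [K], [(-Delta)^s phi (x)] is, for [x] in
    [K], a nonzero constant times the integral of [phi y / |x - y|^(n+2s)]
    ([frac_lap_off_support], [frac_lap_const_neq0]).  Exchanging the two
    integrals ([bump_pairing]) shows that the Riesz potential
    [G y = \int_K w x |x - y|^(-2q) dx], with [q = n/2 + s], vanishes on an open
    set disjoint from [K].

    That [G = 0] near one point forces [w = 0] is proved by elementary means
    ([riesz_potential_unique_continuation]).  The Laplacian in [y] maps the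
    kernel [|x - y|^(-2q)] to a multiple of [|x - y|^(-2(q+1))], and the factor
    is nonzero as [2 (q + 1) > n]; so all potentials of exponents
    [q, q + 1, q + 2, ...] vanish on the open set.  For a fixed [y] there, this
    says that [w x |x - y|^(-2q)] has zero moments with respect to the bounded
    function [|x - y|^(-2)] of [x].  By Weierstrass approximation
    ([moments_lipschitz]) it is then orthogonal to all Lipschitz functions of
    [|x - y|^(-2)], which yields that the integrals of [w x |x - y|^(2j)]
    vanish.  These are polynomials in [y], hence vanish for all [y], not only
    on the open set.  A second application of the approximation theorem, now to
    functions of [|x - y|^2], shows that [w] is orthogonal to all tents
    [max 0 (eps - |x - y|^2)], of arbitrary centre and width.  As [w] is
    continuous, it vanishes.

    Once [u1 = u2 = u], both weak formulations contain the same function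
    [(-Delta)^(s/2) u], determined almost everywhere by [u]
    ([Lfun2_test_ae_eq]).  Their difference leaves
    [\int_Omega (a1 (x, u x) - a2 (x, u x)) phi x dx = 0] for the test functions
    of [Omega].  The Taylor series of [a_j] converges uniformly on bounded sets
    of [z], so that [x |-> a_j (x, u x)] is continuous
    ([nonlinearity_continuous]), and the two nonlinearities agree along [u].

    The only test functions needed in the proof are products of functions
    [exp (-1/t)] of the coordinates, positive on a box and zero elsewhere. *)

(** * Polynomial approximation and vanishing moments *)

Section bernstein.
Variable R : realType.
Implicit Types (g : nat -> R) (x y c e C L : R).

(** The Bernstein polynomial [\sum_k g k 'C(N, k) x^k (1 - x)^(N - k)], in the
    recursive form given by conditioning on the first of [N] coin tosses; it makes
    the induction of [bernstein_dist] immediate. *)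
Fixpoint bernstein (N : nat) g : {poly R} :=
  if N is M.+1 then 'X * bernstein M (g \o succn) + (1 - 'X) * bernstein M g
  else (g 0%N)%:P.

(** Bernstein's variance estimate.  If [S] is binomial of parameters [N] and
    [x], the bound is the expectation of [e + C (S - c)^2]: the variance
    [N x (1 - x)] plus the squared bias.  The centre [c] is arbitrary since the
    induction step replaces it by [c - 1]. *)
Lemma bernstein_dist N g x y e C c : 0 <= x <= 1 ->
  (forall k, (k <= N)%N -> `|g k - y| <= e + C * (k%:R - c) ^+ 2) ->
  `|(bernstein N g).[x] - y| <=
    e + C * (N%:R * (x * (1 - x)) + (N%:R * x - c) ^+ 2).
Proof.
move=> x01; elim: N g c => [|N IH] g c H /=.
  by have := H 0%N isT; rewrite hornerC mulr0n !mul0r !add0r.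
rewrite hornerD !hornerM hornerD hornerN hornerX hornerC.
have /IH H1 : forall k, (k <= N)%N ->
    `|(g \o succn) k - y| <= e + C * (k%:R - (c - 1)) ^+ 2.
  move=> k kN /=; apply: le_trans (H k.+1 _) _ => //.
  by rewrite -natr1 opprB addrA addrAC.
have /IH H2 : forall k, (k <= N)%N -> `|g k - y| <= e + C * (k%:R - c) ^+ 2.
  by move=> k kN; apply: H; exact: leqW.
move: x01 => /andP[x0 x1].
rewrite (_ : _ - y = x * ((bernstein N (g \o succn)).[x] - y) +
   (1 - x) * ((bernstein N g).[x] - y)); last by ring.
rewrite (le_trans (ler_normD _ _))// !normrM (ger0_norm x0).
rewrite (@ger0_norm _ (1 - x)) ?subr_ge0//.
have := ler_wpM2l x0 H1; have : 0 <= 1 - x by rewrite subr_ge0.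
move=> x1' H1'; have H2' := ler_wpM2l x1' H2.
apply: le_trans (lerD H1' H2') _.
rewrite -natr1 le_eqVlt; apply/orP; left; apply/eqP; ring.
Qed.

Lemma lipschitz01_poly_approx (f : R -> R) L e : 0 < e ->
  (forall x y, 0 <= x <= 1 -> 0 <= y <= 1 -> `|f x - f y| <= L * `|x - y|) ->
  exists p : {poly R}, forall x, 0 <= x <= 1 -> `|p.[x] - f x| <= e.
Proof.
move=> e0 fL.
have L0 : 0 <= L.
  have := fL 1 0; rewrite !lexx !ler01 subr0 normr1 mulr1 => /(_ isT isT).
  exact: le_trans.
(* A deviation t of k / N from x costs L d if |t| <= d, and L t^2 / d
   otherwise; the second kind is controlled by the variance, 1 / N. *)
have [d d0 Ld] : exists2 d, 0 < d & L * d <= e / 2.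
  have L1 : 0 < L + 1 by rewrite ltr_wpDl.
  exists (e / (2 * (L + 1))); first by rewrite divr_gt0// mulr_gt0.
  by rewrite mulrA ler_pdivrMr ?mulr_gt0//; nra.
have [N [N0 HN]] : exists N, (0 < N)%N /\ L / (d * N%:R) <= e / 2.
  pose M := (Num.truncn (2 * L / (d * e))).+1.
  have HM : 2 * L / (d * e) < M%:R := truncnS_gt _.
  have M0 : 0 < M%:R :> R by rewrite ltr0n.
  exists M; split => //.
  rewrite ler_pdivrMr ?mulr_gt0//.
  by move: HM; rewrite ltr_pdivrMr ?mulr_gt0// => /ltW; nra.
exists (bernstein N (fun k => f (k%:R / N%:R))) => x x01.
have N0' : 0 < N%:R :> R by rewrite ltr0n.
have /(@bernstein_dist N (fun k => f (k%:R / N%:R)) x (f x) (L * d)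
    (L / (d * N%:R ^+ 2)) (N%:R * x) x01) : forall k, (k <= N)%N ->
    `|f (k%:R / N%:R) - f x| <=
      L * d + L / (d * N%:R ^+ 2) * (k%:R - N%:R * x) ^+ 2.
  move=> k kN.
  have kN1 : 0 <= (k%:R / N%:R : R) <= 1.
    by rewrite divr_ge0 ?ler0n//= ler_pdivrMr// mul1r ler_nat.
  rewrite (le_trans (fL _ _ kN1 x01))//.
  have -> : k%:R - N%:R * x = N%:R * (k%:R / N%:R - x) :> R.
    by field; rewrite gt_eqF.
  set t := _ / _ - x.
  have -> : L / (d * N%:R ^+ 2) * (N%:R * t) ^+ 2 = L * (t ^+ 2 / d).
    by field; rewrite !gt_eqF.
  rewrite -mulrDr ler_wpM2l// -real_normK ?num_real//.
  have : 0 <= `|t| by [].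
  move: `|t| => {}t t0.
  have [td|td] := leP t d.
    by rewrite (le_trans td)// lerDl divr_ge0// ?exprn_ge0// ltW.
  by rewrite ler_wpDl ?(ltW d0)// ler_pdivlMr// expr2 ler_wpM2l// ltW.
rewrite subrr expr0n addr0 => H; apply: le_trans H _.
have x4 : x * (1 - x) <= 1 by nra.
have : L / (d * N%:R ^+ 2) * (N%:R * (x * (1 - x))) <= L / (d * N%:R).
  have -> : L / (d * N%:R ^+ 2) * (N%:R * (x * (1 - x))) =
    L / (d * N%:R) * (x * (1 - x)) by field; rewrite !gt_eqF.
  rewrite ler_piMr// divr_ge0// mulr_ge0// ltW//.
move: Ld HN; lra.
Qed.

Lemma lipschitz_poly_approx (f : R -> R) (a b : R) L e : a < b -> 0 < e ->
  (forall x y, a <= x <= b -> a <= y <= b -> `|f x - f y| <= L * `|x - y|) ->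
  exists p : {poly R}, forall x, a <= x <= b -> `|p.[x] - f x| <= e.
Proof.
move=> ab e0 fL; have ba : 0 < b - a by rewrite subr_gt0.
have H t : 0 <= t <= 1 -> a <= a + (b - a) * t <= b by move=> /andP[? ?]; nra.
pose h t := f (a + (b - a) * t).
have hL x y : 0 <= x <= 1 -> 0 <= y <= 1 ->
    `|h x - h y| <= L * (b - a) * `|x - y|.
  move=> x01 y01; apply: le_trans (fL _ _ (H x x01) (H y y01)) _.
  rewrite (_ : a + _ - _ = (b - a) * (x - y)); last by ring.
  by rewrite normrM gtr0_norm// mulrA.
have [p Hp] := lipschitz01_poly_approx e0 hL.
exists (p \Po ((b - a)^-1 *: ('X - a%:P))) => x axb.
rewrite horner_comp !hornerE.
have x01 : 0 <= (b - a)^-1 * (x - a) <= 1.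
  move: axb => /andP[ax xb]; apply/andP; split.
    by rewrite mulr_ge0 ?subr_ge0 ?invr_ge0// ltW.
  by rewrite ler_pdivrMl// mulr1 lerD2r.
have := Hp _ x01; rewrite /h (_ : a + _ = x)//.
by field; rewrite gt_eqF.
Qed.

End bernstein.

Section moments.
Context d (T : measurableType d) (R : realType) (mu : {measure set T -> \bar R}).
Variables (D : set T) (v g : T -> R) (a b : R).
Hypothesis mD : measurable D.
Hypothesis intv : mu.-integrable D (EFin \o v).
Hypothesis mg : measurable_fun D g.
Hypothesis ab : a < b.
Hypothesis gab : forall x, D x -> a <= g x <= b.

(** Most integrands below are products of an integrable and a bounded function. *)
Lemma integrable_mul_bounded (h : T -> R) M : measurable_fun D h ->
  (forall x, D x -> `|h x| <= M) ->
  mu.-integrable D (fun x => (v x * h x)%:E).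
Proof.
move=> mh hM; have := @integrableMl _ _ _ mu D mD (EFin \o v) h intv mh.
apply; exists M; split; first exact: num_real.
by move=> y My x Dx /=; apply: le_trans (hM _ Dx) _; exact: ltW.
Qed.

(** An integrable [v] that is orthogonal to the powers of a bounded function [g]
    is orthogonal to the polynomials in [g], thus, by uniform approximation on
    the range of [g], to the Lipschitz functions of [g]. *)
Lemma moments_lipschitz (h : R -> R) L :
  (forall k, \int[mu]_(x in D) (v x * g x ^+ k) = 0) ->
  measurable_fun D (h \o g) ->
  (forall x y, a <= x <= b -> a <= y <= b -> `|h x - h y| <= L * `|x - y|) ->
  \int[mu]_(x in D) (v x * h (g x)) = 0.
Proof.
move=> mom mh hL.
have gb x : D x -> `|g x| <= `|a| + `|b|.
  move=> /gab /andP[ax xb]; rewrite ler_norml; apply/andP; split.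
    rewrite lerNl; have := ler_norm (- a); rewrite normrN.
    have := normr_ge0 b; lra.
  have := ler_norm b; have := normr_ge0 a; lra.
have intg k : mu.-integrable D (fun x => (v x * g x ^+ k)%:E).
  apply: (@integrable_mul_bounded (fun x => g x ^+ k) ((`|a| + `|b|) ^+ k)).
    exact: measurable_funX.
  by move=> x Dx; rewrite normrX lerXn2r// ?nnegrE ?addr_ge0// gb.
have intp (p : {poly R}) : mu.-integrable D (fun x => (v x * p.[g x])%:E).
  have -> : (fun x => (v x * p.[g x])%:E) =
     (fun x => \sum_(i < size p) ((p`_i)%:E * (v x * g x ^+ i)%:E)%E)%E.
    apply/funext => x; rewrite horner_coef mulr_sumr -sumEFin.
    by apply: eq_bigr => i _; rewrite -EFinM mulrCA.
  by apply: integrable_sum => // i _; exact: integrableZl.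
have int0 (p : {poly R}) : \int[mu]_(x in D) (v x * p.[g x]) = 0.
  elim/poly_ind: p => [|p c IH].
    by under eq_Rintegral do rewrite horner0 mulr0; rewrite Rintegral_cst// mul0r.
  have H (q : {poly R}) k : \int[mu]_(x in D) (v x * (q * 'X^k).[g x]) = 0.
    elim/poly_ind: q k => [|q e IHq] k.
      by under eq_Rintegral do rewrite mul0r horner0 mulr0; rewrite Rintegral_cst// mul0r.
    under eq_Rintegral => x _ do
      rewrite mulrDl -mulrA -exprS hornerD mulrDr.
    rewrite RintegralD// ?IHq ?add0r; [|exact: intp|exact: intp].
    under eq_Rintegral => x _ do rewrite hornerM hornerC hornerXn mulrCA.
    by rewrite RintegralZl// ?mom ?mulr0//; exact: intg.
  by have := H (p * 'X + c%:P) 0%N; rewrite expr0 mulr1.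
have intn : mu.-integrable D (fun x => `|v x|%:E) by exact: integrable_norm.
set I := \int[mu]_(x in D) `|v x|.
have I0 : 0 <= I by apply: Rintegral_ge0.
have Hhb x : D x -> `|h (g x)| <= `|h a| + `|L| * (b - a).
  move=> Dx; have axb := gab Dx; move: (axb) => /andP[ax xb].
  have aab : a <= a <= b by rewrite lexx (le_trans ax).
  rewrite -[h (g x)](subrK (h a)) addrC (le_trans (ler_normD _ _))//.
  rewrite lerD2l (le_trans (hL _ _ axb aab))//.
  rewrite (le_trans (ler_wpM2r _ (ler_norm L)))// ler_wpM2l//.
  by rewrite ger0_norm ?subr_ge0// lerB.
have inth : mu.-integrable D (fun x => (v x * h (g x))%:E).
  exact: (integrable_mul_bounded mh Hhb).
apply/eqP; rewrite -normr_le0; apply/ler_addgt0Pl => e e0; rewrite addr0.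
pose e' := e / (I + 1).
have e'0 : 0 < e' by rewrite divr_gt0// ltr_wpDl.
have [p Hp] := lipschitz_poly_approx ab e'0 hL.
rewrite -[X in `|X|]subr0 -(int0 p) -(RintegralB mD inth (intp p)).
have intB : mu.-integrable D (EFin \o (fun x => v x * h (g x) - v x * p.[g x])).
  exact: (integrableB mD inth (intp p)).
apply: le_trans (le_normr_Rintegral mD intB) _.
apply: (@le_trans _ _ (\int[mu]_(x in D) (e' * `|v x|))).
  apply: le_Rintegral => //.
  - exact: integrable_norm.
  - exact: (@integrableZl _ _ _ mu D mD e' (fun x => `|v x|%:E)).
  - move=> x Dx; rewrite -mulrBr normrM mulrC ler_wpM2r// distrC; exact/Hp/gab.
rewrite (RintegralZl _ mD intn) -/I /e' mulrAC ler_pdivrMr ?ltr_wpDl//.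
by rewrite ler_pM2l// lerDl.
Qed.

End moments.

(** * Borel sets and Lebesgue measure of R^n *)

Section boxes.
Variables (R : realType) (n : nat).
Implicit Types (a b c x y : 'rV[R]_n) (U A : set 'rV[R]_n).

Lemma measurable_coord (i : 'I_n) :
  measurable_fun setT (fun x : 'rV[R]_n => x ord0 i : R).
Proof. exact: measurable_rV_coord. Qed.

Definition box a b : set 'rV[R]_n :=
  [set x | forall i, a ord0 i < x ord0 i < b ord0 i].

Lemma measurable_box a b : measurable (box a b).
Proof.
rewrite (_ : box a b = \bigcap_(i in [set: 'I_n])
    (fun x : 'rV[R]_n => x ord0 i : R) @^-1` `]a ord0 i, b ord0 i[%classic).
  apply: fin_bigcap_measurable => // i _.
  by rewrite -[X in measurable X]setTI; exact: measurable_coord.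
apply/seteqP; split=> x /= H i => [_|]; first by rewrite /= in_itv/=; exact: H.
by have := H i I; rewrite /= in_itv.
Qed.

Lemma nbhs_rVP x A :
  nbhs x A <-> exists2 e : R, 0 < e &
    forall y, (forall i, `|x ord0 i - y ord0 i| < e) -> A y.
Proof.
split=> [/nbhs_ballP[e /= e0 H]|[e e0 H]].
  by exists e => // y xy; apply: H; split => // i j; rewrite ord1; exact: xy.
by apply/nbhs_ballP; exists e => //= y [_ xy]; apply: H => i; exact: xy.
Qed.

Lemma nbhs_box x A : nbhs x A -> exists a b, box a b x /\ box a b `<=` A.
Proof.
move=> /nbhs_rVP[e e0 H].
exists (\row_i (x ord0 i - e)), (\row_i (x ord0 i + e)); split.
  by move=> i; rewrite !mxE; apply/andP; split; [rewrite ltrBlDr|]; rewrite ltrDl.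
by move=> y xy; apply: H => i; have := xy i; rewrite !mxE ltr_norml; lra.
Qed.

(** The sigma-algebra of R^n is generated by the coordinates, hence contains
    boxes; an open set is a countable union of rational ones. *)
Lemma open_rational_boxes U : open U -> U = \bigcup_(p in
    [set p : 'rV[rat]_n * 'rV[rat]_n |
      box (map_mx ratr p.1) (map_mx ratr p.2) `<=` U])
  box (map_mx ratr p.1) (map_mx ratr p.2).
Proof.
move=> oU; apply/seteqP; split=> [x Ux|x [p pU]]; last exact: pU.
have /nbhs_rVP[e e0 H] : nbhs x U by exact: open_nbhs_nbhs.
have /choice[p Hp] : forall i : 'I_n, exists q : rat,
    ratr q \in `]x ord0 i - e, x ord0 i[.
  by move=> i; apply: rat_in_itvoo; rewrite ltrBlDr ltrDl.
have /choice[q Hq] : forall i : 'I_n, exists q : rat,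
    ratr q \in `]x ord0 i, x ord0 i + e[.
  by move=> i; apply: rat_in_itvoo; rewrite ltrDl.
exists (\row_i p i, \row_i q i) => /=.
  move=> y yb; apply: H => i; have := yb i.
  have := Hp i; have := Hq i; rewrite !mxE !in_itv/= ltr_norml; lra.
move=> i; have := Hp i; have := Hq i; rewrite !mxE !in_itv/=; lra.
Qed.

Lemma open_measurable_rV U : open U -> measurable U.
Proof.
move=> oU; rewrite (open_rational_boxes oU) bigcup_mkcond.
apply: countable_bigcupT_measurable => [|p]; first exact: countableP.
by case: ifP => // _; exact: measurable_box.
Qed.

Lemma closed_measurable_rV U : closed U -> measurable U.
Proof.
move=> cU; rewrite -[U]setCK; apply: measurableC.
by apply: open_measurable_rV; exact: closed_openC.
Qed.

Lemma continuous_measurable_rV (f : 'rV[R]_n -> R) :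
  continuous f -> measurable_fun setT f.
Proof.
move=> cf; apply: (measurability _ (RGenOpens.measurableE R)) => //.
move=> _ [_ [a [b ->] <-]]; apply: open_measurable_rV; rewrite setTI.
by apply: open_comp => // x _; exact: cf.
Qed.

Definition boxes : set (set 'rV[R]_n) := [set A | exists a b, A = box a b].

Lemma measurable_boxes : measurable = <<s boxes >>.
Proof.
apply/seteqP; split; last first.
  apply: smallest_sub; first exact: sigma_algebra_measurable.
  by move=> _ [a [b ->]]; exact: measurable_box.
apply: smallest_sub; first exact: smallest_sigma_algebra.
rewrite -bigcup_seq => A [i _ [B mB <-]]; rewrite setTI.
pose T := g_sigma_algebraType boxes.
suff /(_ measurableT B mB) : measurable_fun [set: T] (fun x : T => x ord0 i : R).
  by rewrite setTI.
apply: (measurability _ (RGenOInfty.measurableE R)) => //.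
move=> _ [_ [t ->] <-]; rewrite setTI.
rewrite (_ : _ @^-1` _ = \bigcup_k box (\row_j (if j == i then t else - k%:R))
  (const_mx k%:R)).
  apply: bigcup_measurable => k _; apply: sub_sigma_algebra.
  by do 2 eexists.
apply/seteqP; split=> [x/=|x [k _ /(_ i)]/=]; last first.
  by rewrite !mxE eqxx in_itv/= => /andP[->].
rewrite in_itv/= andbT => tx.
exists (Num.truncn (\sum_j `|x ord0 j|)).+1 => // j; rewrite !mxE.
have : `|x ord0 j| < (Num.truncn (\sum_j `|x ord0 j|)).+1%:R.
  apply: le_lt_trans (truncnS_gt _); rewrite (bigD1 j)//= lerDl.
  exact: sumr_ge0.
by rewrite ltr_norml; case: eqP => [-> /andP[_ ->]|//]; rewrite tx.
Qed.

Lemma setI_closed_boxes : setI_closed boxes.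
Proof.
move=> _ _ [a [b ->]] [c [d ->]].
exists (\row_i Num.max (a ord0 i) (c ord0 i)), (\row_i Num.min (b ord0 i) (d ord0 i)).
apply/seteqP; split=> [x [H1 H2] i|x H].
  by rewrite !mxE gt_max lt_min; have := H1 i; have := H2 i; lra.
by split=> i; have := H i; rewrite !mxE gt_max lt_min; lra.
Qed.

(** Boxes form a pi-system that generates the sigma-algebra. *)
Lemma boxes_measure_unique (m1 m2 : {measure set 'rV[R]_n -> \bar R}) :
  (forall a b, m1 (box a b) = m2 (box a b)) ->
  (forall a b, (m1 (box a b) < +oo)%E) ->
  forall A, measurable A -> m1 A = m2 A.
Proof.
move=> m12 m1oo.
apply: (measure_unique boxes (fun k => box (const_mx (- k%:R)) (const_mx k%:R))).
- exact: measurable_boxes.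
- exact: setI_closed_boxes.
- by move=> k; do 2 eexists.
- apply/seteqP; split => // x _.
  exists (Num.truncn (\sum_j `|x ord0 j|)).+1 => // j; rewrite !mxE.
  rewrite -ltr_norml; apply: le_lt_trans (truncnS_gt _).
  by rewrite (bigD1 j)//= lerDl; exact: sumr_ge0.
- by move=> _ [a [b ->]].
- by move=> k.
Qed.

End boxes.

Lemma leb_coords (R : realType) n (A : 'I_n -> set R) :
  (forall i, measurable (A i)) ->
  leb R n [set x | forall i, A i (x ord0 i)] =
  (\prod_(i < n) lebesgue_measure (A i))%E.
Proof.
elim: n A => [|n IH] A mA.
  rewrite big_ord0 /= diracE mem_set//.
  by case.
have mS : measurable [set x : 'rV[R]_n | forall i, A (lift ord0 i) (x ord0 i)].
  rewrite (_ : mkset _ = \bigcap_(i in [set: 'I_n])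
    (fun x : 'rV[R]_n => x ord0 i : R) @^-1` A (lift ord0 i)).
    apply: fin_bigcap_measurable => // i _.
    by rewrite -[X in measurable X]setTI; exact: measurable_coord.
  by apply/seteqP; split=> x /= H i => [_|]; [exact: H|exact: (H i I)].
rewrite big_ord_recl /= /leb_cons /pushforward.
rewrite (_ : _ @^-1` _ = A ord0 `*`
    [set x : 'rV[R]_n | forall i, A (lift ord0 i) (x ord0 i)]).
  rewrite product_measure1E//; last exact: mA.
  by congr (_ * _)%E; exact: (IH (fun i => A (lift ord0 i))).
have c0 (p : measurableTypeR R * 'rV[R]_n) : rV_cons p ord0 ord0 = p.1.
  by have /(congr1 fst) := rV_consK p.
have cS (p : measurableTypeR R * 'rV[R]_n) i :
    rV_cons p ord0 (lift ord0 i) = p.2 ord0 i.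
  have -> : lift ord0 i = rshift 1 i :> 'I_(1 + n) by exact: val_inj.
  exact: row_mxEr.
apply/seteqP; split=> [p /= H|p [/= H1 H2] i].
  by split => [|i]; [rewrite -c0|rewrite /= -cS]; exact: H.
by have [j ->|->] := unliftP ord0 i; rewrite ?cS ?c0.
Qed.

Section leb_box.
Variables (R : realType) (n : nat).
Implicit Types (a b c x y : 'rV[R]_n).

Lemma leb_box a b : (forall i, a ord0 i <= b ord0 i) ->
  leb R n (box a b) = (\prod_(i < n) (b ord0 i - a ord0 i))%:E.
Proof.
move=> ab; rewrite -prodEFin.
rewrite (_ : box a b = [set x | forall i,
    `]a ord0 i, b ord0 i[%classic (x ord0 i)]).
  rewrite (@leb_coords R n (fun i => `]a ord0 i, b ord0 i[%classic))//.
  apply: eq_bigr => i _.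
  rewrite lebesgue_measure_itv/= lte_fin.
  by have := ab i; rewrite le_eqVlt => /predU1P[->|->//]; rewrite ltxx subrr.
by apply/seteqP; split=> x /= H i; have := H i; rewrite /= in_itv.
Qed.

Lemma box_le a b : box a b !=set0 -> forall i, a ord0 i <= b ord0 i.
Proof. by move=> [x xab] i; have /andP[/ltW ax /ltW] := xab i; exact: le_trans. Qed.

Lemma leb_box_lty a b : (leb R n (box a b) < +oo)%E.
Proof.
have [->|/set0P ab] := eqVneq (box a b) set0; first by rewrite measure0 ltey.
by rewrite leb_box ?ltey//; exact: box_le.
Qed.

Lemma leb_box_gt0 a b : box a b !=set0 -> (0 < leb R n (box a b))%E.
Proof.
move=> ab; rewrite leb_box; last exact: box_le.
rewrite lte_fin prodr_gt0// => i _; rewrite subr_gt0.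
by case: ab => x /(_ i)/andP[]; exact: lt_trans.
Qed.

Definition reflect c y : 'rV[R]_n := c - y.

Lemma measurable_reflect c : measurable_fun setT (reflect c).
Proof.
apply: measurable_fun_rVP => i.
rewrite (_ : _ \o _ = fun y : 'rV[R]_n => c ord0 i - y ord0 i).
  by apply: measurable_funB => //; exact: measurable_coord.
by apply/funext => y; rewrite /= /rV_coord !mxE.
Qed.

(** The symmetrisation [y -> 2x - y] of singular integrals needs the invariance
    of Lebesgue measure under point reflections; on boxes it is clear. *)
Lemma leb_reflect c A : measurable A -> leb R n (reflect c @^-1` A) = leb R n A.
Proof.
pose m' : {measure set 'rV[R]_n -> \bar R} :=
  measure_function_pushforward__canonical__measure_function_Measure
    (leb R n) (measurable_reflect c).
move=> mA; suff /(_ A mA) -> : forall A, measurable A -> leb R n A = m' A by [].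
apply: boxes_measure_unique => [a b|a b]; last exact: leb_box_lty.
rewrite /= /pushforward.
have -> : reflect c @^-1` box a b = box (c - b) (c - a).
  by apply/seteqP; split=> y /= H i; have := H i; rewrite !mxE; lra.
have [E|/set0P/box_le ab] := eqVneq (box a b) set0.
  rewrite E measure0 (_ : box _ _ = set0) ?measure0//.
  rewrite -subset0 => x H; suff : box a b (c - x) by rewrite E.
  by move=> i; have := H i; rewrite !mxE; lra.
rewrite !leb_box//; last by move=> i; rewrite !mxE lerD2l lerN2.
by congr (_%:E); apply: eq_bigr => i _; rewrite !mxE; ring.
Qed.

Lemma integrable_reflect c (h : 'rV[R]_n -> R) :
  (leb R n).-integrable setT (EFin \o h) ->
  (leb R n).-integrable setT (fun y => (h (c - y))%:E).
Proof.
move=> /integrableP[mh hoo]; apply/integrableP; split.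
  exact: (measurableT_comp mh (measurable_reflect c)).
suff -> : (\int[leb R n]_x `|(h (c - x))%:E| = \int[leb R n]_x `|(EFin \o h) x|)%E by [].
transitivity (\int[pushforward (leb R n) (reflect c)]_x `|(EFin \o h) x|)%E.
  by rewrite ge0_integral_pushforward//; [exact: measurable_reflect|exact: measurableT_comp].
apply: eq_measure_integral; first exact: measurable_reflect.
by move=> mf A mA _; exact: leb_reflect.
Qed.

Lemma Rintegral_reflect c (h : 'rV[R]_n -> R) :
  (leb R n).-integrable setT (EFin \o h) ->
  \int[leb R n]_y h (c - y) = \int[leb R n]_y h y.
Proof.
move=> ih; have ih' := integrable_reflect c ih.
congr fine.
transitivity (\int[pushforward (leb R n) (reflect c)]_x (EFin \o h) x)%E.
  rewrite integral_pushforward//; first exact: measurable_reflect.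
  exact: measurable_int ih.
apply: eq_measure_integral; first exact: measurable_reflect.
by move=> mf A mA _; exact: leb_reflect.
Qed.

End leb_box.

(** * Integrability of powers of the Euclidean norm *)

Lemma ler_powRN (R : realType) (x y a : R) :
  0 < x -> x <= y -> 0 <= a -> y `^ (- a) <= x `^ (- a).
Proof.
move=> x0 xy a0; have y0 := lt_le_trans x0 xy.
by rewrite !powRN lef_pV2 ?posrE ?powR_gt0// ge0_ler_powR// nnegrE ltW.
Qed.

Lemma measurable_fun_powR (R : realType) d (T : measurableType d) (D : set T)
    (f : T -> R) p :
  measurable_fun D f -> measurable_fun D (fun t => f t `^ p).
Proof. by move=> mf; exact: (measurableT_comp (measurable_powR p) mf). Qed.

Section enorm.
Variables (R : realType) (n : nat).
Implicit Types (x y : 'rV[R]_n).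

Lemma sum_sqr_ge0 x : 0 <= \sum_(i < n) x ord0 i ^+ 2.
Proof. by apply: sumr_ge0 => i _; rewrite sqr_ge0. Qed.

Lemma enorm_ge0 x : 0 <= enorm x.
Proof. exact: sqrtr_ge0. Qed.

Lemma sqr_enorm x : enorm x ^+ 2 = \sum_(i < n) x ord0 i ^+ 2.
Proof. by rewrite sqr_sqrtr// sum_sqr_ge0. Qed.

Lemma enormN x : enorm (- x) = enorm x.
Proof. by congr Num.sqrt; apply: eq_bigr => i _; rewrite mxE sqrrN. Qed.

Lemma coord_le_enorm x i : `|x ord0 i| <= enorm x.
Proof.
rewrite -(@ler_pXn2r _ 2)// ?nnegrE ?enorm_ge0// real_normK ?num_real//.
by rewrite sqr_enorm (bigD1 i)//= lerDl; apply: sumr_ge0 => j _; rewrite sqr_ge0.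
Qed.

Lemma coord_le_norm x i : `|x ord0 i| <= `|x|.
Proof.
rewrite [leRHS]/Num.norm/= mx_normrE.
by apply: (le_bigmax _ (fun ij => `|x ij.1 ij.2|) (ord0, i)).
Qed.

Lemma norm_le_enorm x : `|x| <= enorm x.
Proof.
rewrite [leLHS]/Num.norm/= mx_normrE; apply/bigmax_leP; split=> [|[i j] _ /=].
  exact: enorm_ge0.
by rewrite (ord1 i); exact: coord_le_enorm.
Qed.

Lemma enorm_le_norm x : enorm x <= n%:R * `|x|.
Proof.
rewrite -(@ler_pXn2r _ 2)// ?nnegrE ?enorm_ge0 ?mulr_ge0// sqr_enorm.
apply: (@le_trans _ _ (\sum_(i < n) `|x| ^+ 2)).
  apply: ler_sum => i _; rewrite -real_normK ?num_real//.
  by rewrite lerXn2r ?nnegrE//; exact: coord_le_norm.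
rewrite sumr_const card_ord exprMn -[leLHS]mulr_natl ler_wpM2r ?sqr_ge0//.
by rewrite -natrX ler_nat -mulnn; case: (n) => // m; rewrite leq_pmulr.
Qed.

Lemma enorm0 : enorm (0 : 'rV[R]_n) = 0.
Proof.
by rewrite /enorm big1 ?sqrtr0// => i _; rewrite mxE expr0n.
Qed.

Lemma enorm_eq0 x : (enorm x == 0) = (x == 0).
Proof.
apply/eqP/eqP => [x0|->]; last exact: enorm0.
by apply/eqP; rewrite -normr_le0 -x0 norm_le_enorm.
Qed.

Lemma enorm_gt0 x : (0 < enorm x) = (x != 0).
Proof. by rewrite lt_neqAle enorm_ge0 andbT eq_sym enorm_eq0. Qed.

Lemma measurable_enorm d (T : measurableType d) (f : T -> 'rV[R]_n) :
  measurable_fun setT f -> measurable_fun setT (fun t => enorm (f t)).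
Proof.
move=> mf; rewrite /enorm.
rewrite (_ : (fun t => _) = (fun t => (\sum_(i < n) f t ord0 i ^+ 2) `^ (2^-1))).
  apply: measurable_fun_powR; apply: measurable_sum => i; apply: measurable_funX.
  exact: (measurableT_comp (measurable_coord i) mf).
by apply/funext => t; rewrite powR12_sqrt// sum_sqr_ge0.
Qed.

Lemma measurable_rVB d (T : measurableType d) (f g : T -> 'rV[R]_n) :
  measurable_fun setT f -> measurable_fun setT g ->
  measurable_fun setT (fun t => f t - g t).
Proof.
move=> mf mg; apply: measurable_fun_rVP => i.
rewrite (_ : _ \o _ = fun t => f t ord0 i - g t ord0 i).
  by apply: measurable_funB; apply: (measurableT_comp (measurable_coord i)).
by apply/funext => t; rewrite /= /rV_coord !mxE.
Qed.

Lemma measurable_rVD d (T : measurableType d) (f g : T -> 'rV[R]_n) :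
  measurable_fun setT f -> measurable_fun setT g ->
  measurable_fun setT (fun t => f t + g t).
Proof.
move=> mf mg; apply: measurable_fun_rVP => i.
rewrite (_ : _ \o _ = fun t => f t ord0 i + g t ord0 i).
  by apply: measurable_funD; apply: (measurableT_comp (measurable_coord i)).
by apply/funext => t; rewrite /= /rV_coord !mxE.
Qed.

Lemma measurable_enorm_powR d (T : measurableType d) (f : T -> 'rV[R]_n) p :
  measurable_fun setT f -> measurable_fun setT (fun t => enorm (f t) `^ p).
Proof.
by move=> mf; apply: measurable_fun_powR; exact: measurable_enorm.
Qed.

Lemma leb_enorm_le rho : 0 < rho ->
  (leb R n [set x | (enorm x <= rho)%R] <= ((4 ^+ n) * rho `^ n%:R)%:E)%E.
Proof.
move=> r0; apply: (@le_trans _ _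
    (leb R n (box (const_mx (- (2 * rho))) (const_mx (2 * rho))))).
  apply: le_measure; rewrite ?inE.
  - rewrite (_ : mkset _ = (fun x => enorm x) @^-1` `]-oo, rho]%classic).
      rewrite -[X in measurable X]setTI.
      exact: (measurable_enorm (@measurable_id _ _ setT)).
    by apply/seteqP; split => x /=; rewrite in_itv.
  - exact: measurable_box.
  - move=> x /= xr i; rewrite !mxE -ltr_norml.
    apply: le_lt_trans (coord_le_enorm x i) _; apply: le_lt_trans xr _; lra.
rewrite leb_box => [|i]; last by rewrite !mxE; lra.
rewrite lee_fin powR_mulrn ?(ltW r0)// -exprMn.
rewrite (eq_bigr (fun=> 4 * rho)) => [|i _]; last by rewrite !mxE; ring.
by rewrite prodr_const card_ord.
Qed.

End enorm.

Section dyadic.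
Context d (T : measurableType d) (R : realType) (mu : {measure set T -> \bar R}).

(** A substitute for polar coordinates: a function dominated by constants on
    sets (in practice dyadic balls) for which constant times measure decays
    geometrically has a finite integral. *)
Lemma geometric_cover_integral_lty (D : set T) (h : T -> R)
    (A : nat -> set T) (c : nat -> R) (M q : R) :
  measurable D -> measurable_fun D h -> (forall x, D x -> 0 <= h x) ->
  (forall k, measurable (A k)) -> (forall k, 0 <= c k) ->
  0 <= q < 1 ->
  (forall x, D x -> exists k, A k x /\ h x <= c k) ->
  (forall k, ((c k)%:E * mu (A k) <= (M * q ^+ k)%:E)%E) ->
  (\int[mu]_(x in D) (h x)%:E < +oo)%E.
Proof.
move=> mD mh h0 mA c0 /andP[q0 q1] cov bnd.
pose g k x := ((c k)%:E * (\1_(A k) x)%:E)%E : \bar R.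
have mg k : measurable_fun D (g k).
  by apply/measurable_EFinP => /=; apply: measurable_funM.
have g0 k x : (0 <= g k x)%E by rewrite mule_ge0// lee_fin.
apply: (@le_lt_trans _ _ (\int[mu]_(x in D) (\sum_(k <oo) g k x))%E).
  apply: ge0_le_integral => //.
  - by apply/measurable_EFinP.
  - apply: ge0_emeasurable_sum => //.
  - move=> x Dx; have [k [Akx hc]] := cov x Dx.
    apply: (@le_trans _ _ (g k x)).
      by rewrite /g indicE mem_set// mule1 lee_fin.
    apply: (@le_trans _ _ (\sum_(0 <= i < k.+1) g i x)%E); last exact: nneseries_lim_ge.
    by rewrite big_nat_recr//= leeDr// sume_ge0.
rewrite integral_nneseries//.
apply: (@le_lt_trans _ _ (M / (1 - q))%:E); last exact: ltey.
apply: lime_le.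
  by apply: is_cvg_nneseries => k _ _; apply: integral_ge0.
apply: nearW => N.
apply: (@le_trans _ _ (\sum_(0 <= k < N) (M * q ^+ k)%:E)%E).
  apply: lee_sum => k _; apply: le_trans (bnd k).
  rewrite ge0_integralZl_EFin//; last by apply/measurable_EFinP; exact: measurable_indic.
  rewrite lee_wpmul2l ?lee_fin// integral_indic//.
  by apply: le_measure; rewrite ?inE//; exact: measurableI.
have M0 : 0 <= M.
  have := bnd 0%N; rewrite expr0 mulr1 -lee_fin; apply: le_trans.
  by rewrite mule_ge0// lee_fin.
rewrite sumEFin lee_fin ler_pdivlMr ?subr_gt0// big_mkord -mulr_sumr -mulrA.
have := subrXX 1 q N; rewrite expr1n => E.
have -> : (\sum_(i < N) q ^+ i) * (1 - q) = 1 - q ^+ N.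
  rewrite E mulrC; congr (_ * _); apply: eq_bigr => i _; rewrite expr1n mul1r//.
by rewrite ler_piMr// gerBl exprn_ge0.
Qed.

Variables (r : T -> R) (C dd : R).
Hypothesis mr : measurable_fun setT r.
Hypothesis r_ge0 : forall x, 0 <= r x.
(* r plays the role of a norm whose balls have dimension dd. *)
Hypothesis mu_r : forall rho, 0 < rho ->
  (mu [set x | (r x <= rho)%R] <= (C * rho `^ dd)%:E)%E.

Let mle rho : measurable [set x | r x <= rho].
Proof.
rewrite (_ : mkset _ = r @^-1` `]-oo, rho]%classic).
  by rewrite -[X in measurable X]setTI; exact: mr.
by apply/seteqP; split => x /=; rewrite in_itv.
Qed.

Let mgt rho : measurable [set x | rho < r x].
Proof.
rewrite (_ : mkset _ = r @^-1` `]rho, +oo[%classic).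
  by rewrite -[X in measurable X]setTI; exact: mr.
by apply/seteqP; split => x /=; rewrite in_itv/= andbT.
Qed.

Let mrp D p : measurable_fun D (fun x => r x `^ p).
Proof.
apply: (measurable_funS measurableT) => //.
exact: measurable_fun_powR.
Qed.

Let pow2_lt1 (a : R) : a < 0 -> 0 <= 2 `^ a < 1.
Proof.
move=> a0; rewrite powR_ge0/= /powR pnatr_eq0/= expR_lt1.
by rewrite nmulr_rlt0// ln_gt0// ltr1n.
Qed.

Let pow2D (a b : R) : 2 `^ (a + b) = 2 `^ a * 2 `^ b.
Proof. by rewrite powRD// pnatr_eq0 implybT. Qed.

Let pow2X (a : R) k : (2 `^ a) ^+ k = 2 `^ (k%:R * a).
Proof. by rewrite mulrC powRrM powR_mulrn// powR_ge0. Qed.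

Let lt_pow2 (t : R) : exists m : nat, t < 2 `^ m%:R.
Proof.
exists (Num.truncn t).+1; apply: lt_le_trans (truncnS_gt t) _.
rewrite powR_mulrn// -natrX ler_nat; exact/ltnW/ltn_expl.
Qed.

Lemma integral_powR_near_lty (a : R) : 0 < dd -> a < dd ->
  (\int[mu]_(x in [set x | (r x <= 1)%R]) (r x `^ (- a))%:E < +oo)%E.
Proof.
move=> dd0 add; pose b := Num.max a 0.
have b0 : 0 <= b by rewrite /b le_max lexx orbT.
have ab : a <= b by rewrite /b le_max lexx.
have bdd : b < dd by rewrite /b gt_max add dd0.
apply: (@geometric_cover_integral_lty _ _
  (fun k => [set x | r x <= 2 `^ (- k%:R)])
  (fun k => 2 `^ (k.+1%:R * b)) (C * 2 `^ b) (2 `^ (b - dd))).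
- exact: mle.
- exact: mrp.
- by move=> x _; exact: powR_ge0.
- by move=> k; exact: mle.
- by move=> k; exact: powR_ge0.
- by apply: pow2_lt1; rewrite subr_lt0.
- move=> x /= x1; have [x0|x0] := eqVneq (r x) 0.
    exists 0%N; rewrite x0 powR_ge0; split=> //.
    rewrite mul1r; apply: (@le_trans _ _ 1).
      have [->|a0] := eqVneq a 0; first by rewrite oppr0 powRr0.
      by rewrite powR0 ?oppr_eq0//.
    by rewrite -[leLHS](powRr0 2) ler_powR ?ler1n.
  have {}x0 : 0 < r x by rewrite lt_neqAle eq_sym x0 r_ge0.
  have H : exists m : nat, 2 `^ (- m%:R) < r x.
    have [m Hm] := lt_pow2 (r x)^-1; exists m.
    by rewrite powRN invf_plt ?posrE.
  case: (ex_minnP H) => -[|k] Hk kmin.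
    by move: Hk; rewrite oppr0 powRr0 ltNge x1.
  exists k; split.
    by rewrite leNgt; apply/negP => /kmin; rewrite ltnn.
  apply: (@le_trans _ _ (r x `^ (- b))).
    by rewrite ger_powR ?x0// lerN2.
  rewrite (le_trans (ler_powRN _ (ltW Hk) b0))// -powRrM mulNr mulrN opprK//.
- move=> k; apply: (@le_trans _ _ ((2 `^ (k.+1%:R * b))%:E *
      (C * (2 `^ (- k%:R)) `^ dd)%:E)%E).
    by rewrite lee_wpmul2l ?lee_fin ?powR_ge0// mu_r.
  rewrite -EFinM lee_fin pow2X -powRrM le_eqVlt; apply/orP; left; apply/eqP.
  rewrite mulrCA -!mulrA -!pow2D; congr (_ * 2 `^ _).
  by rewrite -natr1; ring.
Qed.

Lemma integral_powR_far_lty (a : R) : 0 <= a -> dd < a ->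
  (\int[mu]_(x in [set x | (1 < r x)%R]) (r x `^ (- a))%:E < +oo)%E.
Proof.
move=> a0 dda.
apply: (@geometric_cover_integral_lty _ _
  (fun k => [set x | r x <= 2 `^ k.+1%:R])
  (fun k => 2 `^ (k%:R * - a)) (C * 2 `^ dd) (2 `^ (dd - a))).
- exact: mgt.
- exact: mrp.
- by move=> x _; exact: powR_ge0.
- by move=> k; exact: mle.
- by move=> k; exact: powR_ge0.
- by apply: pow2_lt1; rewrite subr_lt0.
- move=> x /= x1.
  have H : exists m : nat, r x <= 2 `^ m%:R.
    by have [m /ltW Hm] := lt_pow2 (r x); exists m.
  case: (ex_minnP H) => -[|k] Hk kmin.
    by move: Hk; rewrite powRr0 leNgt x1.
  exists k; split=> //.
  have kx : 2 `^ k%:R <= r x.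
    by apply/ltW; rewrite ltNge; apply/negP => /kmin; rewrite ltnn.
  by rewrite (le_trans (ler_powRN _ kx a0))// -powRrM.
- move=> k; apply: (@le_trans _ _ ((2 `^ (k%:R * - a))%:E *
      (C * (2 `^ k.+1%:R) `^ dd)%:E)%E).
    by rewrite lee_wpmul2l ?lee_fin ?powR_ge0// mu_r.
  rewrite -EFinM lee_fin pow2X -powRrM le_eqVlt; apply/orP; left; apply/eqP.
  rewrite mulrCA -!mulrA -!pow2D; congr (_ * 2 `^ _).
  by rewrite -natr1; ring.
Qed.

(** Integrability criterion for a function with a singularity of order [a] at
    the origin and decay of order [b] at infinity. *)
Lemma integrable_near_far (h : T -> R) (M a b : R) : measurable_fun setT h ->
  0 < dd -> a < dd -> dd < b ->
  (forall x, r x <= 1 -> `|h x| <= M * r x `^ (- a)) ->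
  (forall x, 1 < r x -> `|h x| <= M * r x `^ (- b)) ->
  mu.-integrable setT (EFin \o h).
Proof.
move=> mh dd0 add ddb near_h far_h.
have b0 : 0 <= b by rewrite ltW// (lt_trans dd0).
have H D p : measurable D -> (\int[mu]_(x in D) (r x `^ (- p))%:E < +oo)%E ->
    (forall x, D x -> `|h x| <= M * r x `^ (- p)) ->
    (\int[mu]_(x in D) `|(h x)%:E| < +oo)%E.
  move=> mD rD hD.
  apply: (@le_lt_trans _ _ (\int[mu]_(x in D) (`|M|%:E * (r x `^ (- p))%:E))%E).
    apply: ge0_le_integral => //.
    - apply/measurable_EFinP; apply: measurableT_comp => //.
      exact: measurable_funS mh.
    - by apply/measurable_EFinP; apply: measurable_funM => //; exact: mrp.
    - move=> x Dx; rewrite -EFinM lee_fin (le_trans (hD x Dx))//.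
      by rewrite ler_wpM2r ?powR_ge0// ler_norm.
  rewrite ge0_integralZl_EFin//.
  - by rewrite lte_mul_pinfty// lee_fin.
  - by move=> x _; rewrite lee_fin powR_ge0.
  - by apply/measurable_EFinP; exact: mrp.
apply/integrableP; split; first exact/measurable_EFinP.
have -> : [set: T] = [set x | r x <= 1] `|` [set x | 1 < r x].
  by apply/seteqP; split => // x _ /=; case: (leP (r x) 1); [left|right].
rewrite ge0_integral_setU//=.
- rewrite lte_add_pinfty//.
  + by apply: (H _ a) => //; exact: integral_powR_near_lty.
  + by apply: (H _ b) => //; exact: integral_powR_far_lty.
- apply/measurable_EFinP; apply: measurableT_comp => //.
  exact: measurable_funS mh.
- by apply/disj_setPS => x [/= x1]; rewrite ltNge x1.
Qed.

End dyadic.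

Lemma Rintegral_gt0 d (T : measurableType d) (R : realType)
    (mu : {measure set T -> \bar R}) (D A : set T) (h : T -> R) :
  measurable D -> measurable A -> A `<=` D -> (0 < mu A)%E ->
  mu.-integrable D (EFin \o h) ->
  (forall x, D x -> 0 <= h x) -> (forall x, A x -> 0 < h x) ->
  0 < \int[mu]_(x in D) h x.
Proof.
move=> mD mA AD A0 ih h0 hA.
rewrite lt_neqAle eq_sym; apply/andP; split; last exact: Rintegral_ge0.
apply/eqP => I0.
have E0 : (\int[mu]_(x in D) `|(EFin \o h) x| = 0)%E.
  rewrite (eq_integral (EFin \o h)); last first.
    by move=> x; rewrite inE => Dx; rewrite /= ger0_norm// h0.
  rewrite -[LHS]fineK; last exact: integrable_fin_num.
  by congr (_%:E).
have [N [mN N0 DN]] := (ae_eq_integral_abs mu mD (measurable_int _ ih)).1 E0.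
have : (mu A <= mu N)%E.
  apply: le_measure; rewrite ?inE// => x Ax; apply: DN => /= /(_ (AD _ Ax)) [hx].
  by have := hA x Ax; rewrite hx ltxx.
by rewrite N0 leNgt A0.
Qed.

(** * Smooth bump functions *)

Section flat.
Variable R : realType.
Implicit Types (P : {poly R}) (t u : R).

(** The constant comes from [v^k <= expR (k v) <= expR u] with [v = u / (k + 1)]. *)
Lemma pow_le_expR k : exists M : R, forall u, 0 <= u -> u ^+ k <= M * expR u.
Proof.
exists (k.+1%:R ^+ k) => u u0; have k0 : 0 < k.+1%:R :> R by [].
have -> : u = k.+1%:R * (u / k.+1%:R) by field; rewrite gt_eqF.
set v := u / _; have v0 : 0 <= v by rewrite divr_ge0// ltW.
rewrite exprMn ler_wpM2l ?exprn_ge0 ?(ltW k0)//.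
apply: (@le_trans _ _ (expR v ^+ k)).
  by rewrite lerXn2r ?nnegrE ?expR_ge0// (le_trans _ (expR_ge1Dx v))// lerDr.
by rewrite mulrC -expRM_natr ler_expR ler_wpM2l// ler_nat.
Qed.

Lemma horner_le_expR P : exists M : R, forall u, 0 <= u -> `|P.[u]| <= M * expR u.
Proof.
elim/poly_ind: P => [|P c _].
  by exists 0 => u _; rewrite horner0 normr0 mul0r.
have H (Q : {poly R}) k : exists M : R, forall u, 0 <= u ->
    `|(Q * 'X^k).[u]| <= M * expR u.
  elim/poly_ind: Q k => [|Q e IHQ] k.
    by exists 0 => u _; rewrite mul0r horner0 normr0 mul0r.
  have [M HM] := IHQ k.+1; have [L HL] := pow_le_expR k.
  exists (M + `|e| * L) => u u0.
  rewrite mulrDl -mulrA -exprS hornerD (le_trans (ler_normD _ _))// mulrDl.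
  rewrite lerD ?HM// hornerM hornerC hornerXn normrM -mulrA ler_wpM2l//.
  by rewrite ger0_norm ?exprn_ge0// HL.
by have [M HM] := H (P * 'X + c%:P) 0%N; exists M => u /HM; rewrite expr0 mulr1.
Qed.

(** The functions [P (1/t) exp (-1/t)], extended by zero to [t <= 0].  With an
    arbitrary polynomial [P] the family is closed under derivation, which gives
    smoothness without computing higher derivatives. *)
Definition flat P t : R := if 0 < t then P.[t^-1] * expR (- t^-1) else 0.

Lemma flat_bounded P : exists M : R, forall t, `|flat P t| <= M.
Proof.
have [M HM] := horner_le_expR P; exists M => t; rewrite /flat.
have M0 : 0 <= M.
  by have := HM 0 (lexx _); rewrite expR0 mulr1; exact: le_trans.
case: ifPn => [t0|_]; last by rewrite normr0.
rewrite normrM (ger0_norm (expR_ge0 _)) expRN ler_pdivrMr ?expR_gt0//.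
by rewrite HM// invr_ge0 ltW.
Qed.

Definition dflat P : {poly R} := 'X^2 * (P - P^`()).

(** Flatness at the origin, from the boundedness of the member of the family
    with polynomial ['X^2 * P]; it makes the derivative at 0 vanish. *)
Lemma flat_quadratic P : exists M : R, forall t, `|flat P t| <= M * t ^+ 2.
Proof.
have [M HM] := flat_bounded ('X^2 * P); exists M => t.
have M0 : 0 <= M by apply: le_trans (HM 0).
rewrite /flat; case: ifPn => [t0|_]; last by rewrite normr0 mulr_ge0// sqr_ge0.
have := HM t; rewrite /flat t0 hornerM hornerXn => H.
rewrite -ler_pdivrMr ?exprn_gt0//; apply: le_trans H.
rewrite le_eqVlt; apply/orP; left; apply/eqP.
rewrite -[X in _ / X]ger0_norm ?sqr_ge0// -normf_div; congr `|_|.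
by rewrite exprVn; field; rewrite gt_eqF.
Qed.

Lemma is_derive_flat P t : is_derive t 1 (flat P) (flat (dflat P) t).
Proof.
have [t0|t0|->] := ltgtP t 0.
- apply: (@near_eq_is_derive _ _ _ (cst 0)).
    near=> u; rewrite /flat ifN// -leNgt ltW//.
    by near: u; exact: lt_nbhsl.
  rewrite /flat ifN -?leNgt ?ltW//; exact: is_derive_cst.
- apply: (@near_eq_is_derive _ _ _ ((horner P \o (fun u => u^-1)) *
      (expR \o (fun u => - u^-1)))).
    near=> u; rewrite /flat ifT//.
    by near: u; exact: lt_nbhsr.
  have tn0 : t != 0 by rewrite gt_eqF.
  have dV : is_derive t 1 (fun u => u^-1) (- t^-2).
    by have := @is_deriveV R id t 1 1 tn0 (is_derive_id _ _); rewrite /= scaler1.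
  have dP := is_derive1_comp (is_derive_poly P t^-1) dV.
  have dN : is_derive t 1 (fun u : R => - u^-1) (t ^- 2).
    by have := is_deriveN dV; rewrite opprK.
  have dE := @is_derive1_comp _ expR _ t _ _ (is_derive_expR _) dN.
  apply: is_derive_eq (is_deriveM dP dE) _.
  rewrite /flat t0 /dflat !(hornerM, hornerXn, hornerD, hornerN) /= /GRing.scale/=.
  by rewrite !hornerX; field.
- have [M HM] := flat_quadratic P.
  have H0 : flat P 0 = 0 by rewrite /flat ltxx.
  have dr : (fun h : R => h^-1 *: ((flat P \o shift 0) (h *: 1) - flat P 0))
      h @[h --> 0^'] --> (0 : R).
    apply/cvgrPdist_le => e e0; near=> h.
    have h0 : h != 0 by near: h; exact: nbhs_dnbhs_neq.
    rewrite H0 subr0 sub0r normrN /= addr0 /GRing.scale/= mulr1 normrM normfV.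
    rewrite ler_pdivrMl ?normr_gt0//.
    rewrite (le_trans (HM h))// -real_normK ?num_real// expr2 mulrCA.
    have hM : `|h| <= e / (`|M| + 1).
      by near: h; apply: dnbhs0_le; rewrite divr_gt0// ltr_wpDl.
    rewrite ler_wpM2l// (le_trans (ler_wpM2r _ (ler_norm M)))//.
    rewrite (le_trans (ler_wpM2l _ hM))// mulrCA ler_piMr ?(ltW e0)//.
    by rewrite ler_pdivrMr ?mul1r ?lerDl// ltr_wpDl.
  apply: DeriveDef; first by apply/cvg_ex; exists 0.
  by rewrite /derive (cvg_lim _ dr)// /flat ltxx.
Unshelve. all: by end_near. Qed.

End flat.

Lemma is_derive_continuous (R : realType) (F dF : R -> R) :
  (forall t : R, is_derive t 1 F (dF t)) -> continuous F.
Proof.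
move=> H t; apply/differentiable_continuous/derivable1_diffP.
exact: (@ex_derive _ _ _ _ _ _ _ (H t)).
Qed.

Lemma is_derive_lipschitz (R : realType) (F dF : R -> R) (M : R) (i : interval R) :
  (forall t, t \in i -> is_derive t 1 F (dF t)) -> (forall t, t \in i -> `|dF t| <= M) ->
  forall s t, s \in i -> t \in i -> `|F t - F s| <= M * `|t - s|.
Proof.
move=> HF HM; suff H s t : s <= t -> s \in i -> t \in i -> `|F t - F s| <= M * `|t - s|.
  move=> s t si ti; have [st|/ltW ts] := leP s t; first exact: H.
  by rewrite distrC (distrC t); exact: H.
move=> st si ti.
have sti x : x \in `[s, t] -> x \in i.
  move: si ti; case: i {HF HM} => l r; rewrite !itv_boundlr /=.
  by move=> /andP[ls _] /andP[_ tr] /andP[sx xt]; rewrite (le_trans ls)//= (le_trans _ tr).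
have [x xst||c cst ->] := @MVT_segment _ F dF s t st.
- by apply/HF/sti; exact: subset_itv_oo_cc.
- apply: derivable_within_continuous => x xst.
  exact: (@ex_derive _ _ _ _ _ _ _ (HF x (sti x xst))).
- by rewrite normrM ler_wpM2r// HM// sti.
Qed.

(** The even part [F (s + v) + F (s - v)] has derivative of size [M |v|] in [v],
    whence a second difference of size [u^2]. *)
Lemma is_derive_second_difference (R : realType) (F F' F'' : R -> R) (M : R) :
  (forall t : R, is_derive t 1 F (F' t)) -> (forall t : R, is_derive t 1 F' (F'' t)) ->
  (forall t, `|F'' t| <= M) ->
  forall s u, `|F (s + u) + F (s - u) - 2 * F s| <= 2 * M * u ^+ 2.
Proof.
move=> dF dF' HM s u.
pose G (v : R) := F (s + v) + F (s - v).
have dG (v : R) : is_derive v 1 G (F' (s + v) - F' (s - v)).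
  have d1 : is_derive v 1 (fun v : R => s + v) 1.
    by have := is_deriveD (is_derive_cst s v 1) (is_derive_id v 1); rewrite add0r.
  have d2 : is_derive v 1 (fun v : R => s - v) (-1).
    have := is_deriveD (is_derive_cst s v 1) (is_deriveN (is_derive_id v 1)).
    by rewrite add0r.
  have e1 := @is_derive1_comp _ F _ v _ _ (dF _) d1.
  have e2 := @is_derive1_comp _ F _ v _ _ (dF _) d2.
  by apply: is_derive_eq (is_deriveD e1 e2) _; rewrite mulr1 mulrN1.
have L : forall a b, `|F' b - F' a| <= M * `|b - a|.
  move=> a b; apply: (@is_derive_lipschitz _ _ _ _ `]-oo, +oo[ (fun t _ => dF' t)) => //;
    by rewrite in_itv.
have bG (v : R) : v \in `[(- `|u|), `|u|] -> `|F' (s + v) - F' (s - v)| <= 2 * M * `|u|.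
  rewrite in_itv/= -ler_norml => vu; apply: le_trans (L _ _) _.
  rewrite (_ : s + v - _ = 2 * v); last by ring.
  rewrite normrM normr_nat mulrA (mulrC M) ler_wpM2l// mulr_ge0//.
  exact: le_trans (HM 0).
have u1 : u \in `[(- `|u|), `|u|] by rewrite in_itv/= -ler_norml.
have u0 : (0 : R) \in `[(- `|u|), `|u|] by rewrite in_itv/= -ler_norml normr0.
have := is_derive_lipschitz (fun v _ => dG v) bG u0 u1.
rewrite /G !subr0 addr0 (_ : _ - (F s + F s) = F (s + u) + F (s - u) - 2 * F s).
  by rewrite -mulrA -expr2 real_normK ?num_real.
by ring.
Qed.

Section bump.
Variables (R : realType) (n : nat).
Implicit Types (x z a b : 'rV[R]_n) (f g : 'rV[R]_n -> R).

(** The algebra generated by flat functions of affine functions of one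
    coordinate.  It is closed under partial derivatives, so its members are
    smooth by induction, and it contains the bump functions. *)
Inductive flat_alg : ('rV[R]_n -> R) -> Prop :=
| flat_alg_cst c : flat_alg (cst c)
| flat_alg_flat P i (al be : R) : flat_alg (fun x => flat P (al * x ord0 i + be))
| flat_algD f g : flat_alg f -> flat_alg g -> flat_alg (f + g)
| flat_algM f g : flat_alg f -> flat_alg g -> flat_alg (f * g).

Lemma is_derive_line (F : R -> R) f x (v : 'rV[R]_n) (t d : R) :
  (forall h, f (h *: v + x) = F (h + t)) -> is_derive t 1 F d ->
  is_derive x v f d.
Proof.
move=> fF [dF dFd].
have E : (fun h : R => h^-1 *: ((f \o shift x) (h *: v) - f x)) =
    (fun h => h^-1 *: ((F \o shift t) (h *: 1) - F t)).
  apply/funext => h /=; rewrite fF /GRing.scale/= mulr1.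
  by have := fF 0; rewrite scale0r !add0r => ->.
apply: DeriveDef; first by move: dF; rewrite /derivable E.
by rewrite -dFd /derive E.
Qed.

Lemma is_derive_flat_affine P (al be t : R) :
  is_derive t 1 (fun s : R => flat P (al * s + be)) (al * flat (dflat P) (al * t + be)).
Proof.
have d1 : is_derive t 1 (fun s : R => al * s + be) al.
  have := is_deriveD (is_deriveZ al (is_derive_id t 1)) (is_derive_cst be t 1).
  by rewrite addr0 /GRing.scale/= mulr1.
have := @is_derive1_comp _ (flat P) _ t _ _ (is_derive_flat P _) d1.
by rewrite mulrC.
Qed.

Lemma flat_alg_derive f i : flat_alg f ->
  exists2 g, flat_alg g & forall x, is_derive x (unit_vec R i) f (g x).
Proof.
elim=> [c|P j al be|{}f g _ [f' af' df] _ [g' ag' dg]|{}f g af [f' af' df] ag [g' ag' dg]].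
- by exists (cst 0) => [|x]; [exact: flat_alg_cst|exact: is_derive_cst].
- have [ij|ij] := eqVneq j i; last first.
    exists (cst 0) => [|x]; first exact: flat_alg_cst.
    apply: (@is_derive_line (cst (flat P (al * x ord0 j + be))) _ _ _ 0) => h.
    by rewrite !mxE /= (negbTE ij) mulr0 add0r.
  exists (cst al * (fun x => flat (dflat P) (al * x ord0 j + be))).
    exact/flat_algM/flat_alg_flat/flat_alg_cst.
  move=> x; apply: is_derive_line; last exact: (is_derive_flat_affine P al be (x ord0 j)).
  by move=> h /=; rewrite !mxE ij /= eqxx mulr1.
- exists (f' + g') => [|x]; first exact: flat_algD.
  exact: is_deriveD.
- exists (f * g' + g * f') => [|x]; first by apply: flat_algD; exact: flat_algM.
  exact: is_deriveM.
Qed.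

Lemma flat_alg_continuous f : flat_alg f -> continuous f.
Proof.
elim=> [c|P j al be|{}f g _ cf _ cg|{}f g _ cf _ cg] x.
- exact: cst_continuous.
- apply: (@continuous_comp _ _ _ (fun x => x ord0 j) (fun t => flat P (al * t + be))).
    exact: coord_continuous.
  exact: (is_derive_continuous (is_derive_flat_affine P al be)).
- exact: cvgD (cf x) (cg x).
- exact: cvgM (cf x) (cg x).
Qed.

Lemma flat_alg_smooth f : flat_alg f -> smooth f.
Proof.
move=> af l; have {af} : flat_alg (partials l f).
  elim: l => //= i l IH; have [g ag dg] := flat_alg_derive i IH.
  rewrite (_ : partial _ _ = g)//; apply/funext => x.
  exact: (@derive_val _ _ _ _ _ _ _ (dg x)).
move: (partials l f) => {}f af; split; first exact: flat_alg_continuous.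
move=> i x; have [g _ dg] := flat_alg_derive i af.
exact: (@ex_derive _ _ _ _ _ _ _ (dg x)).
Qed.

(** The quantities that the fractional Laplacian needs are the sup norm and the
    second difference; the Lipschitz bound is there because the second
    difference of a product involves the first differences of the factors. *)
Definition C11_bounded f := exists M : R, forall x z,
  [/\ `|f x| <= M, `|f (x + z) - f x| <= M * `|z| &
      `|f (x + z) + f (x - z) - 2 * f x| <= M * `|z| ^+ 2].

Lemma flat_alg_C11_bounded f : flat_alg f -> C11_bounded f.
Proof.
elim=> [c|P j al be|{}f g _ [M HM] _ [L HL]|{}f g _ [M HM] _ [L HL]].
- exists `|c| => x z; split => //; first by rewrite subrr normr0 mulr_ge0.
  by rewrite (_ : _ - _ = 0) ?normr0 ?mulr_ge0 ?exprn_ge0//= /cst; ring.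
- pose F s := flat P (al * s + be).
  pose F' s := al * flat (dflat P) (al * s + be).
  pose F'' s := al * (al * flat (dflat (dflat P)) (al * s + be)).
  have dF (s : R) : is_derive s 1 F (F' s) by exact: is_derive_flat_affine.
  have dF' (s : R) : is_derive s 1 F' (F'' s).
    exact: (is_deriveZ al (is_derive_flat_affine (dflat P) al be s)).
  have [M0 H0] := flat_bounded P.
  have [M1 H1] := flat_bounded (dflat P).
  have [M2 H2] := flat_bounded (dflat (dflat P)).
  have M00 : 0 <= M0 by exact: le_trans (H0 0).
  have M10 : 0 <= `|al| * M1 by rewrite mulr_ge0// (le_trans _ (H1 0)).
  have M20 : 0 <= 2 * (`|al| * (`|al| * M2)).
    by rewrite !mulr_ge0// (le_trans _ (H2 0)).
  have HF' s : `|F' s| <= `|al| * M1 by rewrite normrM ler_wpM2l.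
  have HF'' s : `|F'' s| <= `|al| * (`|al| * M2).
    by rewrite !normrM !ler_wpM2l.
  exists (M0 + `|al| * M1 + 2 * (`|al| * (`|al| * M2))) => x z.
  have zj := coord_le_norm z j.
  split.
  + by apply: le_trans (H0 _) _; rewrite -addrA lerDl addr_ge0.
  + rewrite mxE.
    apply: (@le_trans _ _ (`|al| * M1 * `|z ord0 j|)).
      have := @is_derive_lipschitz _ F F' _ `]-oo, +oo[ (fun t _ => dF t) (fun t _ => HF' t)
        (x ord0 j) (x ord0 j + z ord0 j).
      by rewrite !in_itv/= => /(_ isT isT); rewrite (addrC (x _ _)) addrK.
    rewrite ler_pM//; lra.
  + rewrite !mxE.
    apply: le_trans (is_derive_second_difference dF dF' HF'' (x ord0 j) (z ord0 j)) _.
    rewrite ler_pM ?sqr_ge0//; first lra.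
    by rewrite -real_normK ?num_real// lerXn2r ?nnegrE.
- exists (M + L) => x z.
  have [M1 M2 M3] := HM x z; have [L1 L2 L3] := HL x z.
  split.
  + by rewrite (le_trans (ler_normD _ _))// lerD.
  + have -> : (f + g) (x + z) - (f + g) x =
      (f (x + z) - f x) + (g (x + z) - g x) by rewrite !fctE; ring.
    by rewrite (le_trans (ler_normD _ _))// [leRHS]mulrDl lerD.
  + have -> : (f + g) (x + z) + (f + g) (x - z) - 2 * (f + g) x =
      (f (x + z) + f (x - z) - 2 * f x) + (g (x + z) + g (x - z) - 2 * g x).
      by rewrite !fctE; ring.
    by rewrite (le_trans (ler_normD _ _))// [leRHS]mulrDl lerD.
- exists (4 * (M * L)) => x z.
  have [M1 M2 M3] := HM x z; have [L1 L2 L3] := HL x z.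
  have [_ M2' _] := HM x (- z); have [_ L2' _] := HL x (- z).
  have [M1' _ _] := HM (x + z) 0.
  have M0 : 0 <= M by exact: le_trans M1.
  have L0 : 0 <= L by exact: le_trans L1.
  rewrite normrN in M2' L2'.
  have ML : 0 <= M * L by exact: mulr_ge0.
  rewrite !fctE; split.
  + have : `|f x| * `|g x| <= M * L by rewrite ler_pM.
    by rewrite normrM; lra.
  + have -> : f (x + z) * g (x + z) - f x * g x =
      f (x + z) * (g (x + z) - g x) + (f (x + z) - f x) * g x by ring.
    rewrite (le_trans (ler_normD _ _))// !normrM.
    apply: (@le_trans _ _ (M * (L * `|z|) + M * `|z| * L)).
      by rewrite lerD// ler_pM.
    have := mulr_ge0 ML (normr_ge0 z); lra.
  + set a := f (x + z) - f x; set b := g (x + z) - g x.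
    set c := f (x - z) - f x; set d := g (x - z) - g x.
    have -> : f (x + z) * g (x + z) + f (x - z) * g (x - z) - 2 * (f x * g x) =
      f x * (g (x + z) + g (x - z) - 2 * g x) +
      (f (x + z) + f (x - z) - 2 * f x) * g x + (a * b + c * d).
      by rewrite /a /b /c /d; ring.
    rewrite (le_trans (ler_normD _ _))//.
    rewrite (le_trans (lerD (ler_normD _ _) (ler_normD _ _)))// !normrM.
    apply: (@le_trans _ _ (M * (L * `|z| ^+ 2) + M * `|z| ^+ 2 * L +
        (M * `|z| * (L * `|z|) + M * `|z| * (L * `|z|)))).
      by rewrite !lerD// ler_pM.
    by rewrite le_eqVlt; apply/orP; left; apply/eqP; ring.
Qed.

Lemma measurable_flat_alg f : flat_alg f -> measurable_fun setT f.
Proof. by move=> /flat_alg_continuous; exact: continuous_measurable_rV. Qed.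

(** The parameter [k] sharpens the bump: for [k] to infinity it tends to the
    indicator function of the box.  Wherever no limit is taken [k] is 0. *)
Definition bump (k : nat) a b : 'rV[R]_n -> R := fun x => \prod_(i < n)
  (flat 1 (k.+1%:R * (x ord0 i - a ord0 i)) * flat 1 (k.+1%:R * (b ord0 i - x ord0 i))).

Lemma flat_alg_bump k a b : flat_alg (bump k a b).
Proof.
rewrite (_ : bump k a b = \prod_(i < n)
  ((fun x => flat 1 (k.+1%:R * x ord0 i + (- (k.+1%:R * a ord0 i)))) *
   (fun x => flat 1 (- k.+1%:R * x ord0 i + k.+1%:R * b ord0 i)))).
  elim/big_ind: _ => [|f g|i _]; first exact: flat_alg_cst.
  - exact: flat_algM.
  - by apply: flat_algM; exact: flat_alg_flat.
apply/funext => x; rewrite fct_prodE /bump; apply: eq_bigr => i _; rewrite fctE.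
by congr (flat 1 _ * flat 1 _); ring.
Qed.

Lemma flat1_gt0 (t : R) : 0 < t -> 0 < flat 1 t.
Proof. by move=> t0; rewrite /flat t0 hornerE mul1r expR_gt0. Qed.

Lemma flat_le0 P (t : R) : t <= 0 -> flat P t = 0.
Proof. by rewrite /flat leNgt => /negbTE ->. Qed.

Lemma flat1_itv (t : R) : 0 <= flat 1 t <= 1.
Proof.
rewrite /flat; case: ifPn => t0; last by rewrite lexx ler01.
by rewrite hornerE mul1r expR_ge0/= expR_le1 oppr_le0 invr_ge0 ltW.
Qed.

Lemma bump_itv k a b x : 0 <= bump k a b x <= 1.
Proof.
have H i : 0 <= flat 1 (k.+1%:R * (x ord0 i - a ord0 i)) *
    flat 1 (k.+1%:R * (b ord0 i - x ord0 i)) <= 1.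
  have /andP[p0 p1] := flat1_itv (k.+1%:R * (x ord0 i - a ord0 i)).
  have /andP[q0 q1] := flat1_itv (k.+1%:R * (b ord0 i - x ord0 i)).
  by rewrite mulr_ge0//= mulr_ile1.
rewrite /bump; elim/big_ind: _ => [|p q /andP[p0 p1] /andP[q0 q1]|i _].
- by rewrite ler01 lexx.
- by rewrite mulr_ge0//= mulr_ile1.
- exact: H.
Qed.

Lemma bump_gt0 k a b x : box a b x -> 0 < bump k a b x.
Proof.
move=> xab; apply: prodr_gt0 => i _; have /andP[ax xb] := xab i.
by rewrite mulr_gt0// flat1_gt0// mulr_gt0// subr_gt0.
Qed.

Lemma bump_eq0 k a b x : ~ box a b x -> bump k a b x = 0.
Proof.
move=> /existsNP[i /negP]; rewrite negb_and -!leNgt => H.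
rewrite /bump (bigD1 i)//=; case/orP: H => H.
  by rewrite (@flat_le0 _ (_ * (x _ _ - _))) ?mul0r// pmulr_rle0// subr_le0.
by rewrite (@flat_le0 _ (_ * (b _ _ - _))) ?mulr0 ?mul0r// pmulr_rle0// subr_le0.
Qed.

Lemma flat1_cvg (t : R) : 0 < t -> flat 1 (k.+1%:R * t) @[k --> \oo] --> (1 : R).
Proof.
move=> t0; rewrite (_ : (fun k => _) = expR \o (fun k => - (k.+1%:R^-1 * t^-1))).
  have H : - (k.+1%:R^-1 * t^-1) @[k --> \oo] --> (- (0 * t^-1)).
    by apply: cvgN; apply: cvgM; [exact: cvg_harmonic|exact: cvg_cst].
  rewrite mul0r oppr0 in H.
  by have := cvg_comp _ _ H (@continuous_expR R 0); rewrite expR0.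
apply/funext => k /=; rewrite /flat mulr_gt0// hornerE mul1r.
by rewrite invfM.
Qed.

Lemma bump_cvg a b x : bump k a b x @[k --> \oo] --> (\1_(box a b) x : R).
Proof.
have [xab|xab] := pselect (box a b x); last first.
  rewrite indicE memNset//; apply: cvg_near_cst.
  by apply: nearW => k; exact: bump_eq0.
rewrite indicE mem_set//.
have H i : flat 1 (k.+1%:R * (x ord0 i - a ord0 i)) *
    flat 1 (k.+1%:R * (b ord0 i - x ord0 i)) @[k --> \oo] --> (1 : R).
  rewrite -[X in _ --> X](mulr1 (1 : R)); have /andP[ax xb] := xab i.
  by apply: cvgM; apply: flat1_cvg; rewrite subr_gt0.
have FF : Filter (\oo : set_system nat) by exact: _.
have := @cvg_big _ _ _ (1 : R) xpredT (@mul_continuous R) nat \oo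
  (index_enum 'I_n) (fun i k => flat 1 (k.+1%:R * (x ord0 i - a ord0 i)) *
    flat 1 (k.+1%:R * (b ord0 i - x ord0 i))) (fun=> 1) FF (fun i _ => H i).
by rewrite big1.
Qed.

Definition cbox a b : set 'rV[R]_n :=
  [set x | forall i, a ord0 i <= x ord0 i <= b ord0 i].

Lemma compact_cbox a b : compact (cbox a b).
Proof.
rewrite (_ : cbox a b = [set x | forall i, `[a ord0 i, b ord0 i]%classic (x ord0 i)]).
  apply: (@rV_compact R n (fun i => `[a ord0 i, b ord0 i]%classic)) => i.
  exact: segment_compact.
by apply/seteqP; split => x H i; have := H i; rewrite /= in_itv.
Qed.

Lemma supp_bump k a b : supp (bump k a b) `<=` cbox a b.
Proof.
have cc : closed (cbox a b) by apply: compact_closed => //; exact: compact_cbox.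
rewrite /supp ((closure_id _).1 cc); apply: closure_subset => x /= x0 i.
have : box a b x by apply: contrapT => /bump_eq0-/(_ k)/eqP; rewrite (negbTE x0).
by move=> /(_ i)/andP[/ltW -> /ltW ->].
Qed.

Lemma bump_Cc_infty (U : set 'rV[R]_n) k a b :
  cbox a b `<=` U -> Cc_infty U (bump k a b).
Proof.
move=> abU; split.
- exact/flat_alg_smooth/flat_alg_bump.
- by apply: subclosed_compact (@compact_cbox a b) (@supp_bump k a b); exact: closed_closure.
- exact: subset_trans (@supp_bump k a b) abU.
Qed.

Lemma nbhs_cbox x (A : set 'rV[R]_n) : nbhs x A ->
  exists a b, box a b x /\ cbox a b `<=` A.
Proof.
move=> /nbhs_rVP[e e0 H].
exists (\row_i (x ord0 i - e / 2)), (\row_i (x ord0 i + e / 2)); split.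
  by move=> i; rewrite !mxE; apply/andP; split; [rewrite ltrBlDr|]; rewrite ltrDl divr_gt0.
by move=> y xy; apply: H => i; have := xy i; rewrite !mxE ltr_norml; lra.
Qed.

End bump.

(** * The fractional Laplacian of a bounded C^{1,1} function *)

Section gamma.
Variable R : realType.
Implicit Types t : R.

Let mu := @lebesgue_measure R.

Lemma lebesgue_measure_norm_le (rho : R) : 0 < rho ->
  (mu [set x | (`|x| <= rho)%R] <= (2 * rho `^ 1)%:E)%E.
Proof.
move=> r0; rewrite (_ : mkset _ = `[- rho, rho]%classic); last first.
  by apply/seteqP; split => x /=; rewrite in_itv/= ler_norml.
rewrite /mu lebesgue_measure_itv/= lte_fin ltrNl (@lt_trans _ _ 0) ?oppr_lt0//.
by rewrite powRr1 ?(ltW r0)// -EFinB lee_fin opprK mulr_natl mulr2n.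
Qed.

Let gamma_int t (x : R) := if 0 < x then x `^ (t - 1) * expR (- x) else 0.

Let gamma_intE t : gamma_int t = (fun x => x `^ (t - 1) * expR (- x)) \_ `]0, +oo[%classic.
Proof.
apply/funext => x; rewrite patchE mem_setE in_itv/= andbT /gamma_int.
by [].
Qed.

(** Near 0 the integrand is at most [x^(t-1)], and [expR (- x)] beats all powers
    at infinity. *)
Lemma integrable_gamma t : 0 < t ->
  mu.-integrable `]0, +oo[%classic (EFin \o (fun x => x `^ (t - 1) * expR (- x))).
Proof.
move=> t0; apply/integrable_mkcond => //.
rewrite (_ : (_ \_ _) = EFin \o gamma_int t); last by rewrite gamma_intE restrict_EFin.
have m0 : measurable_fun (`]0, +oo[%classic : set R) (fun x : R => x `^ (t - 1) * expR (- x)).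
  apply: measurable_funS (@measurableT _ _) _ _ => //.
  apply: measurable_funM; first exact: measurable_powR.
  exact: (measurableT_comp (@measurable_expR R) (@oppr_measurable R setT)).
have [M HM] := pow_le_expR R (Num.truncn (t + 1)).+1.
have M0 : 0 <= M by have := HM 0 (lexx _); rewrite expr0n expR0 mulr1.
apply: (@integrable_near_far _ _ _ mu (fun x : R => `|x|) 2 1 _ _ _
  (gamma_int t) (1 + M) (1 - t) 2).
- exact: normr_measurable.
- by move=> x; exact: normr_ge0.
- exact: lebesgue_measure_norm_le.
- by rewrite gamma_intE; apply/(measurable_restrictT _ _).1.
- by [].
- by lra.
- by lra.
- move=> x x1; rewrite /gamma_int; case: ifPn => x0; last first.
    by rewrite normr0 mulr_ge0 ?powR_ge0// addr_ge0.
  rewrite opprB normrM (ger0_norm (powR_ge0 _ _)) (gtr0_norm x0) mulrC.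
  rewrite ler_wpM2r ?powR_ge0// ger0_norm ?expR_ge0//.
  by rewrite (@le_trans _ _ 1) ?lerDl// expR_le1 oppr_le0 ltW.
- move=> x x1; rewrite /gamma_int; case: ifPn => x0; last first.
    by rewrite normr0 mulr_ge0 ?powR_ge0// addr_ge0.
  rewrite (gtr0_norm x0) in x1 *.
  rewrite ger0_norm ?mulr_ge0 ?powR_ge0 ?expR_ge0//.
  rewrite expRN ler_pdivrMr ?expR_gt0//.
  have xx : x `^ (t - 1) = x `^ (t + 1) * x `^ (- 2).
    rewrite (_ : t - 1 = (t + 1) + - 2); last by ring.
    by rewrite powRD// (gt_eqF x0) implybT.
  rewrite xx mulrAC ler_wpM2r ?powR_ge0//.
  apply: (@le_trans _ _ (M * expR x)); last by rewrite ler_wpM2r ?expR_ge0// lerDr.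
  apply: le_trans (HM x (ltW x0)).
  rewrite -powR_mulrn ?(ltW x0)// ler_powR ?(ltW x1)//.
  exact/ltW/truncnS_gt.
Qed.

Lemma Gamma_pos_gt0 t : 0 < t -> 0 < Gamma_pos t.
Proof.
move=> t0; apply: (@Rintegral_gt0 _ _ _ mu _ (`]0, 1[%classic : set R)).
- exact: measurable_itv.
- exact: measurable_itv.
- by move=> x /=; rewrite !in_itv/= andbT => /andP[].
- change (0 < lebesgue_measure (`]0%R, 1%R[%classic : set R))%E.
  by rewrite lebesgue_measure_itv/= lte_fin ltr01 sube0 lte_fin.
- exact: integrable_gamma.
- by move=> x _; rewrite mulr_ge0 ?powR_ge0 ?expR_ge0.
- by move=> x /=; rewrite in_itv/= => /andP[x0 _]; rewrite mulr_gt0 ?powR_gt0 ?expR_gt0.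
Qed.

(** Without this the fractional Laplacian would vanish identically and carry no
    information on the data. *)
Lemma frac_lap_const_neq0 n (s : R) : 0 < s < 1 -> frac_lap_const n s != 0.
Proof.
move=> /andP[s0 s1]; rewrite /frac_lap_const /Gamma.
have n0 : 0 < n%:R / 2 + s by rewrite ltr_wpDl// divr_ge0.
rewrite n0 oppr_gt0 ltNge (ltW s0)/= !mulf_neq0 ?invr_neq0 ?normr_eq0//.
- by rewrite gt_eqF ?Gamma_pos_gt0.
- rewrite mulf_neq0 ?invr_neq0 ?oppr_eq0 ?gt_eqF//.
  by apply: Gamma_pos_gt0; lra.
- by rewrite gt_eqF// powR_gt0// pi_gt0.
Qed.

End gamma.

Section frac_lap_formula.
Variables (R : realType) (n : nat) (s : R).
Hypotheses (hn : (1 <= n)%N) (hs : 0 < s < 1).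
Implicit Types (x y z : 'rV[R]_n).

Let p : R := n%:R + 2 * s.
Let mu := leb R n.

Let n_gt0 : 0 < n%:R :> R. Proof. by rewrite ltr0n. Qed.
Let p_gt : n%:R < p. Proof. by rewrite /p ltrDl mulr_gt0//; case/andP: hs. Qed.
Let p_gt0 : 0 < p. Proof. exact: lt_trans p_gt. Qed.

(** [integrable_near_far] for the Euclidean norm of R^n. *)
Lemma integrable_kernel (h : 'rV[R]_n -> R) (M a b : R) :
  measurable_fun setT h -> a < n%:R -> n%:R < b ->
  (forall x, enorm x <= 1 -> `|h x| <= M * enorm x `^ (- a)) ->
  (forall x, 1 < enorm x -> `|h x| <= M * enorm x `^ (- b)) ->
  mu.-integrable setT (EFin \o h).
Proof.
move=> mh an nb h1 h2.
apply: (@integrable_near_far _ _ _ mu (fun x => enorm x) (4 ^+ n) n%:R _ _ _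
  h M a b) => //.
- exact: (measurable_enorm (@measurable_id _ _ setT)).
- exact: enorm_ge0.
- exact: leb_enorm_le.
Qed.

Variables (phi : 'rV[R]_n -> R) (M : R).
Hypothesis mphi : measurable_fun setT phi.
Hypothesis phiM : forall x z,
  `|phi x| <= M /\ `|phi (x + z) + phi (x - z) - 2 * phi x| <= M * `|z| ^+ 2.

Let M_ge0 : 0 <= M. Proof. by have [h _] := phiM 0 0; exact: le_trans h. Qed.

Definition second_difference x z := 2 * phi x - phi (x + z) - phi (x - z).

Let D2_quadratic x z : `|second_difference x z| <= 4 * M * enorm z ^+ 2.
Proof.
have [_ H] := phiM x z.
have -> : second_difference x z = - (phi (x + z) + phi (x - z) - 2 * phi x).
  by rewrite /second_difference; ring.
rewrite normrN; apply: le_trans H _.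
rewrite ler_pM ?exprn_ge0//; first by have := M_ge0; lra.
by rewrite lerXn2r ?nnegrE ?enorm_ge0// norm_le_enorm.
Qed.

Let D2_bounded x z : `|second_difference x z| <= 4 * M.
Proof.
have [H1 _] := phiM x 0; have [H2 _] := phiM (x + z) 0; have [H3 _] := phiM (x - z) 0.
rewrite /second_difference (le_trans (ler_normB _ _))//.
rewrite (le_trans (lerD (ler_normB _ _) (lexx _)))// normrM normr_nat; lra.
Qed.

(* The majorant of the dominated convergence theorem: the second difference is
   O(|z|^2) near 0, where it compensates the singularity as p - 2 < n, and it is
   bounded at infinity, where p > n suffices. *)
Let majorant z : R :=
  4 * M * (if enorm z <= 1 then enorm z ^+ 2 else 1) / enorm z `^ p.

Let D2_majorant x z : `|second_difference x z / enorm z `^ p| <= majorant z.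
Proof.
rewrite normrM normfV (ger0_norm (powR_ge0 _ _)) /majorant.
rewrite ler_wpM2r ?invr_ge0 ?powR_ge0//.
by case: ifP => _; rewrite ?mulr1.
Qed.

Let mkernel : measurable_fun setT (fun z : 'rV[R]_n => (enorm z `^ p)^-1).
Proof.
rewrite (_ : (fun _ => _) = fun z : 'rV[R]_n => enorm z `^ (- p)).
  exact: (measurable_enorm_powR (- p) (@measurable_id _ _ setT)).
by apply/funext => z; rewrite powRN.
Qed.

Let integrable_majorant : mu.-integrable setT (EFin \o majorant).
Proof.
have menorm := measurable_enorm (@measurable_id _ 'rV[R]_n setT).
apply: (@integrable_kernel _ (4 * M) (p - 2) p) => //.
- apply: measurable_funM => //; apply: measurable_funM => //.
  apply: measurable_fun_ifT => //.
  + exact: measurable_fun_ler.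
  + exact: measurable_funX.
- by rewrite /p; case/andP: hs => _ s1; lra.
- move=> z z1; rewrite /majorant z1 opprB.
  rewrite ger0_norm ?mulr_ge0 ?invr_ge0 ?powR_ge0 ?exprn_ge0 ?enorm_ge0//.
  rewrite -mulrA ler_wpM2l ?mulr_ge0//.
  have [->|z0] := eqVneq (enorm z) 0; first by rewrite expr0n mul0r powR_ge0.
  rewrite powRB ?z0 ?implybT// powR_mulrn ?enorm_ge0//.
- move=> z z1; rewrite /majorant [enorm z <= 1]leNgt z1/= mulr1 powRN.
  by rewrite ger0_norm// mulr_ge0 ?invr_ge0 ?powR_ge0// mulr_ge0.
Qed.

Let measurable_shift x : measurable_fun setT (fun z => phi (x + z)).
Proof.
by apply: (measurableT_comp mphi); apply: measurable_rVD.
Qed.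

Let measurable_shiftN x : measurable_fun setT (fun z => phi (x - z)).
Proof.
by apply: (measurableT_comp mphi); apply: measurable_rVB.
Qed.

Let measurable_D2 x : measurable_fun setT (fun z => second_difference x z / enorm z `^ p).
Proof.
by apply: measurable_funM => //; apply: measurable_funB => //; apply: measurable_funB.
Qed.

Lemma integrable_second_difference x :
  mu.-integrable setT (EFin \o (fun z => second_difference x z / enorm z `^ p)).
Proof.
apply: (le_integrable _ _ _ integrable_majorant) => //.
  by apply/measurable_EFinP; exact: measurable_D2.
by move=> z _; rewrite lee_fin (le_trans (D2_majorant x z))// ler_norm.
Qed.

Let trunc (eps : R) z : R := if eps < enorm z then 1 else 0.

Let mtrunc eps : measurable_fun setT (trunc eps).
Proof.
have menorm := measurable_enorm (@measurable_id _ 'rV[R]_n setT).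
by apply: measurable_fun_ifT => //; apply: measurable_fun_ltr.
Qed.

Let integrable_trunc eps (h : 'rV[R]_n -> R) (L : R) : 0 < eps -> measurable_fun setT h ->
  (forall z, `|h z| <= L) ->
  mu.-integrable setT (EFin \o (fun z => trunc eps z * (h z / enorm z `^ p))).
Proof.
move=> e0 mh hL; have L0 : 0 <= L by exact: le_trans (hL 0).
apply: (@integrable_kernel _ (L * eps `^ (- p) + L) 0 p) => //.
- by apply: measurable_funM => //; apply: measurable_funM.
- move=> z z1; rewrite oppr0 powRr0 mulr1 normrM /trunc.
  case: ltP => [ez|_]; last by rewrite normr0 mul0r addr_ge0// mulr_ge0// powR_ge0.
  rewrite normr1 mul1r normrM normfV (ger0_norm (powR_ge0 _ _)).
  rewrite (@le_trans _ _ (L * eps `^ (- p)))// ?lerDl//.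
  rewrite ler_pM// ?invr_ge0 ?powR_ge0// powRN lef_pV2 ?posrE ?powR_gt0//.
    by rewrite ge0_ler_powR ?nnegrE ?ltW// (lt_trans e0).
  exact: lt_trans ez.
- move=> z z1; rewrite normrM /trunc.
  apply: (@le_trans _ _ (`|h z / enorm z `^ p|)).
    by rewrite ler_piMl//; case: ifP => _; rewrite ?normr1 ?normr0.
  rewrite normrM normfV (ger0_norm (powR_ge0 _ _)) (powRN (enorm z)).
  rewrite ler_wpM2r ?invr_ge0 ?powR_ge0// (le_trans (hL z))// lerDr.
  by rewrite mulr_ge0// powR_ge0.
Qed.

(* The average of the substitutions y = x - z and y = x + z turns the first
   difference of phi into a second difference; the truncation makes each of the
   two integrals converge. *)
Let truncated_integral (x : 'rV[R]_n) (eps : R) : 0 < eps ->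
  \int[mu]_(y in [set y | (eps < enorm (x - y))%R])
     ((phi x - phi y) / enorm (x - y) `^ p) =
  2^-1 * \int[mu]_z (trunc eps z * (second_difference x z / enorm z `^ p)).
Proof.
move=> e0.
pose hm z := trunc eps z * ((phi x - phi (x - z)) / enorm z `^ p).
pose hp z := trunc eps z * ((phi x - phi (x + z)) / enorm z `^ p).
have ihm : mu.-integrable setT (EFin \o hm).
  apply: (@integrable_trunc _ (fun z => phi x - phi (x - z)) (2 * M)) => //.
    by apply: measurable_funB.
  move=> z; have [H1 _] := phiM x 0; have [H2 _] := phiM (x - z) 0.
  by rewrite (le_trans (ler_normB _ _))//; lra.
have ihp : mu.-integrable setT (EFin \o hp).
  apply: (@integrable_trunc _ (fun z => phi x - phi (x + z)) (2 * M)) => //.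
    by apply: measurable_funB.
  move=> z; have [H1 _] := phiM x 0; have [H2 _] := phiM (x + z) 0.
  by rewrite (le_trans (ler_normB _ _))//; lra.
have -> : \int[mu]_(y in [set y | (eps < enorm (x - y))%R])
    ((phi x - phi y) / enorm (x - y) `^ p) = \int[mu]_z hm z.
  rewrite -(Rintegral_reflect x ihm) Rintegral_mkcond; apply: eq_Rintegral => y _.
  rewrite patchE /hm /trunc subKr.
  have -> : (y \in [set y | eps < enorm (x - y)]) = (eps < enorm (x - y)).
    by apply/idP/idP; rewrite inE.
  by case: ifPn => _; rewrite ?mul1r ?mul0r.
have E : \int[mu]_z hp z = \int[mu]_z hm z.
  rewrite -(Rintegral_reflect 0 ihm); apply: eq_Rintegral => z _.
  by rewrite /hp /hm /trunc sub0r enormN opprK.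
suff -> : \int[mu]_z (trunc eps z * (second_difference x z / enorm z `^ p)) =
    \int[mu]_z hm z + \int[mu]_z hp z by rewrite E; field.
rewrite -RintegralD//; apply: eq_Rintegral => z _.
by rewrite /hm /hp /second_difference; ring.
Qed.

(** The principal value is an absolutely convergent integral of second
    differences, from which boundedness and measurability in [x] follow. *)
Lemma frac_lapE x : frac_lap s phi x =
  frac_lap_const n s * (2^-1 * \int[mu]_z (second_difference x z / enorm z `^ p)).
Proof.
congr (_ * _); apply/cvg_lim => //.
apply/cvg_at_rightP => u [u0 u_cvg].
rewrite (_ : (fun k => _) = (fun k => 2^-1 *
    \int[mu]_z (trunc (u k) z * (second_difference x z / enorm z `^ p)))); last first.
  by apply/funext => k; rewrite truncated_integral.
apply: cvgM; first exact: cvg_cst.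
apply: fine_cvg; rewrite fineK; last first.
  exact/integrable_fin_num/integrable_second_difference.
apply: (dominated_cvg _ _ _ _ integrable_majorant) => //.
- move=> k; apply/measurable_EFinP; apply: measurable_funM => //.
- move=> z _; apply: cvg_near_cst.
  have [->|z0] := eqVneq z 0.
    apply: nearW => k; rewrite /second_difference addr0 subr0.
    by congr (_%:E); ring.
  have z0' : 0 < enorm z by rewrite enorm_gt0.
  have : \forall k \near \oo, u k < enorm z by exact: (cvgr_lt 0 u_cvg).
  by apply: filterS => k uk; rewrite /trunc uk mul1r.
- move=> k z _; rewrite lee_fin normrM.
  apply: le_trans (D2_majorant x z).
  by rewrite ler_piMl// /trunc; case: ifP => _; rewrite ?normr1 ?normr0.
Qed.

Lemma frac_lap_bounded : exists C, forall x, `|frac_lap s phi x| <= C.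
Proof.
exists (`|frac_lap_const n s| * (2^-1 * \int[mu]_z majorant z)) => x.
rewrite frac_lapE normrM ler_wpM2l// normrM ger0_norm// ler_wpM2l//.
have iD := integrable_second_difference x.
rewrite (le_trans (le_normr_Rintegral _ iD))//.
by apply: le_Rintegral => //; exact: integrable_norm.
Qed.

Lemma measurable_frac_lap : measurable_fun setT (frac_lap s phi).
Proof.
rewrite (_ : frac_lap s phi = fun x => frac_lap_const n s *
  (2^-1 * \int[mu]_z (second_difference x z / enorm z `^ p))); last first.
  by apply/funext => x; rewrite frac_lapE.
apply: measurable_funM => //; apply: measurable_funM => //.
pose f (xz : 'rV[R]_n * 'rV[R]_n) : \bar R :=
  (second_difference xz.1 xz.2 / enorm xz.2 `^ p)%:E.
have mf : measurable_fun setT f.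
  apply/measurable_EFinP; apply: measurable_funM.
    apply: measurable_funB; first apply: measurable_funB.
    - by apply: measurable_funM => //; exact: (measurableT_comp mphi measurable_fst).
    - apply: (measurableT_comp mphi); exact: measurable_rVD.
    - apply: (measurableT_comp mphi); exact: measurable_rVB.
  exact: (measurableT_comp mkernel measurable_snd).
rewrite /Rintegral; apply: (measurableT_comp (@fine_measurable R setT _)) => //.
rewrite (_ : (fun x => _) = (fubini_F mu (f^\+)%E \- fubini_F mu (f^\-)%E)%E).
  apply: emeasurable_funB.
  - apply: measurable_fun_fubini_tonelli_F => //; exact: measurable_funepos.
  - apply: measurable_fun_fubini_tonelli_F => //; exact: measurable_funeneg.
by apply/funext => x; rewrite integralE /fubini_F; congr (_ - _)%E;
  apply: eq_integral => y _; rewrite ?funeposE ?funenegE.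
Qed.

(** At distance [d] from the support the truncation at a radius below [d] has
    no effect and [phi x = 0], so no principal value is needed. *)
Lemma frac_lap_off_support x (d : R) : 0 < d ->
  (forall y, phi y != 0 -> d < enorm (x - y)) ->
  frac_lap s phi x =
  frac_lap_const n s * \int[mu]_y (- (phi y / enorm (x - y) `^ p)).
Proof.
move=> d0 dphi; congr (_ * _); apply/cvg_lim => //; apply: cvg_near_cst.
have phix : phi x = 0.
  apply: contrapT => /eqP/dphi; rewrite subrr enorm0 => /(lt_trans d0).
  by rewrite ltxx.
near=> eps; rewrite Rintegral_mkcond; apply: eq_Rintegral => y _.
rewrite patchE.
have -> : (y \in [set y | eps < enorm (x - y)]) = (eps < enorm (x - y)).
  by apply/idP/idP; rewrite inE.
case: ltP => [_|xe]; first by rewrite phix sub0r mulNr.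
have [->|/dphi dy] := eqVneq (phi y) 0; first by rewrite mul0r oppr0.
have ed : eps < d by near: eps; exact: nbhs_right_lt.
by have := lt_trans (lt_le_trans dy xe) ed; rewrite ltxx.
Unshelve. all: by end_near. Qed.

End frac_lap_formula.

(** * Unique continuation for Riesz potentials *)

Section zero_integral_derive.
Context d (T : measurableType d) (R : realType) (mu : {measure set T -> \bar R}).
Variables (K : set T) (w : T -> R).
Hypothesis mK : measurable K.
Hypothesis iw : mu.-integrable K (EFin \o w).

(** Derivation under the integral sign, for an integral that vanishes for all
    values of the parameter near 0. *)
Lemma zero_integral_derive (k dk : R -> T -> R) (delta C : R) : 0 < delta ->
  (forall t, `|t| < delta -> measurable_fun K (k t)) ->
  (forall t x, `|t| < delta -> K x -> `|k t x| <= C) ->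
  (forall (t : R) x, `|t| < delta -> K x -> is_derive t 1 (k ^~ x) (dk t x)) ->
  (forall t x, `|t| < delta -> K x -> `|dk t x| <= C) ->
  (forall t, `|t| < delta -> \int[mu]_(x in K) (w x * k t x) = 0) ->
  \int[mu]_(x in K) (w x * dk 0 x) = 0.
Proof.
move=> d0 mk kC dkk dkC k0.
have ID t : `]- delta, delta[%classic t -> `|t| < delta.
  by rewrite /= in_itv/= ltr_norml.
have I0 : `]- delta, delta[%classic (0 : R) by rewrite /= in_itv/= oppr_lt0 d0.
pose f t x := w x * k t x.
have df (t : R) x : `|t| < delta -> K x -> is_derive t 1 (f ^~ x) (w x * dk t x).
  by move=> td Kx; exact: (is_deriveZ (w x) (dkk t x td Kx)).
have d1f (t : R) x : `|t| < delta -> K x -> partial1of2 f t x = w x * dk t x.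
  by move=> td Kx; rewrite partial1of2E; exact: (@derive_val _ _ _ _ _ _ _ (df t x td Kx)).
have cvgF : h^-1 *: (\int[mu]_(x in K) f (h + 0) x - \int[mu]_(x in K) f 0 x)
    @[h --> 0^'] --> \int[mu]_(x in K) partial1of2 f 0 x.
  apply: (@cvg_differentiation_under_integral R _ T mu f K mK 0 (- delta) delta I0
    _ _ (fun x => `|w x * C|)).
  - by move=> t /ID td; exact: (integrable_mul_bounded mK iw (mk t td) (fun x => kC t x td)).
  - by move=> t x /ID td Kx; exact: (@ex_derive _ _ _ _ _ _ _ (df t x td Kx)).
  - by move=> x.
  - have := @integrable_mul_bounded _ _ _ _ _ _ mK iw (cst C) `|C| _ (fun _ _ => lexx _).
    by move=> /(_ (measurable_cst _)); exact: integrable_norm.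
  - move=> t x /ID td Kx; rewrite d1f// normrM [leRHS]normrM ler_wpM2l//.
    by rewrite (le_trans (dkC t x td Kx))// ler_norm.
rewrite (@eq_Rintegral _ _ _ _ _ (partial1of2 f 0)); last first.
  by move=> x; rewrite inE => Kx; rewrite d1f// normr0.
apply: (@cvg_unique _ _ _ _ _ _ cvgF) => //.
apply: cvg_near_cst; near=> h.
rewrite addr0 /f !k0 ?subrr ?scaler0 ?normr0//.
by near: h; exact: dnbhs0_lt.
Unshelve. all: by end_near. Qed.

End zero_integral_derive.

Section sqdist.
Variables (R : realType) (n : nat).
Implicit Types (x y : 'rV[R]_n).

(** The kernels are written as powers of the squared distance, a polynomial in
    both points, so that their derivatives involve no square root. *)
Definition sqdist x y : R := \sum_(i < n) (x ord0 i - y ord0 i) ^+ 2.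

Lemma sqdistE x y : sqdist x y = enorm (x - y) ^+ 2.
Proof. by rewrite sqr_enorm; apply: eq_bigr => i _; rewrite !mxE. Qed.

Lemma sqdist_ge0 x y : 0 <= sqdist x y.
Proof. by rewrite sqdistE sqr_ge0. Qed.

Lemma coord_le_sqdist x y i : (x ord0 i - y ord0 i) ^+ 2 <= sqdist x y.
Proof.
by rewrite /sqdist (bigD1 i)//= lerDl; apply: sumr_ge0 => j _; rewrite sqr_ge0.
Qed.

Lemma sqdistC x y : sqdist x y = sqdist y x.
Proof. by apply: eq_bigr => i _; rewrite -sqrrN opprB. Qed.

Lemma sqdist_powR x y p : enorm (x - y) `^ p = sqdist x y `^ (p / 2).
Proof.
rewrite sqdistE -powR_mulrn ?enorm_ge0// -powRrM; congr (_ `^ _).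
by rewrite mulrCA mulfV ?mulr1.
Qed.

Lemma sqdist_line x y i t :
  sqdist x (y + t *: unit_vec R i) = sqdist x y - 2 * t * (x ord0 i - y ord0 i) + t ^+ 2.
Proof.
rewrite /sqdist (bigD1 i)//= [in RHS](bigD1 i)//= !mxE !eqxx mulr1.
rewrite (eq_bigr (fun j => (x ord0 j - y ord0 j) ^+ 2)); first by ring.
by move=> j ji; rewrite !mxE eqxx/= (negbTE ji) mulr0 addr0.
Qed.

Lemma measurable_sqdist y (D : set 'rV[R]_n) : measurable_fun D (fun x => sqdist x y).
Proof.
apply: (measurable_funS measurableT) => //.
apply: measurable_sum => i; apply: measurable_funX; apply: measurable_funB => //.
exact: measurable_coord.
Qed.

Lemma measurable_sqdist_powR y r (D : set 'rV[R]_n) :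
  measurable_fun D (fun x => sqdist x y `^ r).
Proof. by apply: measurable_fun_powR; exact: measurable_sqdist. Qed.

Lemma is_derive_sqdist_line x y i (t : R) :
  is_derive t 1 (fun t : R => sqdist x (y + t *: unit_vec R i))
    (- 2 * (x ord0 i - (y + t *: unit_vec R i) ord0 i)).
Proof.
rewrite (_ : (fun t => _) = horner ((sqdist x y)%:P
  - (2 * (x ord0 i - y ord0 i)) *: 'X + 'X^2)).
  apply: is_derive_eq (is_derive_poly _ _) _.
  rewrite derivD derivB derivC derivZ derivX derivXn !hornerE !mxE !eqxx /=.
  by ring.
by apply/funext => h; rewrite sqdist_line !hornerE; ring.
Qed.

Lemma is_derive_sqdist_line_powR x y i (t r : R) : 0 < sqdist x (y + t *: unit_vec R i) ->
  is_derive t 1 (fun t : R => sqdist x (y + t *: unit_vec R i) `^ (- r))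
    (2 * r * ((x ord0 i - (y + t *: unit_vec R i) ord0 i) *
      sqdist x (y + t *: unit_vec R i) `^ (- (r + 1)))).
Proof.
move=> N0; have d1 := is_derive1_powR (- r) N0.
have d2 := @is_derive1_comp _ (fun u : R => u `^ (- r)) _ t _ _ d1
  (is_derive_sqdist_line x y i t).
by apply: is_derive_eq d2 _; rewrite (opprD r 1); ring.
Qed.

(** With [is_derive_sqdist_line_powR], this computes the second derivatives of
    the kernel in the coordinate directions of [y]. *)
Lemma is_derive_coord_sqdist_line_powR x y i (t r : R) :
  0 < sqdist x (y + t *: unit_vec R i) ->
  is_derive t 1 (fun t : R => (x ord0 i - (y + t *: unit_vec R i) ord0 i) *
      sqdist x (y + t *: unit_vec R i) `^ (- r))
    (2 * r * ((x ord0 i - (y + t *: unit_vec R i) ord0 i) ^+ 2 *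
      sqdist x (y + t *: unit_vec R i) `^ (- (r + 1))) -
      sqdist x (y + t *: unit_vec R i) `^ (- r)).
Proof.
move=> N0; have d2 := is_derive_sqdist_line_powR r N0.
have d1 : is_derive t 1 (fun t : R => x ord0 i - (y + t *: unit_vec R i) ord0 i) (-1).
  rewrite (_ : (fun t => _) = horner ((x ord0 i - y ord0 i)%:P - 'X)).
    apply: is_derive_eq (is_derive_poly _ _) _.
    by rewrite derivB derivC derivX !hornerE.
  by apply/funext => h; rewrite !mxE !eqxx !hornerE/=; ring.
apply: is_derive_eq (is_deriveM d1 d2) _.
by rewrite /GRing.scale/=; ring.
Qed.

End sqdist.

Lemma integrable_sumr d (T : measurableType d) (R : realType)
    (mu : {measure set T -> \bar R}) (D : set T) (I : Type) (r : seq I)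
    (h : I -> T -> R) : measurable D ->
  (forall i, mu.-integrable D (EFin \o h i)) ->
  mu.-integrable D (fun x => (\sum_(i <- r) h i x)%:E).
Proof.
move=> mD ih; rewrite (_ : (fun x => _) = (fun x => \sum_(i <- r) (h i x)%:E)%E).
  by apply: integrable_sum => // i _; exact: ih.
by apply/funext => x; rewrite sumEFin.
Qed.

Lemma Rintegral_sum d (T : measurableType d) (R : realType)
    (mu : {measure set T -> \bar R}) (D : set T) (I : Type) (r : seq I)
    (h : I -> T -> R) : measurable D ->
  (forall i, mu.-integrable D (EFin \o h i)) ->
  \int[mu]_(x in D) (\sum_(i <- r) h i x) = \sum_(i <- r) \int[mu]_(x in D) h i x.
Proof.
move=> mD ih; elim: r => [|i r IH].
  by under eq_Rintegral do rewrite big_nil; rewrite Rintegral_cst// mul0r big_nil.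
under eq_Rintegral do rewrite big_cons.
by rewrite RintegralD// ?IH ?big_cons//; exact: integrable_sumr.
Qed.

Section unique_continuation.
Variables (R : realType) (n : nat).
Implicit Types (x y : 'rV[R]_n).
Let mu := leb R n.
Variables (K W : set 'rV[R]_n) (w : 'rV[R]_n -> R) (rho : R).
Hypothesis mK : measurable K.
Hypothesis K_rho : forall x, K x -> forall i, `|x ord0 i| <= rho.
Hypothesis oW : open W.
Hypothesis KW : forall y, W y -> ~ K y.
Hypothesis iw : mu.-integrable K (EFin \o w).

Let mul_powRN (N r : R) : 0 < N -> N * N `^ (- (r + 1)) = N `^ (- r).
Proof.
move=> N0; rewrite -{1}(@powRr1 _ N (ltW N0)) -powRD; last first.
  by rewrite (gt_eqF N0) implybT.
by congr (_ `^ _); ring.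
Qed.

(** A point of [W] has a neighbourhood in [W] on which all kernels centred in
    [K] are bounded uniformly. *)
Lemma sqdist_away y : W y -> exists2 e : R, 0 < e &
  forall y', (forall j, `|y ord0 j - y' ord0 j| < e) ->
    W y' /\ forall x, K x -> e ^+ 2 <= sqdist x y'.
Proof.
move=> Wy; have /nbhs_rVP[e e0 H] : nbhs y W by exact: open_nbhs_nbhs.
exists (e / 2) => [|y' yy']; first by rewrite divr_gt0.
split=> [|x Kx]; first by apply: H => j; apply: lt_trans (yy' j) _; lra.
have [j] : exists j, e <= `|y ord0 j - x ord0 j|.
  apply: contrapT => /forallNP yx; apply: (KW (H x _) Kx) => j.
  by rewrite ltNge; apply/negP; exact: yx.
move=> ej; apply: le_trans (coord_le_sqdist x y' j).
rewrite -[leRHS]real_normK ?num_real// lerXn2r ?nnegrE//; first by rewrite ltW// divr_gt0.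
have := yy' j; have := ler_distD (y' ord0 j) (y ord0 j) (x ord0 j).
rewrite (distrC (y' _ _)); lra.
Qed.

Let line_near y i (t e : R) : `|t| < e ->
  forall j, `|y ord0 j - (y + t *: unit_vec R i) ord0 j| < e.
Proof.
move=> te j; rewrite !mxE opprD addrA subrr sub0r normrN eqxx.
by case: (j == i); rewrite /= ?mulr1 ?mulr0 ?normr0// (le_lt_trans _ te).
Qed.

(* With c = x_i - y_i, |c| <= 1 + c^2 <= 1 + N spares a square root. *)
Let coord_kernel_le (N c m r : R) : 0 < m -> m <= N -> c ^+ 2 <= N -> 0 <= r ->
  `|c * N `^ (- (r + 1))| <= m `^ (- (r + 1)) + m `^ (- r).
Proof.
move=> m0 mN cN r0; have N0 := lt_le_trans m0 mN.
rewrite normrM (ger0_norm (powR_ge0 _ _)).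
apply: (@le_trans _ _ ((1 + N) * N `^ (- (r + 1)))).
  rewrite ler_wpM2r ?powR_ge0//.
  have : `|c| ^+ 2 <= N by rewrite real_normK ?num_real.
  have := normr_ge0 c; nra.
by rewrite mulrDl mul1r mul_powRN// lerD// ler_powRN// addr_ge0.
Qed.

Lemma riesz_zero_gradient q : 0 < q ->
  (forall y, W y -> \int[mu]_(x in K) (w x * sqdist x y `^ (- q)) = 0) ->
  forall i y, W y ->
  \int[mu]_(x in K) (w x * ((x ord0 i - y ord0 i) * sqdist x y `^ (- (q + 1)))) = 0.
Proof.
move=> q0 H i y Wy; have [e e0 He] := sqdist_away Wy.
have e20 : 0 < e ^+ 2 by rewrite exprn_gt0.
have Ht (t : R) : `|t| < e -> W (y + t *: unit_vec R i) /\
    forall x, K x -> e ^+ 2 <= sqdist x (y + t *: unit_vec R i).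
  by move=> te; apply: He; exact: line_near.
pose k (t : R) x := sqdist x (y + t *: unit_vec R i) `^ (- q).
pose dk (t : R) x := 2 * q * ((x ord0 i - (y + t *: unit_vec R i) ord0 i) *
  sqdist x (y + t *: unit_vec R i) `^ (- (q + 1))).
have q20 : 0 <= 2 * q by rewrite mulr_ge0// ltW.
pose C0 := (e ^+ 2) `^ (- (q + 1)) + (e ^+ 2) `^ (- q).
have C00 : 0 <= C0 by rewrite addr_ge0 ?powR_ge0.
have dkC (t : R) x : `|t| < e -> K x ->
    `|(x ord0 i - (y + t *: unit_vec R i) ord0 i) *
      sqdist x (y + t *: unit_vec R i) `^ (- (q + 1))| <= C0.
  move=> te Kx; apply: coord_kernel_le => //; last exact: ltW.
    exact: (Ht t te).2.
  exact: coord_le_sqdist.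
have E : \int[mu]_(x in K) (w x * dk 0 x) = 0.
  apply: (@zero_integral_derive _ _ _ mu K w mK iw k dk e
    ((e ^+ 2) `^ (- q) + 2 * q * C0) e0).
  - by move=> t _; exact: measurable_sqdist_powR.
  - move=> t x te Kx; rewrite ger0_norm ?powR_ge0// (@le_trans _ _ ((e ^+ 2) `^ (- q)))//.
      by rewrite ler_powRN ?(ltW q0)//; exact: (Ht t te).2.
    by rewrite lerDl mulr_ge0.
  - move=> t x te Kx; apply: is_derive_sqdist_line_powR.
    by apply: lt_le_trans e20 _; exact: (Ht t te).2.
  - move=> t x te Kx; rewrite normrM (ger0_norm q20).
    by rewrite (le_trans (ler_wpM2l q20 (dkC t x te Kx)))// lerDr powR_ge0.
  - by move=> t te; apply: H; exact: (Ht t te).1.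
have ig : mu.-integrable K (fun x =>
    (w x * ((x ord0 i - y ord0 i) * sqdist x y `^ (- (q + 1))))%:E).
  apply: (integrable_mul_bounded (M := C0) mK iw).
    apply: measurable_funM; last exact: measurable_sqdist_powR.
    apply: (measurable_funS measurableT) => //; apply: measurable_funB => //.
    exact: measurable_coord.
  by move=> x Kx; have := dkC 0 x; rewrite scale0r addr0 normr0; exact.
move: E; rewrite /dk scale0r addr0.
under eq_Rintegral do rewrite mulrCA.
rewrite (RintegralZl _ mK ig) => /eqP.
by rewrite mulf_eq0 mulf_eq0 (gt_eqF q0) pnatr_eq0/= => /eqP.
Qed.

Lemma riesz_zero_hessian q : 0 < q -> forall i,
  (forall y, W y -> \int[mu]_(x in K)
    (w x * ((x ord0 i - y ord0 i) * sqdist x y `^ (- (q + 1)))) = 0) ->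
  forall y, W y ->
  \int[mu]_(x in K) (w x * (2 * (q + 1) * ((x ord0 i - y ord0 i) ^+ 2 *
    sqdist x y `^ (- (q + 1 + 1))) - sqdist x y `^ (- (q + 1)))) = 0.
Proof.
move=> q0 i H y Wy; have [e e0 He] := sqdist_away Wy.
have e20 : 0 < e ^+ 2 by rewrite exprn_gt0.
have Ht (t : R) : `|t| < e -> W (y + t *: unit_vec R i) /\
    forall x, K x -> e ^+ 2 <= sqdist x (y + t *: unit_vec R i).
  by move=> te; apply: He; exact: line_near.
pose k (t : R) x := (x ord0 i - (y + t *: unit_vec R i) ord0 i) *
  sqdist x (y + t *: unit_vec R i) `^ (- (q + 1)).
pose dk (t : R) x := 2 * (q + 1) * ((x ord0 i - (y + t *: unit_vec R i) ord0 i) ^+ 2 *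
  sqdist x (y + t *: unit_vec R i) `^ (- (q + 1 + 1))) -
  sqdist x (y + t *: unit_vec R i) `^ (- (q + 1)).
have q10 : 0 <= q + 1 by rewrite addr_ge0// ltW.
have q20 : 0 <= 2 * (q + 1) by rewrite mulr_ge0.
have := powR_ge0 (e ^+ 2) (- (q + 1)); have := powR_ge0 (e ^+ 2) (- q).
set m1 := _ `^ (- q); set m2 := _ `^ _ => m10 m20.
have H2 : 0 <= 2 * (q + 1) * m2 by exact: mulr_ge0.
have E : \int[mu]_(x in K) (w x * dk 0 x) = 0.
  apply: (@zero_integral_derive _ _ _ mu K w mK iw k dk e
    (m2 + m1 + 2 * (q + 1) * m2) e0).
  - move=> t _; apply: measurable_funM; last exact: measurable_sqdist_powR.
    apply: (measurable_funS measurableT) => //; apply: measurable_funB => //.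
    exact: measurable_coord.
  - move=> t x te Kx; apply: (@le_trans _ _ (m2 + m1)); last by rewrite lerDl.
    apply: coord_kernel_le => //; [|exact: coord_le_sqdist|exact: ltW].
    exact: (Ht t te).2.
  - move=> t x te Kx; apply: is_derive_coord_sqdist_line_powR.
    by apply: lt_le_trans e20 _; exact: (Ht t te).2.
  - move=> t x te Kx; rewrite /dk; set c := x ord0 i - _; set N := sqdist _ _.
    have mN : e ^+ 2 <= N by exact: (Ht t te).2.
    have cN : c ^+ 2 <= N by exact: coord_le_sqdist.
    have N0 : 0 < N by exact: lt_le_trans mN.
    have N1 : N `^ (- (q + 1)) <= m2 by exact: ler_powRN.
    have N2 : c ^+ 2 * N `^ (- (q + 1 + 1)) <= m2.
      by apply: le_trans N1; rewrite -(mul_powRN (q + 1) N0) ler_wpM2r ?powR_ge0.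
    rewrite (le_trans (ler_normB _ _))// normrM (ger0_norm q20).
    rewrite (ger0_norm (powR_ge0 _ _)) (ger0_norm (mulr_ge0 (sqr_ge0 _) (powR_ge0 _ _))).
    have := ler_wpM2l q20 N2; lra.
  - by move=> t te; apply: H; exact: (Ht t te).1.
by move: E; rewrite /dk scale0r addr0.
Qed.

(** Up to the factor [2 q], the sum over [i] of the second derivatives of the
    kernel ([riesz_zero_hessian]) is its Laplacian,
    [(2 (q + 1) - n) |x - y|^(-2(q+1))]; the first factor is positive. *)
Lemma riesz_zero_succ q : 0 < q -> n%:R < 2 * (q + 1) ->
  (forall y, W y -> \int[mu]_(x in K) (w x * sqdist x y `^ (- q)) = 0) ->
  forall y, W y -> \int[mu]_(x in K) (w x * sqdist x y `^ (- (q + 1))) = 0.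
Proof.
move=> q0 nq H y Wy; have [e e0 /(_ y)] := sqdist_away Wy.
case=> [j|_ He]; first by rewrite subrr normr0.
have e20 : 0 < e ^+ 2 by rewrite exprn_gt0.
have q10 : 0 <= q + 1 by rewrite addr_ge0// ltW.
have ig : mu.-integrable K (fun x => (w x * sqdist x y `^ (- (q + 1)))%:E).
  apply: (integrable_mul_bounded (M := (e ^+ 2) `^ (- (q + 1))) mK iw).
    exact: measurable_sqdist_powR.
  by move=> x Kx; rewrite ger0_norm ?powR_ge0// ler_powRN// He.
pose h i x := w x * (2 * (q + 1) * ((x ord0 i - y ord0 i) ^+ 2 *
    sqdist x y `^ (- (q + 1 + 1))) - sqdist x y `^ (- (q + 1))).
have h0 i : \int[mu]_(x in K) h i x = 0.
  by apply: riesz_zero_hessian => // y' Wy'; exact: riesz_zero_gradient.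
have ih i : mu.-integrable K (EFin \o h i).
  apply: (integrable_mul_bounded
    (M := 2 * (q + 1) * (e ^+ 2) `^ (- (q + 1)) + (e ^+ 2) `^ (- (q + 1))) mK iw).
    apply: measurable_funB; last exact: measurable_sqdist_powR.
    apply: measurable_funM => //; apply: measurable_funM; last exact: measurable_sqdist_powR.
    apply: (measurable_funS measurableT) => //; apply: measurable_funX.
    apply: measurable_funB => //.
    exact: measurable_coord.
  move=> x Kx; have mN := He x Kx; have N0 : 0 < sqdist x y by exact: lt_le_trans mN.
  have N1 : sqdist x y `^ (- (q + 1)) <= (e ^+ 2) `^ (- (q + 1)) by exact: ler_powRN.
  have N2 : (x ord0 i - y ord0 i) ^+ 2 * sqdist x y `^ (- (q + 1 + 1)) <=
      (e ^+ 2) `^ (- (q + 1)).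
    apply: le_trans N1; rewrite -(mul_powRN (q + 1) N0) ler_wpM2r ?powR_ge0//.
    exact: coord_le_sqdist.
  have q20 : 0 <= 2 * (q + 1) by rewrite mulr_ge0.
  rewrite (le_trans (ler_normB _ _))// normrM (ger0_norm q20).
  rewrite (ger0_norm (powR_ge0 _ _)) (ger0_norm (mulr_ge0 (sqr_ge0 _) (powR_ge0 _ _))).
  by rewrite lerD// ler_wpM2l.
have : \int[mu]_(x in K) (\sum_(i < n) h i x) = 0.
  by rewrite Rintegral_sum// big1.
have hE x : K x -> \sum_(i < n) h i x =
    (2 * (q + 1) - n%:R) * (w x * sqdist x y `^ (- (q + 1))).
  move=> Kx; have N0 : 0 < sqdist x y by exact: lt_le_trans (He x Kx).
  rewrite /h -mulr_sumr sumrB sumr_const card_ord -mulr_sumr -mulr_suml.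
  by rewrite -/(sqdist x y) mul_powRN// -mulr_natl; ring.
rewrite (@eq_Rintegral _ _ _ _ _ (fun x =>
  (2 * (q + 1) - n%:R) * (w x * sqdist x y `^ (- (q + 1))))); last first.
  by move=> x; rewrite inE; exact: hE.
rewrite (RintegralZl _ mK ig) => /eqP; rewrite mulf_eq0 => /orP[/eqP|/eqP//]; lra.
Qed.

Lemma riesz_zero_addn q k : 0 < q -> n%:R < 2 * (q + 1) ->
  (forall y, W y -> \int[mu]_(x in K) (w x * sqdist x y `^ (- q)) = 0) ->
  forall y, W y -> \int[mu]_(x in K) (w x * sqdist x y `^ (- (q + k%:R))) = 0.
Proof.
move=> q0 nq H; elim: k => [|k IH] y Wy; first by rewrite addr0; exact: H.
rewrite -natr1 addrA; apply: riesz_zero_succ => //.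
  by rewrite ltr_wpDr.
by have : 0 <= k%:R :> R by []; lra.
Qed.

Lemma sqdist_bounded y : exists M : R, forall x, K x -> sqdist x y <= M.
Proof.
exists (\sum_(i < n) (rho + `|y ord0 i|) ^+ 2) => x Kx.
apply: ler_sum => i _; rewrite -real_normK ?num_real// lerXn2r ?nnegrE//.
  by rewrite addr_ge0// (le_trans _ (K_rho Kx i)).
by rewrite (le_trans (ler_normB _ _))// lerD2r K_rho.
Qed.

Lemma integrable_mul_sqdistX y j :
  mu.-integrable K (fun x => (w x * sqdist x y ^+ j)%:E).
Proof.
have [M HM] := sqdist_bounded y.
apply: (integrable_mul_bounded (M := M ^+ j) mK iw).
  by apply: measurable_funX; exact: measurable_sqdist.
move=> x Kx; rewrite normrX ger0_norm ?sqdist_ge0// lerXn2r ?nnegrE ?sqdist_ge0 ?HM//.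
exact: le_trans (sqdist_ge0 x y) (HM x Kx).
Qed.

(** The moments of [w |x - y|^(-2q)] with respect to [|x - y|^(-2)] are the
    potentials of exponents [q + k]; [|x - y|^(2j)] is obtained by testing with
    the power function of exponent [- (q + j)], Lipschitz away from 0. *)
Lemma riesz_zero_sqdistX q : 0 < q -> n%:R < 2 * (q + 1) ->
  (forall y, W y -> \int[mu]_(x in K) (w x * sqdist x y `^ (- q)) = 0) ->
  forall j y, W y -> \int[mu]_(x in K) (w x * sqdist x y ^+ j) = 0.
Proof.
move=> q0 nq H j y Wy; have [e e0 /(_ y)] := sqdist_away Wy.
case=> [i|_ He]; first by rewrite subrr normr0.
have e20 : 0 < e ^+ 2 by rewrite exprn_gt0.
have [M HM] := sqdist_bounded y.
pose b := (e ^+ 2)^-1; pose a := (`|M| + e ^+ 2 + 1)^-1.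
have A0 : 0 < `|M| + e ^+ 2 + 1 by rewrite ltr_wpDl// addr_ge0// ltW.
have a0 : 0 < a by rewrite invr_gt0.
have ab : a < b.
  rewrite ltf_pV2 ?posrE//.
  have := normr_ge0 M; lra.
have gab x : K x -> a <= (sqdist x y)^-1 <= b.
  move=> Kx; have N0 : 0 < sqdist x y by exact: lt_le_trans (He x Kx).
  rewrite !lef_pV2 ?posrE//.
  rewrite He// andbT; have := HM x Kx; have := ler_norm M; lra.
have iv : mu.-integrable K (EFin \o (fun x => w x * sqdist x y `^ (- q))).
  apply: (integrable_mul_bounded (M := (e ^+ 2) `^ (- q)) mK iw).
    exact: measurable_sqdist_powR.
  by move=> x Kx; rewrite ger0_norm ?powR_ge0// ler_powRN ?(ltW q0)// He.
have mg : measurable_fun K (fun x => (sqdist x y)^-1).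
  rewrite (_ : (fun _ => _) = fun x => sqdist x y `^ (- 1)).
    exact: measurable_sqdist_powR.
  by apply/funext => x; rewrite powR_inv1// sqdist_ge0.
pose r := q + j%:R; have r0 : 0 <= r by rewrite addr_ge0// ltW.
have VE x k : K x -> w x * sqdist x y `^ (- q) * (sqdist x y)^-1 ^+ k =
    w x * sqdist x y `^ (- (q + k%:R)).
  move=> Kx; have N0 : 0 < sqdist x y by exact: lt_le_trans (He x Kx).
  rewrite -mulrA opprD powRD ?(gt_eqF N0) ?implybT//.
  by rewrite (powRN _ k%:R) powR_mulrn ?(ltW N0)// exprVn.
have E : \int[mu]_(x in K) (w x * sqdist x y `^ (- q) * (sqdist x y)^-1 `^ (- r)) = 0.
  apply: (@moments_lipschitz _ _ _ mu K _ _ a b mK iv mg ab gab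
    (fun u => u `^ (- r)) (r * a `^ (- (r + 1)))).
  - move=> k; rewrite (@eq_Rintegral _ _ _ _ _ (fun x => w x * sqdist x y `^ (- (q + k%:R)))).
      exact: riesz_zero_addn.
    by move=> x; rewrite inE; exact: VE.
  - exact: measurable_fun_powR.
  - move=> u v uab vab; rewrite distrC (distrC u).
    apply: (@is_derive_lipschitz _ (fun t : R => t `^ (- r))
      (fun t => - r * t `^ (- r - 1)) _ `[a, b]);
      rewrite ?in_itv//.
    + move=> t; rewrite in_itv/= => /andP[at_ _].
      by apply: is_derive1_powR; exact: lt_le_trans at_.
    + move=> t; rewrite in_itv/= => /andP[at_ _].
      rewrite normrM normrN (ger0_norm r0) (ger0_norm (powR_ge0 _ _)) ler_wpM2l//.
      by rewrite -opprD ler_powRN// addr_ge0.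
rewrite -[RHS]E; apply: eq_Rintegral => x; rewrite inE => Kx.
have N0 : 0 < sqdist x y by exact: lt_le_trans (He x Kx).
rewrite -mulrA; congr (_ * _).
rewrite -(@powR_inv1 _ (sqdist x y)) ?(ltW N0)// -powRrM mulN1r opprK.
rewrite -powRD ?(gt_eqF N0) ?implybT// /r addKr powR_mulrn// ltW//.
Qed.

(** On the line from [y0] to a given point, the integral is a polynomial of degree
    at most [2 j], and it vanishes near [y0].  Integrating the Lagrange
    interpolation formula of the integrand, instead of expanding the integral,
    avoids handling its coefficients. *)
Lemma sqdistX_zero_everywhere j y0 : W y0 ->
  (forall y, W y -> \int[mu]_(x in K) (w x * sqdist x y ^+ j) = 0) ->
  forall y, \int[mu]_(x in K) (w x * sqdist x y ^+ j) = 0.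
Proof.
move=> Wy0 H y1; pose v := y1 - y0.
pose P x : {poly R} := (\sum_(i < n) ((x ord0 i - y0 ord0 i)%:P - v ord0 i *: 'X) ^+ 2) ^+ j.
have PE x t : (P x).[t] = sqdist x (y0 + t *: v) ^+ j.
  rewrite /P horner_exp horner_sum; congr (_ ^+ j); apply: eq_bigr => i _.
  by rewrite horner_exp !hornerE !mxE; congr (_ ^+ 2); ring.
have sP x : (size (P x) <= (2 * j).+1)%N.
  apply: leq_trans (size_poly_exp_leq _ _) _; rewrite ltnS leq_mul2r.
  apply/orP; right; rewrite -subn1 leq_subLR.
  apply: leq_trans (size_sum _ _ _) _; apply/bigmax_leqP => i _.
  apply: leq_trans (size_poly_exp_leq _ _) _; rewrite ltnS -[leqRHS]mul1n leq_mul2r/=.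
  rewrite -subn1 leq_subLR; apply: leq_trans (size_polyD _ _) _.
  rewrite geq_max (leq_trans (size_polyC_leq1 _))//= size_polyN.
  by rewrite (leq_trans (size_scale_leq _ _))// size_polyX.
have /nbhs_rVP[e e0 He] : nbhs y0 W by exact: open_nbhs_nbhs.
pose V := 1 + \sum_(i < n) `|v ord0 i|.
have V0 : 0 < V by rewrite ltr_wpDr// sumr_ge0.
(* Infinitely many distinct parameters t for which y0 + t v stays in W; the
   point y1 is reached at t = 1. *)
pose tau (i : nat) := e / V / i.+1%:R.
have tau_inj : injective tau.
  move=> i k; rewrite /tau => /mulfI; rewrite gt_eqF ?divr_gt0// => /(_ isT)/invr_inj.
  by move=> /eqP; rewrite eqr_nat => /eqP[].
have Wtau i : W (y0 + tau i *: v).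
  apply: He => l; rewrite mxE opprD addrA subrr sub0r normrN.
  rewrite [fun_of_matrix (_ *: _) _ _]mxE normrM.
  have vl : `|v ord0 l| < V.
    rewrite /V (bigD1 l)//= addrCA ltrDl ltr_wpDr// sumr_ge0//.
  have ti : 0 < tau i by rewrite !divr_gt0.
  rewrite (gtr0_norm ti) /tau.
  apply: (@le_lt_trans _ _ (e / V * `|v ord0 l|)).
    rewrite ler_wpM2r// ler_piMr ?divr_ge0 ?(ltW e0) ?(ltW V0)//.
    by rewrite invf_le1// ler1n.
  by rewrite mulrAC ltr_pdivrMr// ltr_pM2l.
pose N := (2 * j).+1.
pose L (i : 'I_N) : R := (tnth (qpoly.lagrange N tau) i : {poly R}).[1].
have E x : w x * sqdist x y1 ^+ j =
    \sum_(i < N) L i * (w x * sqdist x (y0 + tau i *: v) ^+ j).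
  have -> : sqdist x y1 = sqdist x (y0 + 1 *: v) by rewrite scale1r addrC subrK.
  rewrite -PE {1}(@qpoly.lagrange_gen _ N tau isT tau_inj (P x) (sP x)).
  rewrite horner_sum mulr_sumr; apply: eq_bigr => i _.
  by rewrite hornerM hornerC -PE -/(L i); ring.
have ih (i : 'I_N) : mu.-integrable K (EFin \o
    (fun x => L i * (w x * sqdist x (y0 + tau i *: v) ^+ j))).
  exact: (integrableZl mK _ (integrable_mul_sqdistX _ j)).
rewrite (eq_Rintegral _ (fun x _ => E x)) Rintegral_sum// big1// => i _.
by rewrite (RintegralZl _ mK (integrable_mul_sqdistX _ j)) H// mulr0.
Qed.

(** Any Lipschitz function of [|x - y|^2] would do; the tents suffice, being
    nonnegative with support in a ball around an arbitrary centre. *)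
Lemma tent_zero q y0 : W y0 -> 0 < q -> n%:R < 2 * (q + 1) ->
  (forall y, W y -> \int[mu]_(x in K) (w x * sqdist x y `^ (- q)) = 0) ->
  forall y eps, \int[mu]_(x in K) (w x * Num.max 0 (eps - sqdist x y)) = 0.
Proof.
move=> Wy0 q0 nq H y eps; have [M HM] := sqdist_bounded y.
have M1 : 0 < `|M| + 1 by rewrite ltr_wpDl.
have gM x : K x -> 0 <= sqdist x y <= `|M| + 1.
  move=> Kx; rewrite sqdist_ge0/= (le_trans (HM x Kx))//.
  by rewrite (le_trans (ler_norm M))// lerDl.
pose h (u : R) := Num.max 0 (eps - u).
apply: (@moments_lipschitz _ _ _ mu K w (fun x => sqdist x y) 0 (`|M| + 1) mK iw
  (@measurable_sqdist _ _ y K) M1 gM h 1).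
- by move=> k; apply: (sqdistX_zero_everywhere Wy0); exact: (riesz_zero_sqdistX q0 nq H).
- apply: measurable_maxr => //; apply: measurable_funB => //; exact: measurable_sqdist.
- move=> u v _ _; rewrite mul1r /h.
  have := ler_norm (u - v); have := ler_norm (v - u); rewrite (distrC v).
  case: (leP 0 (eps - u)); case: (leP 0 (eps - v)) => h1 h2 N1 N2;
    rewrite ?max_r ?max_l ?ler_norml//; lra.
Qed.

End unique_continuation.

Lemma riesz_potential_unique_continuation (R : realType) (n : nat)
    (K W : set 'rV[R]_n) (w : 'rV[R]_n -> R) (rho q : R) :
  measurable K -> (forall x, K x -> forall i, `|x ord0 i| <= rho) ->
  open W -> W !=set0 -> (forall y, W y -> ~ K y) ->
  (leb R n).-integrable K (EFin \o w) -> continuous w -> (forall x, ~ K x -> w x = 0) ->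
  0 < q -> n%:R < 2 * (q + 1) ->
  (forall y, W y -> \int[leb R n]_(x in K) (w x * sqdist x y `^ (- q)) = 0) ->
  forall x, w x = 0.
Proof.
move=> mK K_rho oW [y0 Wy0] KW.
have pos (u : 'rV[R]_n -> R) : (leb R n).-integrable K (EFin \o u) -> continuous u ->
    (forall x, ~ K x -> u x = 0) -> 0 < q -> n%:R < 2 * (q + 1) ->
    (forall y, W y -> \int[leb R n]_(x in K) (u x * sqdist x y `^ (- q)) = 0) ->
    forall x, u x <= 0.
  move=> iu cu u0 q0 nq H x; rewrite leNgt; apply/negP => ux.
  have /nbhs_rVP[e e0 He] : nbhs x [set y | 0 < u y].
    exact: (cvgr_gt (u x) (cu x)) ux.
  have uK y : 0 < u y -> K y.
    by move=> uy; apply: contrapT => /u0 uy0; rewrite uy0 ltxx in uy.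
  (* The factor n + 1 puts this box inside the Euclidean ball of radius e. *)
  have /nbhs_box[a [b [xab abU]]] :
      nbhs x [set y | forall i, `|x ord0 i - y ord0 i| < e / (n%:R + 1)].
    by apply/nbhs_rVP; exists (e / (n%:R + 1)) => //; rewrite divr_gt0// ltr_wpDl.
  have n1 : 0 < n%:R + 1 :> R by rewrite ltr_wpDl.
  have iT : (leb R n).-integrable K
      (EFin \o (fun y => u y * Num.max 0 (e ^+ 2 - sqdist y x))).
    apply: (integrable_mul_bounded (M := e ^+ 2) mK iu).
      apply: measurable_maxr => //; apply: measurable_funB => //; exact: measurable_sqdist.
    move=> y Ky; rewrite ger0_norm ?le_max ?lexx// ge_max sqr_ge0/=.
    by rewrite lerBlDr lerDl sqdist_ge0.
  have tent_supp y : 0 < Num.max 0 (e ^+ 2 - sqdist y x) -> 0 < u y.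
    rewrite lt_max ltxx/= subr_gt0 => yx; apply: He => i.
    rewrite distrC -(@ltr_pXn2r _ 2) ?nnegrE ?(ltW e0)// real_normK ?num_real//.
    exact: le_lt_trans (coord_le_sqdist y x i) yx.
  have : 0 < \int[leb R n]_(y in K) (u y * Num.max 0 (e ^+ 2 - sqdist y x)).
    apply: (@Rintegral_gt0 _ _ _ _ _ (box a b)) => //.
    - exact: measurable_box.
    - move=> y yab; apply/uK/He => i; apply: lt_le_trans (abU y yab i) _.
      by rewrite ler_pdivrMr// ler_peMr ?(ltW e0)// lerDr.
    - by apply: leb_box_gt0; exists x.
    - move=> y Ky; have [t0|t0] := ltP 0 (Num.max 0 (e ^+ 2 - sqdist y x)).
        by rewrite mulr_ge0 ?(ltW t0)// ltW// tent_supp.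
      rewrite (_ : Num.max _ _ = 0) ?mulr0//.
      by apply/eqP; rewrite eq_le t0 le_max lexx.
    - move=> y yab; have t0 : 0 < Num.max 0 (e ^+ 2 - sqdist y x).
        rewrite lt_max ltxx/= subr_gt0.
        apply: (@le_lt_trans _ _ (\sum_(i < n) (e / (n%:R + 1)) ^+ 2)).
          apply: ler_sum => i _; rewrite -real_normK ?num_real// distrC.
          by rewrite lerXn2r ?nnegrE ?divr_ge0 ?(ltW e0) ?(ltW n1)// ltW// abU.
        rewrite sumr_const card_ord -[ltLHS]mulr_natl expr_div_n mulrA ltr_pdivrMr ?exprn_gt0//.
        have : 0 <= n%:R :> R by []; move: (n%:R : R) n1 => m m1 m0.
        have := exprn_gt0 2 e0; nra.
      by rewrite mulr_gt0// tent_supp.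
  by rewrite (tent_zero mK K_rho oW KW iu Wy0 q0 nq H) ltxx.
move=> iw cw w0 q0 nq H x; apply/eqP; rewrite eq_le; apply/andP; split.
  exact: (pos w).
rewrite -oppr_le0; apply: (pos (fun y => - w y)) => //.
- have := integrableN iw; apply: eq_integrable => // y _.
- by move=> y; exact: (cvgN (cw y)).
- by move=> y /w0 ->; rewrite oppr0.
- move=> y Wy; under eq_Rintegral do rewrite mulNr -mulN1r.
  have [e e0 /(_ y)] := sqdist_away oW KW Wy.
  case=> [i|_ He]; first by rewrite subrr normr0.
  rewrite RintegralZl// ?H ?mulr0//.
  apply: (integrable_mul_bounded (M := (e ^+ 2) `^ (- q)) mK iw).
    exact: measurable_sqdist_powR.
  by move=> z Kz; rewrite ger0_norm ?powR_ge0// ler_powRN ?(ltW q0) ?exprn_gt0// He.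
Qed.

(** * Hoelder functions and the nonlinearity *)

Section hoelder.
Variables (R : realType) (n : nat).
Implicit Types (x y : 'rV[R]_n) (f : 'rV[R]_n -> R) (U : set 'rV[R]_n).

(** The [hoelder_norm] is a sum of two suprema in the extended reals; two
    distinct points make both of them suprema of nonempty sets, hence
    nonnegative, so that each is bounded by the norm. *)
Definition nontrivial U := exists p q, [/\ U p, U q & p != q].

Lemma hoelder_norm_bounds (al : R) U f : nontrivial U ->
  (forall x, U x -> (`|f x|%:E <= hoelder_norm al U f)%E) /\
  (forall x y, U x -> U y -> x != y ->
    ((`|f x - f y| / enorm (x - y) `^ al)%:E <= hoelder_norm al U f)%E).
Proof.
move=> [p [q [Up Uq pq]]]; rewrite /hoelder_norm.
set s1 := ereal_sup _; set s2 := ereal_sup _.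
have H1 x : U x -> (`|f x|%:E <= s1)%E by move=> Ux; apply: ereal_sup_ubound; exists x.
have H2 x y : U x -> U y -> x != y ->
    ((`|f x - f y| / enorm (x - y) `^ al)%:E <= s2)%E.
  by move=> Ux Uy xy; apply: ereal_sup_ubound; exists (x, y).
have s10 : (0 <= s1)%E by apply: le_trans (H1 p Up); rewrite lee_fin.
have s20 : (0 <= s2)%E.
  by apply: le_trans (H2 p q Up Uq pq); rewrite lee_fin divr_ge0// powR_ge0.
split=> [x Ux|x y Ux Uy xy].
  by apply: le_trans (H1 x Ux) _; rewrite leeDl.
by apply: le_trans (H2 x y Ux Uy xy) _; rewrite leeDr.
Qed.

Lemma hoelder_spaceP (al : R) U f : nontrivial U -> hoelder_space al U f ->
  exists C : R, (forall x, U x -> `|f x| <= C) /\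
    (forall x y, U x -> U y -> `|f x - f y| <= C * enorm (x - y) `^ al).
Proof.
move=> ntU; have [H1 H2] := hoelder_norm_bounds al f ntU.
rewrite /hoelder_space /=; set N := hoelder_norm _ _ _ => Noo.
have NE : N = (fine N)%:E.
  have [p [_ [Up _ _]]] := ntU.
  rewrite fineK// fin_numElt Noo andbT (lt_le_trans _ (H1 p Up))//.
  by rewrite ltNyr.
exists (fine N); split=> [x Ux|x y Ux Uy]; first by rewrite -lee_fin -NE; exact: H1.
have [->|xy] := eqVneq x y.
  rewrite !subrr normr0 mulr_ge0 ?powR_ge0// -lee_fin -NE.
  by apply: le_trans (H1 y Uy); rewrite lee_fin.
have exy : 0 < enorm (x - y) `^ al by rewrite powR_gt0// enorm_gt0 subr_eq0.
by rewrite -ler_pdivrMr// -lee_fin -NE; exact: H2.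
Qed.

Lemma hoelder_continuous_at (al C : R) U f x : 0 < al ->
  (forall x y, U x -> U y -> `|f x - f y| <= C * enorm (x - y) `^ al) ->
  nbhs x U -> {for x, continuous f}.
Proof.
move=> al0 fC /nbhs_rVP[d d0 xU]; apply/(@cvgrPdist_le _ _ _ (nbhs x)) => e e0.
have Ux : U x by apply: xU => i; rewrite subrr normr0.
pose e1 := e / (`|C| + 1); have e10 : 0 < e1 by rewrite divr_gt0// ltr_wpDl.
pose r := e1 `^ al^-1; have r0 : 0 < r by exact: powR_gt0.
pose r1 := Num.min d (r / (n%:R + 1)).
have r10 : 0 < r1 by rewrite lt_min d0 divr_gt0// ltr_wpDl.
apply/nbhs_rVP; exists r1 => // y xy.
have Uy : U y by apply: xU => i; apply: lt_le_trans (xy i) _; rewrite ge_min lexx.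
apply: le_trans (fC x y Ux Uy) _.
have exy : enorm (x - y) <= r.
  apply: le_trans (enorm_le_norm _) _.
  have : `|x - y| <= r1.
    rewrite [leLHS]/Num.norm/= mx_normrE; apply/bigmax_leP; split=> [|[i j] _ /=].
      exact: ltW.
    by rewrite (ord1 i) !mxE ltW.
  have : r1 <= r / (n%:R + 1) by rewrite ge_min lexx orbT.
  rewrite ler_pdivlMr ?ltr_wpDl// => h1 h2.
  have := ler_wpM2l (ler0n R n) h2; have := ltW r10; lra.
rewrite (le_trans (ler_wpM2r (powR_ge0 _ _) (ler_norm C)))//.
apply: (@le_trans _ _ (`|C| * e1)).
  rewrite ler_wpM2l//; apply: (@le_trans _ _ (r `^ al)).
    by rewrite ge0_ler_powR ?nnegrE ?enorm_ge0 ?(ltW al0) ?(ltW r0).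
  by rewrite /r -powRrM mulVf ?gt_eqF// powRr1// ltW.
rewrite /e1 mulrA ler_pdivrMr ?ltr_wpDl//.
by rewrite mulrC ler_pM2l// lerDl.
Qed.

Lemma nontrivial_nbhs x U : (1 <= n)%N -> nbhs x U -> nontrivial U.
Proof.
move=> n1 /nbhs_rVP[e e0 H].
exists x, (x + (e / 2) *: const_mx 1); split.
- by apply: H => i; rewrite subrr normr0.
- apply: H => i; rewrite !mxE opprD addrA subrr sub0r normrN mulr1 gtr0_norm ?divr_gt0//; lra.
- rewrite -subr_eq0 opprD addrA subrr sub0r oppr_eq0; apply/eqP => /rowP/(_ (Ordinal n1)).
  by rewrite !mxE mulr1; apply/eqP; rewrite gt_eqF// divr_gt0.
Qed.

End hoelder.

Section nonlinearity.
Variables (R : realType) (n : nat) (s : R) (Omega : set 'rV[R]_n)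
  (a : 'rV[R]_n -> R -> R) (u : 'rV[R]_n -> R) (Z : R).
Hypotheses (n1 : (1 <= n)%N) (s0 : 0 < s) (oOmega : open Omega) (neOmega : Omega !=set0).
Hypothesis ha : holomorphic_Cs s Omega a.
Hypothesis cu : continuous u.
Hypothesis uZ : forall x, `|u x| <= Z.

Let U := closure Omega.
Let OU : Omega `<=` U. Proof. exact: subset_closure. Qed.
Let ntU : nontrivial U.
Proof.
have [x Ox] := neOmega.
have [p [q [Op Oq pq]]] := nontrivial_nbhs n1 (open_nbhs_nbhs (conj oOmega Ox)).
by exists p, q; split => //; exact: OU.
Qed.

Let term k x z := taylor_coef a k x * z ^+ k / k`!%:R.
Let partial_sum N x z := \sum_(1 <= k < N) term k x z.

(* Convergence in the Hoelder norm for a fixed z is used only through the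
   uniform convergence in x that it implies. *)
Let remainder_cvg z e : 0 < e -> exists N0, forall N, (N0 <= N)%N ->
  forall x, U x -> `|a x z - partial_sum N x z| <= e.
Proof.
move=> e0; have [_ /(_ z) H] := ha.
pose rem N x := a x z - partial_sum N x z.
have {}H : hoelder_norm s U (rem N) @[N --> \oo] --> (0 : R)%:E by exact: H.
have : \forall N \near \oo, (hoelder_norm s U (rem N) <= e%:E)%E.
  move: H => /fine_cvgP[Hfin] /cvgrPdist_le/(_ e e0) Hc.
  near=> N.
  have /fineK <- : hoelder_norm s U (rem N) \is a fin_num by near: N.
  rewrite lee_fin.
  have : `|0 - fine (hoelder_norm s U (rem N))| <= e by near: N.
  by rewrite sub0r normrN; apply: le_trans; exact: ler_norm.
move=> [N0 _ HN0]; exists N0 => N /HN0 /= HN x Ux.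
rewrite -lee_fin; apply: le_trans HN.
by have [H1 _] := hoelder_norm_bounds s (rem N) ntU; exact: H1.
Unshelve. all: by end_near. Qed.

Let Z_ge0 : 0 <= Z. Proof. by have [x _] := neOmega; apply: le_trans (uZ x). Qed.
(* As for power series, boundedness of the terms at z0 > Z gives geometric
   decay at all |z| <= Z, of ratio theta. *)
Let z0 : R := Z + 1.
Let theta : R := Z / z0.
Let z0_gt0 : 0 < z0. Proof. by rewrite ltr_wpDl. Qed.
Let theta_ge0 : 0 <= theta. Proof. by rewrite divr_ge0// ltW. Qed.
Let theta_lt1 : theta < 1. Proof. by rewrite /theta ltr_pdivrMr// mul1r ltrDl. Qed.

(* A term is the difference of two consecutive remainders, which are eventually
   at most 1; the finitely many others are bounded one by one. *)
Let term_bounded : exists2 C : R, 0 <= C & forall k x, (1 <= k)%N -> U x -> `|term k x z0| <= C.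
Proof.
have [N0 HN0] := @remainder_cvg z0 1 ltr01.
have [hc _] := ha.
have /choice[c Hc] : forall k, exists c : R, (1 <= k)%N -> forall x, U x -> `|term k x z0| <= c.
  move=> k; have [k1|k1] := leqP 1 k; last by exists 0.
  have [C [HC _]] := hoelder_spaceP ntU (hc k k1).
  exists (C * `|z0 ^+ k / k`!%:R|) => _ x Ux.
  by rewrite /term -mulrA normrM ler_wpM2r// HC.
exists (2 + \sum_(k < N0.+1) `|c k|); first by rewrite addr_ge0// sumr_ge0.
move=> k x k1 Ux; have [kN|Nk] := ltnP k N0.+1.
  apply: le_trans (Hc k k1 x Ux) _; apply: le_trans (ler_norm _) _.
  rewrite (bigD1 (Ordinal kN))//= addrCA lerDl addr_ge0// sumr_ge0//.
have H1 := HN0 k (ltnW Nk) x Ux.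
have H2 := HN0 k.+1 (leqW (ltnW Nk)) x Ux.
have E : term k x z0 = (a x z0 - partial_sum k x z0) - (a x z0 - partial_sum k.+1 x z0).
  by rewrite /partial_sum big_nat_recr//=; ring.
rewrite E (le_trans (ler_normB _ _))//.
have : 0 <= \sum_(k < N0.+1) `|c k| by exact: sumr_ge0.
lra.
Qed.

Let term_geometric : exists2 C : R, 0 <= C & forall k x z, (1 <= k)%N -> U x ->
  `|z| <= Z -> `|term k x z| <= C * theta ^+ k.
Proof.
have [C C0 HC] := term_bounded; exists C => // k x z k1 Ux zZ.
apply: (@le_trans _ _ (`|term k x z0| * theta ^+ k)).
  have zk : `|z ^+ k| <= `|z0 ^+ k| * theta ^+ k.
    rewrite !normrX (gtr0_norm z0_gt0) -exprMn /theta mulrCA mulfV ?(gt_eqF z0_gt0)//.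
    by rewrite mulr1 lerXn2r ?nnegrE.
  rewrite /term !normrM [leRHS]mulrAC ler_wpM2r// -mulrA ler_wpM2l//.
by rewrite ler_wpM2r ?exprn_ge0// HC.
Qed.

(** The hypothesis gives convergence for each [z] separately, whereas [u x]
    varies with [x]: the geometric bound on the terms makes the tail uniform
    in [|z| <= Z]. *)
Lemma nonlinearity_uniform_approx e : 0 < e -> exists N, forall x, U x ->
  `|a x (u x) - partial_sum N x (u x)| <= e.
Proof.
move=> e0; have [C C0 HC] := term_geometric.
have [N HN] : exists N : nat, C * theta ^+ N <= e / 2 * (1 - theta).
  have : theta ^+ N @[N --> \oo] --> (0 : R).
    by apply: cvg_expr; rewrite ger0_norm.
  move=> /cvgrPdist_le/(_ (e / 2 * (1 - theta) / (C + 1))).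
  have e1 : 0 < e / 2 * (1 - theta) by rewrite mulr_gt0 ?divr_gt0// subr_gt0.
  have C1 : 0 < C + 1 by rewrite ltr_wpDl.
  move=> /(_ (divr_gt0 e1 C1))[N _ /(_ N (leqnn _))]/=.
  rewrite sub0r normrN ger0_norm ?exprn_ge0// ler_pdivlMr// => HN.
  exists N; apply: le_trans HN; rewrite mulrC ler_wpM2l ?exprn_ge0//; lra.
exists N.+1 => x Ux.
have [N0 HN0] := @remainder_cvg (u x) (e / 2) (divr_gt0 e0 (ltr0n _ 2)).
pose M := maxn N0 N.+1.
have HM := HN0 M (leq_maxl _ _) x Ux.
have tail : `|partial_sum M x (u x) - partial_sum N.+1 x (u x)| <= e / 2.
  rewrite /partial_sum (@big_cat_nat _ _ _ N.+1 1 M)//= ?leq_maxr//.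
  rewrite addrAC subrr add0r.
  apply: le_trans (ler_norm_sum _ _ _) _.
  apply: (@le_trans _ _ (\sum_(N.+1 <= k < M) C * theta ^+ k)).
    rewrite !big_nat; apply: ler_sum => k /andP[Nk _].
    by apply: HC => //; exact: leq_ltn_trans Nk.
  rewrite -mulr_sumr -(@ler_pM2r _ (1 - theta)) ?subr_gt0//.
  apply: le_trans HN; rewrite -mulrA ler_wpM2l//.
  rewrite mulr_suml (eq_bigr (fun k => - theta ^+ k.+1 - - theta ^+ k)); last first.
    by move=> k _; rewrite exprS; ring.
  rewrite telescope_sumr ?leq_maxr// opprK.
  have := exprn_ge0 M theta_ge0.
  have : theta ^+ N.+1 <= theta ^+ N by rewrite exprS ler_piMl ?exprn_ge0// ltW.
  lra.
rewrite (_ : a x (u x) - _ = (a x (u x) - partial_sum M x (u x)) +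
  (partial_sum M x (u x) - partial_sum N.+1 x (u x))); last by ring.
by rewrite (le_trans (ler_normD _ _))//; lra.
Qed.

Lemma nonlinearity_bounded : exists C, forall x, U x -> `|a x (u x)| <= C.
Proof.
have [C C0 HC] := term_geometric.
have [N HN] := nonlinearity_uniform_approx ltr01.
exists (1 + \sum_(1 <= k < N) C * theta ^+ k) => x Ux.
rewrite -[a x (u x)](subrK (partial_sum N x (u x))) (le_trans (ler_normD _ _))//.
rewrite lerD ?HN// (le_trans (ler_norm_sum _ _ _))// !big_nat.
by apply: ler_sum => k /andP[k1 _]; exact: HC.
Qed.

(** A uniform limit of continuous functions of [x]. *)
Lemma nonlinearity_continuous x : Omega x -> {for x, continuous (fun x => a x (u x))}.
Proof.
move=> Ox; apply/(@cvgrPdist_le _ _ _ (nbhs x)) => e e0.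
have [N HN] := nonlinearity_uniform_approx (divr_gt0 e0 (ltr0n R 3)).
have nx : nbhs x Omega by exact: open_nbhs_nbhs.
have ct k : (1 <= k)%N -> {for x, continuous (fun x => term k x (u x))}.
  move=> k1; have [C [_ HC]] := hoelder_spaceP ntU (ha.1 k k1).
  have nU : nbhs x U by apply: filterS nx; exact: OU.
  have c1 : {for x, continuous (taylor_coef a k)} by exact: (hoelder_continuous_at s0 HC nU).
  have c2 : {for x, continuous (fun x => u x ^+ k)}.
    exact: (cvg_comp _ _ (@cu x) (@exprn_continuous R k (u x))).
  have c3 : {for x, continuous (fun _ : 'rV[R]_n => (k`!%:R : R)^-1)} by exact: cst_continuous.
  exact: (cvgM (cvgM c1 c2) c3).
have cN : {for x, continuous (fun x => partial_sum N x (u x))}.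
  rewrite /partial_sum; elim: (N) => [|[|m] IH].
  - rewrite (_ : (fun x => _) = cst 0); first exact: cst_continuous.
    by apply/funext => y; rewrite big_geq.
  - rewrite (_ : (fun x => _) = cst 0); first exact: cst_continuous.
    by apply/funext => y; rewrite big_geq.
  - rewrite (_ : (fun x => _) = (fun x => \sum_(1 <= k < m.+1) term k x (u x)) +
        (fun x => term m.+1 x (u x))).
      exact: (cvgD IH (ct m.+1 isT)).
    by apply/funext => y; rewrite big_nat_recr.
have := cN => /cvgrPdist_le/(_ _ (divr_gt0 e0 (ltr0n R 3))) H.
near=> y.
have Oy : Omega y by near: y.
have h1 := HN x (OU Ox); have h2 := HN y (OU Oy).
have h3 : `|partial_sum N x (u x) - partial_sum N y (u y)| <= e / 3 by near: y.
rewrite distrC in h2.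
rewrite (_ : a x (u x) - _ = (a x (u x) - partial_sum N x (u x)) +
  (partial_sum N x (u x) - partial_sum N y (u y)) +
  (partial_sum N y (u y) - a y (u y))); last by ring.
apply: le_trans (ler_normD _ _) _; apply: le_trans (lerD (ler_normD _ _) (lexx _)) _.
lra.
Unshelve. all: by end_near. Qed.

End nonlinearity.

(** * Testing against bump functions *)

Section testing.
Variables (R : realType) (n : nat).
Implicit Types (x y a b : 'rV[R]_n) (U D : set 'rV[R]_n) (h g : 'rV[R]_n -> R).
Let mu := leb R n.

Lemma measurable_fun_continuous_at U h : open U ->
  (forall x, U x -> {for x, continuous h}) -> measurable_fun U h.
Proof.
move=> oU ch; apply: (measurability _ (RGenOpens.measurableE R)) => //.
move=> _ [_ [a [b ->] <-]]; apply: open_measurable_rV.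
rewrite openE => x [Ux hx]; apply: filterI; first exact: open_nbhs_nbhs.
by apply: (ch x Ux); apply: open_nbhs_nbhs; split => //; exact: itv_open.
Qed.

(** Were [h] positive at [x], it would be so on a closed box around [x], and the
    integral against the bump of that box would be positive. *)
Lemma bump_test_le0 D U h : measurable D -> open U -> U `<=` D ->
  (forall x, U x -> {for x, continuous h}) ->
  (forall a b, cbox a b `<=` U -> mu.-integrable D (fun x => (h x * bump 0 a b x)%:E)) ->
  (forall a b, cbox a b `<=` U -> \int[mu]_(x in D) (h x * bump 0 a b x) = 0) ->
  forall x, U x -> h x <= 0.
Proof.
move=> mD oU UD ch ih h0 x Ux; rewrite leNgt; apply/negP => hx.
have nx : nbhs x (U `&` [set y | 0 < h y]).
  apply: filterI; first exact: open_nbhs_nbhs.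
  exact: (cvgr_gt (h x) (ch x Ux)) hx.
have [a [b [xab abU]]] := nbhs_cbox nx.
have abU' : cbox a b `<=` U by move=> y /abU[].
have bc : box a b `<=` cbox a b.
  by move=> y yab i; have /andP[/ltW -> /ltW ->] := yab i.
have : 0 < \int[mu]_(x in D) (h x * bump 0 a b x).
  apply: (@Rintegral_gt0 _ _ _ mu D (box a b)) => //.
  - exact: measurable_box.
  - by move=> y /bc/abU'/UD.
  - by apply: leb_box_gt0; exists x.
  - exact: ih.
  - move=> y _; have [yab|yab] := pselect (box a b y).
      have /bc/abU[_ /= hy] := yab.
      by rewrite mulr_ge0 ?(ltW hy)//; have /andP[] := bump_itv 0 a b y.
    by rewrite bump_eq0// mulr0.
  - by move=> y yab; have /bc/abU[_ /= hy] := yab; rewrite mulr_gt0// bump_gt0.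
by rewrite h0// ltxx.
Qed.

Lemma bump_test_eq0 D U h : measurable D -> open U -> U `<=` D ->
  (forall x, U x -> {for x, continuous h}) ->
  (forall a b, cbox a b `<=` U -> mu.-integrable D (fun x => (h x * bump 0 a b x)%:E)) ->
  (forall a b, cbox a b `<=` U -> \int[mu]_(x in D) (h x * bump 0 a b x) = 0) ->
  forall x, U x -> h x = 0.
Proof.
move=> mD oU UD ch ih h0 x Ux; apply/eqP; rewrite eq_le; apply/andP; split.
  exact: (bump_test_le0 mD oU UD ch ih h0).
rewrite -oppr_le0; apply: (@bump_test_le0 D U (fun x => - h x) mD oU UD) => //.
- by move=> y Uy; exact: (cvgN (ch y Uy)).
- move=> a b abU; have := integrableN (ih a b abU); apply: eq_integrable => // y _.
  by rewrite /= mulNr EFinN.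
- move=> a b abU; under eq_Rintegral do rewrite mulNr -mulN1r.
  by rewrite RintegralZl// ?h0 ?mulr0//; exact: ih.
Qed.

(** The sets on which [h] has zero integral, within a large box, form a
    lambda-system that contains the pi-system of boxes. *)
Lemma boxes_integral_eq0_ae h :
  (forall a b, mu.-integrable (box a b) (EFin \o h)) ->
  (forall a b, \int[mu]_(x in box a b) h x = 0) ->
  {ae mu, forall x, h x = 0}.
Proof.
move=> ih h0.
pose B (k : nat) : set 'rV[R]_n := box (const_mx (- k%:R)) (const_mx k%:R).
have mB k : measurable (B k) by exact: measurable_box.
pose H k : set (set 'rV[R]_n) := [set A | measurable A /\
  \int[mu]_(x in A `&` B k) h x = 0].
have iB k A : measurable A -> mu.-integrable (A `&` B k) (EFin \o h).
  move=> mA; apply: (@integrableS _ _ _ mu (B k)) => //; last exact: ih.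
  exact: measurableI.
have dH k : dynkin (H k).
  split.
  - by split; [exact: measurableT|rewrite setTI; exact: h0].
  - move=> A [mA A0]; split; first exact: measurableC.
    have E : B k = (A `&` B k) `|` (~` A `&` B k) by rewrite -setIUl setUv setTI.
    have := h0 (const_mx (- k%:R)) (const_mx k%:R); rewrite -/(B k) {1}E.
    rewrite Rintegral_setU ?A0 ?add0r//.
    + exact: measurableI.
    + by apply: measurableI => //; exact: measurableC.
    + by rewrite -E; exact: ih.
    + by apply/disj_setPS => x [[Ax _] [nAx _]].
  - move=> F tF HF; split; first by apply: bigcup_measurable => i _; exact: (HF i).1.
    rewrite setI_bigcupl /Rintegral integral_bigcup.
    + rewrite eseries0// => i _ _.
      rewrite -[LHS]fineK; first by congr (_%:E); exact: (HF i).2.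
      by apply: integrable_fin_num; [apply: measurableI => //|apply: iB]; exact: (HF i).1.
    + exact: trivIset_setIr.
    + by move=> i; apply: measurableI => //; exact: (HF i).1.
    + rewrite -setI_bigcupl; apply: iB.
      by apply: bigcup_measurable => i _; exact: (HF i).1.
have allH k A : measurable A -> H k A.
  rewrite measurable_boxes; move: A; apply: lambda_system_subset.
  - exact: setI_closed_boxes.
  - exact/dynkin_lambda_system/dH.
  - move=> _ [a [b ->]]; split; first exact: measurable_box.
    have [c [d ->]] : exists c d, box a b `&` B k = box c d.
      by apply: setI_closed_boxes; do 2 eexists.
    exact: h0.
  - by move=> X _.
have aeB k : {ae mu, forall x, B k x -> h x = 0}.
  have := @integral_ae_eq _ _ _ mu (B k) (mB k) (cst 0%E) (EFin \o h) (ih _ _)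
    (measurable_cst _) _.
  have H0 E : E `<=` B k -> measurable E ->
      (\int[mu]_(x in E) (EFin \o h) x = \int[mu]_(x in E) cst 0%E x)%E.
    move=> EB mE; rewrite integral0; have [_] := allH k E mE.
    rewrite (setIidl EB) /Rintegral => E0.
    rewrite -[LHS]fineK ?E0//; apply: integrable_fin_num => //.
    by have := iB k E mE; rewrite (setIidl EB).
  move=> /(_ H0); apply: filterS => x /= hx Bx.
  by have [] := hx Bx.
have := ae_foralln aeB; apply: filterS => x hx.
apply: (hx (Num.truncn (\sum_j `|x ord0 j|)).+1) => j; rewrite !mxE.
rewrite -ltr_norml; apply: le_lt_trans (truncnS_gt _).
by rewrite (bigD1 j)//= lerDl; exact: sumr_ge0.
Qed.

Lemma Lfun2_integrable_box g a b : g \in Lfun mu 2%:E ->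
  mu.-integrable (box a b) (EFin \o g).
Proof.
move=> g2; have mg : measurable_fun setT g.
  by move: g2; rewrite inE => /andP[+ _]; rewrite inE.
have mb : measurable (box a b) by exact: measurable_box.
have i1 : mu.-integrable (box a b) (EFin \o cst 1).
  apply: measurable_bounded_integrable => //; first exact: leb_box_lty.
  exact: bounded_cst.
(* |g| <= 1 + g^2, and boxes have finite measure. *)
have i2 := integrableS measurableT mb (@subsetT _ _) (Lfun2_integrable_sqr g2).
apply: (le_integrable mb _ _ (integrableD mb i1 i2)).
  by apply/measurable_EFinP; exact: measurable_funS mg.
move=> x _; rewrite /= lee_fin [leRHS]ger0_norm ?addr_ge0 ?sqr_ge0//.
rewrite -real_normK ?num_real//; have := normr_ge0 (g x); have := sqr_ge0 (`|g x| - 1); nra.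
Qed.

Lemma bump_restrict g a b k : (fun x => g x * bump k a b x) =
  (fun x => g x * bump k a b x) \_ (box a b).
Proof.
apply/funext => x; rewrite patchE; case: ifPn => // /negP xab.
by rewrite bump_eq0 ?mulr0// => H; apply: xab; rewrite inE.
Qed.

Lemma measurable_bump k a b D : measurable_fun D (@bump R n k a b).
Proof.
by apply: (measurable_funS measurableT) => //; exact: measurable_flat_alg (flat_alg_bump k a b).
Qed.

Lemma integrable_mul_bump g k a b : mu.-integrable (box a b) (EFin \o g) ->
  mu.-integrable setT (fun x => (g x * bump k a b x)%:E).
Proof.
move=> ig; have mb : measurable (box a b) by exact: measurable_box.
have : mu.-integrable (box a b) (fun x => (g x * bump k a b x)%:E).
  apply: (integrable_mul_bounded (M := 1) mb ig); first exact: measurable_bump.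
  by move=> x _; have /andP[b0 b1] := bump_itv k a b x; rewrite ger0_norm.
move/(integrable_mkcond _ mb); rewrite restrict_EFin.
by rewrite -(bump_restrict g a b k).
Qed.

(** Bumps converge boundedly to indicator functions of boxes, so the two
    functions have the same integral over each box. *)
Lemma Lfun2_test_ae_eq (g1 g2 : 'rV[R]_n -> R) :
  g1 \in Lfun mu 2%:E -> g2 \in Lfun mu 2%:E ->
  (forall phi, Cc_infty setT phi ->
    \int[mu]_x (g1 x * phi x) = \int[mu]_x (g2 x * phi x)) ->
  {ae mu, forall x, g1 x = g2 x}.
Proof.
move=> L1 L2 H.
have i1 a b := Lfun2_integrable_box a b L1.
have i2 a b := Lfun2_integrable_box a b L2.
have ih a b : mu.-integrable (box a b) (EFin \o (fun x => g1 x - g2 x)).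
  exact: (integrableB (measurable_box a b) (i1 a b) (i2 a b)).
suff : {ae mu, forall x, g1 x - g2 x = 0}.
  by apply: filterS => x /eqP; rewrite subr_eq0 => /eqP.
apply: boxes_integral_eq0_ae => // a b.
have mb : measurable (box a b) by exact: measurable_box.
have test k : \int[mu]_(x in box a b) ((g1 x - g2 x) * bump k a b x) = 0.
  rewrite Rintegral_mkcond -bump_restrict.
  under eq_Rintegral do rewrite mulrBl.
  have ib1 := integrable_mul_bump k (i1 a b); have ib2 := integrable_mul_bump k (i2 a b).
  rewrite (RintegralB measurableT ib1 ib2) H ?subrr//.
  exact: bump_Cc_infty.
have : (\int[mu]_(x in box a b) ((g1 x - g2 x) * bump k a b x)%:E)%E @[k --> \oo] -->
    (\int[mu]_(x in box a b) (g1 x - g2 x)%:E)%E.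
  apply: (dominated_cvg mb _ _ _ (integrable_abse (ih a b))).
  - move=> k; apply/measurable_EFinP; apply: measurable_funM; last exact: measurable_bump.
    by apply/measurable_EFinP; exact: measurable_int (ih a b).
  - move=> x xab; apply: cvg_EFin; first exact: nearW.
    have := @bump_cvg R n a b x; rewrite indicE mem_set// => bc.
    have c : (g1 x - g2 x) * bump k a b x @[k --> \oo] --> (g1 x - g2 x) * 1.
      by apply: cvgM; [exact: cvg_cst|exact: bc].
    by rewrite mulr1 in c; exact: c.
  - by [].
  - move=> k x xab; rewrite /= lee_fin normrM ler_piMr//.
    by have /andP[b0 b1] := bump_itv k a b x; rewrite ger0_norm.
have -> : (\int[mu]_(x in box a b) (g1 x - g2 x)%:E)%E =
    (\int[mu]_(x in box a b) (g1 x - g2 x))%:E.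
  by rewrite /Rintegral fineK//; exact: integrable_fin_num.
move=> /fine_cvg; rewrite (_ : fine \o _ = cst 0); last first.
  by apply/funext => k; exact: test.
by move=> c; apply: (@cvg_unique _ _ _ _ _ _ c) => //; exact: cvg_cst.
Qed.

End testing.

(** * Riesz potentials away from the support *)

Section riesz_potential.
Variables (R : realType) (n : nat).
Implicit Types (x y : 'rV[R]_n).
Let mu := leb R n.
Variables (K W : set 'rV[R]_n) (w : 'rV[R]_n -> R) (rho e q : R).
Hypothesis mK : measurable K.
Hypothesis K_rho : forall x, K x -> forall i, `|x ord0 i| <= rho.
Hypothesis e0 : 0 < e.
Hypothesis q0 : 0 < q.
Hypothesis We : forall x y, K x -> W y -> e ^+ 2 <= sqdist x y.
Hypothesis iw : mu.-integrable K (EFin \o w).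

Definition riesz_potential y := \int[mu]_(x in K) (w x * sqdist x y `^ (- q)).

Let e20 : 0 < e ^+ 2. Proof. by rewrite exprn_gt0. Qed.

Lemma integrable_riesz y : W y ->
  mu.-integrable K (fun x => (w x * sqdist x y `^ (- q))%:E).
Proof.
move=> Wy; apply: (integrable_mul_bounded (M := (e ^+ 2) `^ (- q)) mK iw).
  exact: measurable_sqdist_powR.
by move=> x Kx; rewrite ger0_norm ?powR_ge0// ler_powRN ?(ltW q0)//; exact: We.
Qed.

Let iabs : mu.-integrable K (fun x => `|w x|%:E). Proof. exact: integrable_norm. Qed.

Lemma riesz_potential_bounded : exists C, forall y, W y -> `|riesz_potential y| <= C.
Proof.
exists (\int[mu]_(x in K) (`|w x| * (e ^+ 2) `^ (- q))) => y Wy.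
have iy := integrable_riesz Wy.
rewrite (le_trans (le_normr_Rintegral _ iy))//; apply: le_Rintegral => //.
- exact: integrable_norm iy.
- exact: (integrableZr mK _ iabs).
- move=> x Kx; rewrite normrM ler_wpM2l// ger0_norm ?powR_ge0//.
  by rewrite ler_powRN ?(ltW q0)//; exact: We.
Qed.

Lemma riesz_potential_continuous y : open W -> W y ->
  {for y, continuous riesz_potential}.
Proof.
move=> oW Wy; apply/(@cvgrPdist_le _ _ _ (nbhs y)) => eps eps0.
have /nbhs_rVP[d d0 Wd] : nbhs y W by exact: open_nbhs_nbhs.
pose S := \sum_(i < n) 2 * (`|rho| + `|y ord0 i| + d).
have S0 : 0 <= S by apply: sumr_ge0 => i _; rewrite mulr_ge0// !addr_ge0// ltW.
pose L := q * (e ^+ 2) `^ (- (q + 1)).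
have L0 : 0 <= L by rewrite mulr_ge0 ?powR_ge0// ltW.
pose I := \int[mu]_(x in K) `|w x|.
have I0 : 0 <= I by exact: Rintegral_ge0.
have ILS0 : 0 <= I * (L * S) by exact: (mulr_ge0 I0 (mulr_ge0 L0 S0)).
pose eta := Num.min d (eps / (I * (L * S) + 1)).
have eta0 : 0 < eta by rewrite lt_min d0 divr_gt0// ltr_wpDl.
apply/nbhs_rVP; exists eta => // y' yy'.
have Wy' : W y' by apply: Wd => i; apply: lt_le_trans (yy' i) _; rewrite ge_min lexx.
have sd x : K x -> `|sqdist x y - sqdist x y'| <= S * eta.
  move=> Kx; rewrite /sqdist -sumrB (le_trans (ler_norm_sum _ _ _))// mulr_suml.
  apply: ler_sum => i _.
  rewrite (_ : _ - _ = (2 * x ord0 i - y ord0 i - y' ord0 i) *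
    (y' ord0 i - y ord0 i)); last by ring.
  rewrite normrM distrC ler_pM//; last by rewrite -distrC ltW.
  have h1 := K_rho Kx i; have h2 := ler_norm rho.
  have h3 : `|y' ord0 i| <= `|y ord0 i| + d.
    have := yy' i; rewrite lt_min => /andP[yd _].
    have := ler_distD (y ord0 i) (y' ord0 i) 0; rewrite !subr0 distrC; lra.
  rewrite distrC (le_trans (ler_normB _ _))//.
  rewrite (le_trans (lerD (ler_normB _ _) (lexx _)))// normrM normr_nat; lra.
have kd x : K x -> `|sqdist x y `^ (- q) - sqdist x y' `^ (- q)| <= L * S * eta.
  move=> Kx; rewrite -mulrA; apply: le_trans (ler_wpM2l L0 (sd x Kx)).
  apply: (@is_derive_lipschitz _ (fun t : R => t `^ (- q)) (fun t => - q * t `^ (- q - 1))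
    _ `[e ^+ 2, +oo[); rewrite ?in_itv/= ?andbT ?We//.
  + move=> t; rewrite in_itv/= andbT => et.
    by apply: is_derive1_powR; exact: lt_le_trans et.
  + move=> t; rewrite in_itv/= andbT => et.
    rewrite normrM normrN (gtr0_norm q0) (ger0_norm (powR_ge0 _ _)) /L ler_wpM2l ?(ltW q0)//.
    by rewrite -opprD ler_powRN// addr_ge0// ltW.
have iy := integrable_riesz Wy; have iy' := integrable_riesz Wy'.
rewrite /riesz_potential -(RintegralB mK iy iy').
have iB := integrableB mK iy iy'.
rewrite (le_trans (le_normr_Rintegral _ iB))//.
apply: (@le_trans _ _ (\int[mu]_(x in K) (`|w x| * (L * S * eta)))).
  apply: le_Rintegral => //; first exact: integrable_norm iB.
  - exact: (integrableZr mK _ iabs).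
  - by move=> x Kx; rewrite -mulrBr normrM ler_wpM2l// kd.
rewrite RintegralZr// -/I mulrA.
have : eta <= eps / (I * (L * S) + 1) by rewrite ge_min lexx orbT.
rewrite ler_pdivlMr ?ltr_wpDl// => h; have := ltW eta0; lra.
Qed.

End riesz_potential.

Lemma Rintegral_Fubini d1 d2 (T1 : measurableType d1) (T2 : measurableType d2)
    (R : realType) (m1 : {sigma_finite_measure set T1 -> \bar R})
    (m2 : {sigma_finite_measure set T2 -> \bar R}) (f : T1 -> T2 -> R) :
  (m1 \x m2)%E.-integrable setT (fun z => (f z.1 z.2)%:E) ->
  (forall x, m2.-integrable setT (EFin \o f x)) ->
  (forall y, m1.-integrable setT (EFin \o f ^~ y)) ->
  \int[m1]_x \int[m2]_y f x y = \int[m2]_y \int[m1]_x f x y.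
Proof.
move=> ifz i1 i2; congr fine.
transitivity (\int[m1]_x \int[m2]_y (f x y)%:E)%E.
  apply: eq_integral => x _; rewrite /Rintegral fineK//.
  exact: (integrable_fin_num measurableT (i1 x)).
transitivity (\int[m2]_y \int[m1]_x (f x y)%:E)%E; last first.
  apply: eq_integral => y _; rewrite /Rintegral fineK//.
  exact: (integrable_fin_num measurableT (i2 y)).
exact: (Fubini ifz).
Qed.

Lemma Rintegral_eq0 d (T : measurableType d) (R : realType)
    (mu : {measure set T -> \bar R}) (D : set T) (f : T -> R) :
  (forall x, f x = 0) -> \int[mu]_(x in D) f x = 0.
Proof. by move=> f0; rewrite /Rintegral integral0_eq// => x _; rewrite f0. Qed.

Section bump_pairing.
Variables (R : realType) (n : nat).
Implicit Types (x y a b : 'rV[R]_n).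
Let mu := leb R n.
Variables (K W : set 'rV[R]_n) (w : 'rV[R]_n -> R) (e q : R).
Hypothesis mK : measurable K.
Hypothesis e0 : 0 < e.
Hypothesis q0 : 0 < q.
Hypothesis We : forall x y, K x -> W y -> e ^+ 2 <= sqdist x y.
Hypothesis iw : mu.-integrable K (EFin \o w).
Hypothesis mw : measurable_fun setT w.
Hypothesis w0 : forall x, ~ K x -> w x = 0.

Let e20 : 0 < e ^+ 2. Proof. by rewrite exprn_gt0. Qed.

Let wK (g : 'rV[R]_n -> R) : (fun x => w x * g x) = (fun x => w x * g x) \_ K.
Proof.
apply/funext => x; rewrite patchE; case: ifPn => // /negP xK.
by rewrite w0 ?mul0r// => Kx; apply: xK; rewrite inE.
Qed.

Let iwT : mu.-integrable setT (EFin \o w).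
Proof.
have := iw; move/(integrable_mkcond _ mK); rewrite restrict_EFin.
rewrite (_ : w \_ K = w)//; apply/funext => x; rewrite patchE; case: ifPn => // /negP xK.
by rewrite w0// => Kx; apply: xK; rewrite inE.
Qed.

(** Fubini's theorem applies because the kernel is bounded for [x] in [K] and
    [y] in [W], and the bump lives on a box of finite measure. *)
Lemma bump_pairing a b : cbox a b `<=` W ->
  \int[mu]_x (w x * \int[mu]_y (bump 0 a b y * sqdist x y `^ (- q))) =
  \int[mu]_y (riesz_potential K w q y * bump 0 a b y).
Proof.
move=> abW.
have mb : measurable (box a b) by exact: measurable_box.
have bW y : box a b y -> W y.
  by move=> yab; apply: abW => i; have /andP[/ltW -> /ltW ->] := yab i.
pose C := (e ^+ 2) `^ (- q); have C0 : 0 <= C by exact: powR_ge0.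
pose f x y := w x * (bump 0 a b y * sqdist x y `^ (- q)).
have bC x y : K x -> `|bump 0 a b y * sqdist x y `^ (- q)| <= C * \1_(box a b) y.
  move=> Kx; rewrite indicE; have [yab|/negP yab] := boolP (y \in box a b); last first.
    by rewrite bump_eq0 ?mul0r ?normr0 ?mulr0// => H; apply: yab; rewrite inE.
  rewrite inE in yab; have /andP[b0 b1] := bump_itv 0 a b y.
  rewrite mulr1 normrM (ger0_norm b0) (ger0_norm (powR_ge0 _ _)).
  apply: (@le_trans _ _ (sqdist x y `^ (- q))); first by rewrite ler_piMl ?powR_ge0.
  by rewrite ler_powRN ?(ltW q0)// We//; exact: bW.
have fC x y : `|f x y| <= `|w x| * (C * \1_(box a b) y).
  rewrite /f normrM.
  have [Kx|/w0 ->] := pselect (K x); last by rewrite normr0 !mul0r.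
  by rewrite ler_wpM2l// bC.
have msq : measurable_fun setT (fun z : 'rV[R]_n * 'rV[R]_n => sqdist z.1 z.2 `^ (- q)).
  apply: measurable_fun_powR; apply: measurable_sum => i; apply: measurable_funX.
  apply: measurable_funB.
    exact: (measurableT_comp (measurable_coord i) measurable_fst).
  exact: (measurableT_comp (measurable_coord i) measurable_snd).
have mf : measurable_fun setT (fun z : 'rV[R]_n * 'rV[R]_n => f z.1 z.2).
  apply: measurable_funM; first exact: (measurableT_comp mw measurable_fst).
  apply: measurable_funM => //.
  by apply: (measurableT_comp _ measurable_snd); exact: measurable_bump.
have ibox : mu.-integrable setT (EFin \o (fun y => C * \1_(box a b) y)).
  apply/integrableP; split; first by apply/measurable_EFinP; apply: measurable_funM.
  under eq_integral => y _ do rewrite /= ger0_norm ?mulr_ge0// EFinM.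
  rewrite ge0_integralZl_EFin//; last by apply/measurable_EFinP; exact: measurable_indic.
  rewrite integral_indic// setIT lte_mul_pinfty// ?lee_fin//.
  exact: leb_box_lty.
have i1 x : mu.-integrable setT (EFin \o f x).
  apply: (le_integrable measurableT _ _ (integrableZl measurableT (`|w x|) ibox)).
    by apply/measurable_EFinP; exact: (measurableT_comp mf (measurable_pair1 x)).
  by move=> y _; rewrite /= lee_fin (le_trans (fC x y))// ler_norm.
have i2 y : mu.-integrable setT (EFin \o f ^~ y).
  apply: (le_integrable measurableT _ _ (integrableZr measurableT (C * \1_(box a b) y)
    (integrable_norm iwT))).
    by apply/measurable_EFinP; exact: (measurableT_comp mf (measurable_pair2 y)).
  by move=> x _; rewrite /= lee_fin (le_trans (fC x y))// ler_norm.
have i12 : (mu \x mu)%E.-integrable setT (fun z => (f z.1 z.2)%:E).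
  apply/integrable12ltyP; first exact/measurable_EFinP.
  set c : R := \int[mu]_y (C * \1_(box a b) y).
  apply: (@le_lt_trans _ _ (\int[mu]_x (`|w x| * c)%:E)%E).
    apply: ge0_le_integral => //.
    - by move=> x _; exact: integral_ge0.
    - have mfa : measurable_fun setT (fun z : 'rV[R]_n * 'rV[R]_n => `|(f z.1 z.2)%:E|%E).
        by apply: measurableT_comp => //; exact/measurable_EFinP.
      have := measurable_fun_fubini_tonelli_F (m2 := mu)
        (fun z : 'rV[R]_n * 'rV[R]_n => `|(f z.1 z.2)%:E|%E) mfa (fun z => abse_ge0 _).
      by [].
    - by apply/measurable_EFinP; apply: measurable_funM => //; exact: measurableT_comp.
    - move=> x _.
      apply: (@le_trans _ _ (\int[mu]_y (`|w x| * (C * \1_(box a b) y))%:E)%E).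
        apply: ge0_le_integral => //.
        + apply: measurableT_comp => //; exact: measurable_int (i1 x).
        + by apply/measurable_EFinP; do 2![apply: measurable_funM => //]; exact: measurable_indic.
        + by move=> y _; rewrite lee_fin; exact: fC.
      under eq_integral do rewrite EFinM.
      rewrite integralZl// EFinM /c /Rintegral fineK//.
      exact: (integrable_fin_num measurableT ibox).
  rewrite (_ : (fun x => _) = ((EFin \o (Num.norm \o w)) \* cst c%:E)%E).
    exact: (integrable_lty measurableT (integrableZr measurableT c (integrable_norm iwT))).
  by apply/funext => x; rewrite /= EFinM.
have E := Rintegral_Fubini i12 i1 i2.
transitivity (\int[mu]_x \int[mu]_y f x y).
  apply: eq_Rintegral => x _; rewrite /f.
  have [Kx|/w0 wx] := pselect (K x); last first.
    by rewrite wx mul0r Rintegral_eq0 => [//|y]; rewrite mul0r.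
  have ig : mu.-integrable setT (EFin \o (fun y => bump 0 a b y * sqdist x y `^ (- q))).
    apply: (le_integrable measurableT _ _ ibox).
      apply/measurable_EFinP; apply: measurable_funM; first exact: measurable_bump.
      exact: (measurableT_comp msq (measurable_pair1 x)).
    by move=> y _; exact: (etrans (lee_fin _ _) (le_trans (bC x y Kx) (ler_norm _))).
  exact: (esym (RintegralZl (w x) measurableT ig)).
rewrite E; apply: eq_Rintegral => y _; rewrite /f.
have [yab|yab] := pselect (box a b y); last first.
  have b0 : bump 0 a b y = 0 by exact: bump_eq0.
  by rewrite b0 mulr0 Rintegral_eq0 => [//|x]; rewrite mul0r mulr0.
have ik : mu.-integrable setT (EFin \o (fun x => w x * sqdist x y `^ (- q))).
  have := integrable_riesz mK e0 q0 We iw (bW y yab).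
  by move/(integrable_mkcond _ mK); rewrite restrict_EFin -wK.
have -> : riesz_potential K w q y = \int[mu]_x (w x * sqdist x y `^ (- q)).
  by rewrite /riesz_potential Rintegral_mkcond [in RHS]wK.
rewrite -(RintegralZr (bump 0 a b y) measurableT ik).
by apply: eq_Rintegral => x _; ring.
Qed.

End bump_pairing.

(** * Determination of the solution by exterior data *)

Section calderon.
Variables (R : realType) (n : nat).
Implicit Types (x y a b : 'rV[R]_n).
Let mu := leb R n.
Variables (K W : set 'rV[R]_n) (u1 u2 : 'rV[R]_n -> R) (rho s : R).
Hypothesis hn : (1 <= n)%N.
Hypothesis hs : 0 < s < 1.
Hypothesis cK : closed K.
Hypothesis K_rho : forall x, K x -> forall i, `|x ord0 i| <= rho.
Hypothesis oW : open W.
Hypothesis neW : W !=set0.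
Hypothesis WK : forall y, W y -> ~ K y.
Hypotheses (cu1 : continuous u1) (cu2 : continuous u2).
Hypotheses (iu1 : mu.-integrable setT (EFin \o u1)) (iu2 : mu.-integrable setT (EFin \o u2)).
Hypothesis u12 : forall x, ~ K x -> u1 x = u2 x.
Hypothesis u12W : eq_distr_on W (frac_lap_distr s u1) (frac_lap_distr s u2).

(** Testing with bumps near a point of [W] turns the hypothesis into the
    vanishing, around that point, of the Riesz potential of [u1 - u2] of exponent
    [n/2 + s], to which unique continuation applies. *)
Theorem fractional_calderon x : u1 x = u2 x.
Proof.
have mK : measurable K by exact: closed_measurable_rV.
pose w x := u1 x - u2 x.
have iw : mu.-integrable setT (EFin \o w).
  exact: (integrableB measurableT iu1 iu2).
have iwK : mu.-integrable K (EFin \o w) by exact: (integrableS measurableT mK).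
have cw : continuous w by move=> z; exact: (continuousB (@cu1 z) (@cu2 z)).
have mw : measurable_fun setT w by exact: continuous_measurable_rV.
have w0 z : ~ K z -> w z = 0 by move=> Kz; rewrite /w u12// subrr.
have [y0 Wy0] := neW.
have [e e0 W0] := sqdist_away oW WK Wy0.
pose W' : set 'rV[R]_n := ball y0 e.
have W'P y : W' y -> W y /\ forall x, K x -> e ^+ 2 <= sqdist x y.
  by move=> W'y; apply: W0 => j; have [_ /(_ ord0 j)] := W'y.
have oW' : open W' by exact: ball_open.
have W'W : W' `<=` W by move=> y /W'P[].
have We x' y : K x' -> W' y -> e ^+ 2 <= sqdist x' y by move=> Kx /W'P[_]; apply.
have [s0 s1] := andP hs.
pose q := (n%:R + 2 * s) / 2.
have q0 : 0 < q by have : 0 <= n%:R :> R by []; rewrite /q; lra.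
apply: subr0_eq; apply: (riesz_potential_unique_continuation mK K_rho oW' _ _ iwK cw w0 q0).
- by exists y0; exact: ballxx.
- by move=> y /W'W; exact: WK.
- by rewrite /q; lra.
move=> {x}y W'y.
have cG y' : W' y' -> {for y', continuous (riesz_potential K w q)}.
  exact: (riesz_potential_continuous mK K_rho e0 q0 We iwK).
have [C GC] := riesz_potential_bounded mK e0 q0 We iwK.
apply: (bump_test_eq0 (D := setT) (U := W') (h := riesz_potential K w q)) => // a b abW'.
  apply: integrable_mul_bump.
  have bW' : box a b `<=` W'.
    by move=> z zab; apply: abW' => i; have /andP[/ltW -> /ltW ->] := zab i.
  apply: measurable_bounded_integrable; [exact: measurable_box|exact: leb_box_lty| |].
    apply: (measurable_funS (open_measurable_rV oW') bW').
    exact: measurable_fun_continuous_at.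
  exists C; split; first exact: num_real.
  by move=> M CM z zab; exact: (le_trans (GC z (bW' z zab)) (ltW CM)).
rewrite -(bump_pairing mK e0 q0 We iwK mw w0 abW').
set psi := fun x => \int[mu]_y (bump 0 a b y * sqdist x y `^ (- q)).
have abW : cbox a b `<=` W by move=> z /abW'/W'W.
have [M phiM] := flat_alg_C11_bounded (flat_alg_bump 0 a b).
have phiM' x z : `|bump 0 a b x| <= M /\
    `|bump 0 a b (x + z) + bump 0 a b (x - z) - 2 * bump 0 a b x| <= M * `|z| ^+ 2.
  by have [] := phiM x z.
have mphi : measurable_fun setT (bump 0 a b) by exact: measurable_bump.
have mL := measurable_frac_lap hn hs mphi phiM'.
have [C' LC] := frac_lap_bounded hn hs mphi phiM'.
have i1 := integrable_mul_bounded measurableT iu1 mL (fun x _ => LC x).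
have i2 := integrable_mul_bounded measurableT iu2 mL (fun x _ => LC x).
(* Outside K both sides vanish with w; on K the bump is at distance at least e. *)
have wL x : w x * psi x = - (frac_lap_const n s)^-1 * (w x * frac_lap s (bump 0 a b) x).
  have [Kx|/w0 ->] := pselect (K x); last by rewrite !mul0r mulr0.
  rewrite (@frac_lap_off_support _ _ s _ x (e / 2)) ?divr_gt0//; last first.
    move=> z zb; have W'z : W' z.
      apply: abW'; apply: contrapT => zab; move/eqP: zb; apply; apply: bump_eq0 => H.
      by apply: zab => i; have /andP[/ltW -> /ltW ->] := H i.
    have := We x z Kx W'z; rewrite sqdistE ler_sqr ?nnegrE ?enorm_ge0 ?(ltW e0)//.
    by apply: lt_le_trans; rewrite ltr_pdivrMr// ltr_pMr// ltr1n.
  have ig : mu.-integrable setT (EFin \o (fun z => bump 0 a b z * sqdist x z `^ (- q))).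
    rewrite (_ : _ \o _ = fun z => (sqdist x z `^ (- q) * bump 0 a b z)%:E); last first.
      by apply/funext => z; rewrite /= mulrC.
    apply: integrable_mul_bump; apply: measurable_bounded_integrable.
    - exact: measurable_box.
    - exact: leb_box_lty.
    - apply: measurable_fun_powR; have -> : sqdist x = (fun z => sqdist z x).
        by apply/funext => z; exact: sqdistC.
      exact: measurable_sqdist.
    exists ((e ^+ 2) `^ (- q)); split; first exact: num_real.
    move=> B CB z zab; suff H : `|sqdist x z `^ (- q)| <= (e ^+ 2) `^ (- q).
      exact: (le_trans H (ltW CB)).
    rewrite ger0_norm ?powR_ge0// ler_powRN ?(ltW q0) ?exprn_gt0//; apply: We => //.
    by apply: abW' => i; have /andP[/ltW -> /ltW ->] := zab i.
  have -> : \int[mu]_y - (bump 0 a b y / enorm (x - y) `^ (n%:R + 2 * s)) = - psi x.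
    rewrite /psi -mulN1r -(RintegralZl _ measurableT ig).
    by apply: eq_Rintegral => z _; rewrite sqdist_powR powRN mulN1r.
  by field; exact: frac_lap_const_neq0.
transitivity (\int[mu]_x (- (frac_lap_const n s)^-1 * (w x * frac_lap s (bump 0 a b) x))).
  by apply: eq_Rintegral => x _; exact: wL.
have iwL := integrable_mul_bounded measurableT iw mL (fun x _ => LC x).
rewrite (RintegralZl _ measurableT iwL).
transitivity (- (frac_lap_const n s)^-1 *
  \int[mu]_x (u1 x * frac_lap s (bump 0 a b) x - u2 x * frac_lap s (bump 0 a b) x)).
  by congr (_ * _); apply: eq_Rintegral => x _; rewrite /w mulrBl.
rewrite (RintegralB measurableT i1 i2).
have := u12W (bump_Cc_infty 0 abW); rewrite /frac_lap_distr => ->.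
by rewrite subrr mulr0.
Qed.

End calderon.

(** * Determination of the nonlinearity along the solution *)

Section potential_identification.
Variables (R : realType) (n : nat) (s : R) (Omega : set 'rV[R]_n).
Implicit Types (a : 'rV[R]_n -> R -> R) (u f : 'rV[R]_n -> R).
Let mu := leb R n.
Hypothesis hn : (1 <= n)%N.
Hypothesis hs : 0 < s < 1.
Hypothesis oOmega : open Omega.
Hypothesis neOmega : Omega !=set0.
Hypothesis bOmega : bounded_set Omega.

Lemma bounded_coord (A : set 'rV[R]_n) : bounded_set A ->
  exists rho, forall x, A x -> forall i, `|x ord0 i| <= rho.
Proof.
move=> [M [_ H]]; exists (M + 1) => x Ax i.
apply: (le_trans (coord_le_norm x i) (H (M + 1) _ x Ax)); by rewrite ltrDl.
Qed.

Lemma bounded_coord_closure (A : set 'rV[R]_n) rho :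
  (forall x, A x -> forall i, `|x ord0 i| <= rho) ->
  forall x, closure A x -> forall i, `|x ord0 i| <= rho.
Proof.
move=> H x Ax i; apply/ler_addgt0Pr => e e0.
have [] := Ax [set y | forall i, `|x ord0 i - y ord0 i| < e].
  by apply/nbhs_rVP; exists e.
move=> y [Ay xy]; have := H y Ay i; have := ltW (xy i).
have := ler_normD (x ord0 i - y ord0 i) (y ord0 i); rewrite subrK; lra.
Qed.

(** Integrability holds because [u] is bounded and vanishes outside a box that
    contains both [Omega] and the support of the datum. *)
Lemma solution_regular a f u : compact (supp f) -> is_solution s Omega a f u ->
  [/\ continuous u, exists Z, forall x, `|u x| <= Z & mu.-integrable setT (EFin \o u)].
Proof.
move=> cf [hu [uL2 _] uf _].
have s0 : 0 < s by case/andP: hs.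
have nT : nontrivial [set: 'rV[R]_n] by apply: (nontrivial_nbhs (x := 0) hn); exact: filterT.
have [Z [uZ uH]] := hoelder_spaceP nT hu.
have cu : continuous u.
  by move=> x; apply: (hoelder_continuous_at s0 uH); exact: filterT.
have bu x : `|u x| <= Z by exact: uZ.
split => //; first by exists Z.
have [rho1 Hr1] := bounded_coord bOmega.
have [rho2 Hr2] := bounded_coord (compact_bounded cf).
have cr1 := bounded_coord_closure Hr1.
pose r := Num.max rho1 rho2 + 1.
have u0 x : ~ box (const_mx (- r)) (const_mx r) x -> u x = 0.
  move=> xr; have [|xO] := pselect (closure Omega x).
    move=> xO; exfalso; apply: xr => i; have := cr1 x xO i; rewrite !mxE ler_norml /r.
    have : rho1 <= Num.max rho1 rho2 by rewrite le_max lexx.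
    lra.
  rewrite uf//; apply: contrapT => /eqP fx; apply: xr => i.
  have /(_ i) : forall i, `|x ord0 i| <= rho2 by apply: Hr2; exact: subset_closure.
  rewrite !mxE ler_norml /r.
  have : rho2 <= Num.max rho1 rho2 by rewrite le_max lexx orbT.
  lra.
have mb : measurable (box (const_mx (- r)) (const_mx r) : set 'rV[R]_n) by exact: measurable_box.
have iu : mu.-integrable (box (const_mx (- r)) (const_mx r)) (EFin \o u).
  apply: measurable_bounded_integrable => //; [exact: leb_box_lty| |].
    by apply: (measurable_funS measurableT) => //; exact: continuous_measurable_rV.
  exists Z; split; first exact: num_real.
  by move=> M ZM x _; exact: (le_trans (bu x) (ltW ZM)).
have := iu; move/(integrable_mkcond _ mb); rewrite restrict_EFin.
rewrite (_ : u \_ _ = u)//; apply/funext => x; rewrite patchE; case: ifPn => // /negP xK.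
by rewrite u0// => H; apply: xK; rewrite inE.
Qed.

(** The two representatives of [(-Delta)^(s/2) u] agree almost everywhere, so the
    terms that contain them cancel in the difference of the weak formulations. *)
Lemma same_solution_same_nonlinearity a1 a2 f u : compact (supp f) ->
  holomorphic_Cs s Omega a1 -> holomorphic_Cs s Omega a2 ->
  is_solution s Omega a1 f u -> is_solution s Omega a2 f u ->
  forall x, Omega x -> a1 x (u x) = a2 x (u x).
Proof.
move=> cf ha1 ha2 u1 u2.
have s0 : 0 < s by case/andP: hs.
have hs2 : 0 < s / 2 < 1 by case/andP: hs => ? ?; lra.
have [cu [Z uZ] _] := solution_regular cf u1.
have [_ _ _ [g1 [[L1 G1] E1]]] := u1.
have [_ _ _ [g2 [[L2 G2] E2]]] := u2.
have g12 : {ae mu, forall x, g1 x = g2 x}.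
  by apply: Lfun2_test_ae_eq => // phi hphi; rewrite -G1// -G2.
have mO : measurable Omega by exact: open_measurable_rV.
have Ooo : (mu Omega < +oo)%E.
  have [rho Hr] := bounded_coord bOmega.
  apply: le_lt_trans (leb_box_lty (const_mx (- (rho + 1))) (const_mx (rho + 1))).
  apply: le_measure; rewrite ?inE//; first exact: measurable_box.
  by move=> x /Hr H i; have := H i; rewrite !mxE ler_norml; lra.
have iA a : holomorphic_Cs s Omega a -> mu.-integrable Omega (EFin \o (fun x => a x (u x))).
  move=> ha; have [C AC] := nonlinearity_bounded hn oOmega neOmega ha uZ.
  apply: measurable_bounded_integrable => //.
    apply: measurable_fun_continuous_at => //.
    exact: (nonlinearity_continuous hn s0 oOmega neOmega ha cu uZ).
  exists C; split; first exact: num_real.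
  move=> M CM x Ox; exact: (le_trans (AC x (subset_closure Ox)) (ltW CM)).
have iAb a p q : holomorphic_Cs s Omega a ->
    mu.-integrable Omega (fun x => (a x (u x) * bump 0 p q x)%:E).
  move=> ha; apply: (integrable_mul_bounded mO (iA a ha) (M := 1)); first exact: measurable_bump.
  by move=> x _; have /andP[b0 b1] := bump_itv 0 p q x; rewrite ger0_norm.
move=> x Ox; apply: subr0_eq.
apply: (bump_test_eq0 (D := Omega) (U := Omega) (h := fun x => a1 x (u x) - a2 x (u x))) => //.
- move=> y Oy; apply: continuousB.
    exact: (nonlinearity_continuous hn s0 oOmega neOmega ha1 cu uZ).
  exact: (nonlinearity_continuous hn s0 oOmega neOmega ha2 cu uZ).
- move=> p q _; rewrite (_ : (fun x => _) =
    ((fun x => (a1 x (u x) * bump 0 p q x)%:E) \- (fun x => (a2 x (u x) * bump 0 p q x)%:E))%E).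
    by apply: integrableB => //; exact: iAb.
  by apply/funext => y; rewrite /= mulrBl.
move=> p q pq; have bC := bump_Cc_infty 0 pq.
transitivity (\int[mu]_(x in Omega) (a1 x (u x) * bump 0 p q x - a2 x (u x) * bump 0 p q x)).
  by apply: eq_Rintegral => y _; rewrite mulrBl.
rewrite (RintegralB mO (iAb _ p q ha1) (iAb _ p q ha2)).
have [M phiM] := flat_alg_C11_bounded (flat_alg_bump 0 p q).
have phiM' y z : `|bump 0 p q y| <= M /\
    `|bump 0 p q (y + z) + bump 0 p q (y - z) - 2 * bump 0 p q y| <= M * `|z| ^+ 2.
  by have [] := phiM y z.
have mL := measurable_frac_lap hn hs2 (@measurable_bump _ _ 0 p q setT) phiM'.
have := E1 _ bC; have := E2 _ bC.
have mLfun (g : 'rV[R]_n -> R) : g \in Lfun mu 2%:E -> measurable_fun setT g.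
  by rewrite inE => /andP[+ _]; rewrite inE.
suff -> : \int[leb R n]_x (g1 x * frac_lap (s / 2) (bump 0 p q) x) =
   \int[leb R n]_x (g2 x * frac_lap (s / 2) (bump 0 p q) x).
  by move=> e2 e1; have /addrI -> := etrans e1 (esym e2); rewrite subrr.
congr fine; apply: ae_eq_integral => //.
- by apply/measurable_EFinP; apply: measurable_funM => //; exact: mLfun.
- by apply/measurable_EFinP; apply: measurable_funM => //; exact: mLfun.
by apply: filterS g12 => y gy _; rewrite gy.
Qed.

End potential_identification.

Unset Implicit Arguments.
Set Strict Implicit.
Set Printing Implicit Defensive.

Theorem theorem5p1 (R : realType) (n : nat) (s : R)
    (Omega W1 W2 : set 'rV[R]_n)
    (a1 a2 : 'rV[R]_n -> R -> R) (eps1 delta1 eps2 delta2 : R)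
    (hn : (1 <= n)%N) (hs : 0 < s < 1)
    (hOmega : is_domain Omega) (bOmega : bounded_set Omega)
    (rOmega : C11_boundary Omega)
    (oW1 : open W1) (neW1 : W1 !=set0)
    (cW1 : compactly_inside W1 (exterior Omega))
    (oW2 : open W2) (neW2 : W2 !=set0)
    (cW2 : compactly_inside W2 (exterior Omega))
    (ha1 : admissible s Omega a1) (ha2 : admissible s Omega a2)
    (wp1 : well_posed s Omega a1 eps1 delta1)
    (wp2 : well_posed s Omega a2 eps2 delta2) :
  exists2 delta : R, 0 < delta &
    forall f : 'rV[R]_n -> R,
      Cc_infty W1 f -> f <> cst 0 -> Cc_norm f < delta ->
      let u1 := small_solution s Omega a1 delta1 f in
      let u2 := small_solution s Omega a2 delta2 f in
      [/\ unique (is_small_solution s Omega a1 delta1 f) u1,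
          unique (is_small_solution s Omega a2 delta2 f) u2 &
          eq_distr_on W2 (DN_map s Omega a1 delta1 f)
                         (DN_map s Omega a2 delta2 f) ->
          u1 = u2 /\ forall x, Omega x -> a1 x (u1 x) = a2 x (u1 x)].
Proof.
have oO : open Omega by case: hOmega.
have neO : Omega !=set0 by case: hOmega.
have [_ _ hol1] := ha1; have [_ _ hol2] := ha2.
have [e1 d1 ex1] := wp1; have [e2 d2 ex2] := wp2.
have W1E : W1 `<=` exterior Omega by move=> x W1x; apply: cW1.2; exact: subset_closure.
have W2E y : W2 y -> ~ closure Omega y by move=> W2y; apply: cW2.2; exact: subset_closure.
exists (Num.min eps1 eps2); first by rewrite lt_min e1.
move=> f hf _; rewrite lt_min => /andP[f1 f2] u1 u2.
have fE : Cc_infty (exterior Omega) f by case: hf => ? ? fW; split => //; exact: subset_trans W1E.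
have [v1 [sv1 uv1]] := ex1 f fE (ltW f1).
have [v2 [sv2 uv2]] := ex2 f fE (ltW f2).
have U1 : is_small_solution s Omega a1 delta1 f u1.
  exact: (@xgetPex _ (cst 0) [set u | is_small_solution s Omega a1 delta1 f u]
    (ex_intro _ v1 sv1)).
have U2 : is_small_solution s Omega a2 delta2 f u2.
  exact: (@xgetPex _ (cst 0) [set u | is_small_solution s Omega a2 delta2 f u]
    (ex_intro _ v2 sv2)).
split.
- by split => // u hu; rewrite -(uv1 _ U1); exact: uv1.
- by split => // u hu; rewrite -(uv2 _ U2); exact: uv2.
move=> DN; have [_ cf _] := hf.
have [S1 _] := U1; have [S2 _] := U2.
have [cu1 _ iu1] := solution_regular hn hs bOmega cf S1.
have [cu2 _ iu2] := solution_regular hn hs bOmega cf S2.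
have [rho /bounded_coord_closure Hrho] := bounded_coord bOmega.
have u12 : u1 = u2.
  apply/funext; apply: (fractional_calderon hn hs (@closed_closure _ Omega) Hrho
    oW2 neW2 W2E cu1 cu2 iu1 iu2) => // x xO.
  by have [_ _ -> //] := S1; have [_ _ -> //] := S2.
split=> //; apply: (same_solution_same_nonlinearity hn hs oO neO bOmega cf hol1 hol2 S1).
by rewrite u12.
Qed.
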